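(* Let $U$ be a Hopf algebra, $H\subseteq U$ a Hopf subalgebra and $N_1,\dots,N_T$ ($T\ge1$) subalgebras of $U$ such that the multiplication induces a linear isomorphism $$\mu:N_1\otimes\cdots\otimes N_T\otimes H\to U.$$ Assume that for all $1\le l\le T$, $N_lH$ is a Hopf subalgebra of $U$, the projection $\pi_l:N_lH\to H$ defined by $\pi_l(nh)=\varepsilon(n)h$ ($n\in N_l$, $h\in H$) is a Hopf algebra map, and $N_l=(N_lH)^{\mathrm{co}\,\pi_l}$. Assume moreover that $H$ is cosemisimple and that, for all $1\le l\le T$, $N_l=\oplus_{i\in\mathbb{N}}N_l(i)$ is a coradically graded Hopf algebra in ${}_H^H\mathcal{YD}$. For ${\bf i}=(i_1,\dots,i_T)\in\mathbb{N}^T$ let $$U({\bf i})=\mu\bigl(N_1(i_1)\otimes\cdots\otimes N_T(i_T)\otimes H\bigr).$$ Then $U=\oplus_{{\bf i}\in\mathbb{N}^T}U({\bf i})$ is a coradically $\mathbb{N}^T$-graded coalgebra.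
   Context: The ground field $\Bbbk$ is algebraically closed of characteristic $0$, and $0\in\mathbb{N}$. ${}_H^H\mathcal{YD}$ is the braided category of (left-left) Yetter-Drinfeld modules over $H$. $(N_lH)^{\mathrm{co}\,\pi_l}=\{a\in N_lH:(\mathrm{id}\otimes\pi_l)\Delta(a)=a\otimes1\}$. Under the stated conditions $N_l$ is a braided Hopf algebra in ${}_H^H\mathcal{YD}$, with action the adjoint action $h\cdot n=h_{(1)}n\mathcal{S}(h_{(2)})$, coaction $(\pi_l\otimes\mathrm{id})\Delta$ and braided comultiplication $\Delta_l(n)=n_{(1)}\mathcal{S}(\pi_l(n_{(2)}))\otimes n_{(3)}$. Moreover $N_lH\simeq N_l\#H$ (bosonization). For ${\bf i}=(i_1,\dots,i_T)\in\mathbb{N}^T$ put $|{\bf i}|=i_1+\cdots+i_T$. An $\mathbb{N}^T$-graded coalgebra is a coalgebra $C=\oplus_{{\bf i}\in\mathbb{N}^T}C({\bf i})$ with $\Delta C({\bf i})\subset\oplus_{\bf j}C({\bf j})\otimes C({\bf i}-{\bf j})$. It is coradically graded if, for all $n\in\mathbb{N}$, the $n$-th term of its coradical filtration is $C_n=\oplus_{|{\bf i}|\le n}C({\bf i})$. A coradically graded Hopf algebra in ${}_H^H\mathcal{YD}$ is an $\mathbb{N}$-graded braided Hopf algebra in ${}_H^H\mathcal{YD}$ (with homogeneous components Yetter-Drinfeld submodules) whose underlying graded coalgebra (here $(N_l,\Delta_l)$) is coradically graded. *)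

(* Defs.v *)
From HB Require Import structures.
From mathcomp Require Import all_boot all_algebra.
From mathcomp Require Import boolp classical_sets.

Set Implicit Arguments.
Unset Strict Implicit.
Unset Printing Implicit Defensive.

Import GRing.Theory.
Local Open Scope classical_set_scope.
Local Open Scope ring_scope.

(* The tensor product V (x) W: finite formal sums of pairs (v, w) modulo the    *)
(* congruence generated by bilinearity. Scalars are carried by the first       *)
(* component of the pairs.                                                     *)
Section TensorCarrier.
Variables (k : comNzRingType) (V W : lmodType k).

Inductive tens_eq : seq (V * W) -> seq (V * W) -> Prop :=
| tens_eq_refl s : tens_eq s s
| tens_eq_sym s t : tens_eq s t -> tens_eq t s
| tens_eq_trans s t u : tens_eq s t -> tens_eq t u -> tens_eq s u
| tens_eq_cat s s' t t' :
    tens_eq s s' -> tens_eq t t' -> tens_eq (s ++ t) (s' ++ t')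
| tens_eq_catC s t : tens_eq (s ++ t) (t ++ s)
| tens_eq_Dl v v' w : tens_eq [:: (v + v', w)] [:: (v, w); (v', w)]
| tens_eq_Dr v w w' : tens_eq [:: (v, w + w')] [:: (v, w); (v, w')]
| tens_eq_Z a v w : tens_eq [:: (a *: v, w)] [:: (v, a *: w)]
| tens_eq_0 w : tens_eq [:: (0, w)] [::].

Definition tens_eqb s t := `[< tens_eq s t >].

Lemma tens_eqb_equiv : equiv_class_of tens_eqb.
Proof.
split.
- by move=> s; apply/asboolP/tens_eq_refl.
- by move=> s t; apply/asboolP/asboolP; apply: tens_eq_sym.
- by move=> s t u /asboolP h1 /asboolP h2; apply/asboolP/(tens_eq_trans h1 h2).
Qed.

Canonical tens_equiv := EquivRelPack tens_eqb_equiv.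

Definition tens := {eq_quot tens_equiv}%qT.

HB.instance Definition _ := Choice.on tens.
HB.instance Definition _ := EqQuotient.on tens.

Lemma tensP (s t : seq (V * W)) :
  (\pi_tens s = \pi_tens t)%qT <-> tens_eq s t.
Proof.
by split=> [/eqmodP/asboolP|h] //; apply/eqmodP/asboolP.
Qed.

Lemma repr_tens s : tens_eq (repr (\pi_tens s)%qT) s.
Proof. by apply/tensP; rewrite reprK. Qed.

Lemma tensW (P : tens -> Prop) :
  (forall s, P (\pi_tens s)%qT) -> forall x, P x.
Proof. by move=> h x; rewrite -[x]reprK. Qed.

Definition tens_zero : tens := (\pi_tens [::])%qT.
Definition tens_add (x y : tens) : tens := (\pi_tens (repr x ++ repr y))%qT.
Definition tens_scale (a : k) (x : tens) : tens :=
  (\pi_tens [seq (a *: p.1, p.2) | p <- repr x])%qT.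
Definition tens_opp (x : tens) : tens := tens_scale (-1) x.

Lemma tens_addE s t :
  tens_add (\pi_tens s)%qT (\pi_tens t)%qT = (\pi_tens (s ++ t))%qT.
Proof. by apply/tensP/tens_eq_cat; apply: repr_tens. Qed.

Lemma tens_eq_scale a s t : tens_eq s t ->
  tens_eq [seq (a *: p.1, p.2) | p <- s] [seq (a *: p.1, p.2) | p <- t].
Proof.
elim=> {s t} /= [s|s t _ h|s t u _ h1 _ h2|s s' t t' _ h1 _ h2|s t|v v' w
  |v w w'|b v w|w].
- exact: tens_eq_refl.
- exact: tens_eq_sym.
- exact: tens_eq_trans h1 h2.
- by rewrite !map_cat; apply: tens_eq_cat.
- by rewrite !map_cat; apply: tens_eq_catC.
- by rewrite scalerDr; apply: tens_eq_Dl.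
- exact: tens_eq_Dr.
- by rewrite scalerA mulrC -scalerA; apply: tens_eq_Z.
- by rewrite scaler0; apply: tens_eq_0.
Qed.

Lemma tens_scaleE a s : tens_scale a (\pi_tens s)%qT =
  (\pi_tens [seq (a *: p.1, p.2) | p <- s])%qT.
Proof. by apply/tensP/tens_eq_scale/repr_tens. Qed.

Lemma tens_addA : associative tens_add.
Proof.
move=> x y z; elim/tensW: x => s; elim/tensW: y => t; elim/tensW: z => u.
by rewrite !tens_addE catA.
Qed.

Lemma tens_addC : commutative tens_add.
Proof.
move=> x y; elim/tensW: x => s; elim/tensW: y => t; rewrite !tens_addE.
exact/tensP/tens_eq_catC.
Qed.

Lemma tens_add0 : left_id tens_zero tens_add.
Proof. by move=> x; elim/tensW: x => s; rewrite tens_addE. Qed.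

Lemma tens_scaleDl (x : tens) (a b : k) :
  tens_scale (a + b) x = tens_add (tens_scale a x) (tens_scale b x).
Proof.
elim/tensW: x => s; rewrite !tens_scaleE tens_addE; apply/tensP.
elim: s => [|[v w] s IHs] /=; first exact: tens_eq_refl.
rewrite scalerDl.
have h := tens_eq_cat (tens_eq_Dl (a *: v) (b *: v) w) IHs.
apply: tens_eq_trans h _; rewrite /= -cat_rcons -cats1.
set A := map _ s; set B := map _ s; set p := (a *: v, w); set q := (b *: v, w).
apply: (@tens_eq_cat [:: p] [:: p] (([:: q] ++ A) ++ B) ((A ++ [:: q]) ++ B)).
  exact: tens_eq_refl.
by apply: tens_eq_cat; [apply: tens_eq_catC|apply: tens_eq_refl].
Qed.

Lemma tens_scale0 (x : tens) : tens_scale 0 x = tens_zero.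
Proof.
elim/tensW: x => s; rewrite tens_scaleE; apply/tensP.
elim: s => [|[v w] s IHs] /=; first exact: tens_eq_refl.
rewrite scale0r.
exact: (tens_eq_cat (tens_eq_0 w) IHs).
Qed.

Lemma tens_scale1 (x : tens) : tens_scale 1 x = x.
Proof.
elim/tensW: x => s; rewrite tens_scaleE; congr (\pi_tens _)%qT.
by rewrite -[RHS]map_id; apply: eq_map => -[v w] /=; rewrite scale1r.
Qed.

Lemma tens_addN : left_inverse tens_zero tens_opp tens_add.
Proof.
move=> x; rewrite /tens_opp -{2}(tens_scale1 x) -tens_scaleDl addNr.
exact: tens_scale0.
Qed.

Lemma tens_scaleA a b (x : tens) :
  tens_scale a (tens_scale b x) = tens_scale (a * b) x.
Proof.
elim/tensW: x => s; rewrite !tens_scaleE -map_comp; congr (\pi_tens _)%qT.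
by apply: eq_map => -[v w] /=; rewrite scalerA.
Qed.

Lemma tens_scaleDr : right_distributive tens_scale tens_add.
Proof.
move=> a x y; elim/tensW: x => s; elim/tensW: y => t.
by rewrite tens_addE !tens_scaleE tens_addE map_cat.
Qed.

HB.instance Definition _ :=
  GRing.isZmodule.Build tens tens_addA tens_addC tens_add0 tens_addN.
HB.instance Definition _ := GRing.Zmodule_isLmodule.Build k tens
  tens_scaleA tens_scale1 tens_scaleDr tens_scaleDl.

Definition ptens (v : V) (w : W) : tens := (\pi_tens [:: (v, w)])%qT.

End TensorCarrier.

Notation "v *t w" := (ptens v w) (at level 40, left associativity) : ring_scope.

Section TensorLift.
Variables (k : comNzRingType) (V W X : lmodType k).
Implicit Types (f : V -> W -> X) (v : V) (w : W) (x : tens V W).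

Lemma ptensDl v v' w : (v + v') *t w = v *t w + v' *t w.
Proof.
by rewrite [RHS]tens_addE; apply/tensP/tens_eq_Dl.
Qed.

Lemma ptensDr v w w' : v *t (w + w') = v *t w + v *t w'.
Proof.
by rewrite [RHS]tens_addE; apply/tensP/tens_eq_Dr.
Qed.

Lemma ptensZl a v w : (a *: v) *t w = a *: (v *t w).
Proof. by rewrite [RHS]tens_scaleE. Qed.

Lemma ptensZr a v w : v *t (a *: w) = a *: (v *t w).
Proof. by rewrite -ptensZl; apply/esym/tensP/tens_eq_Z. Qed.

Lemma ptens0l w : (0 : V) *t w = 0.
Proof. by rewrite -(scale0r 0) ptensZl scale0r. Qed.

Lemma ptens_sum x : exists s : seq (V * W), x = \sum_(p <- s) p.1 *t p.2.
Proof.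
move: x; apply: tensW => s; exists s.
elim: s => [|[v w] s IHs]; first by rewrite big_nil.
by rewrite big_cons -IHs [RHS]tens_addE.
Qed.

Lemma tens_ind (P : tens V W -> Prop) :
  (forall v w, P (v *t w)) -> P 0 -> (forall x y, P x -> P y -> P (x + y)) ->
  forall x, P x.
Proof.
move=> Pt P0 PD x; have [s ->] := ptens_sum x.
by apply: big_ind => // p _; apply: Pt.
Qed.

(* The map v (x) w |-> f v w; meaningful for bilinear f only (see tliftE).     *)
Definition tlift f x : X := \sum_(p <- repr x) f p.1 p.2.

Lemma tlift_pi f (hf : bilinear_for *:%R *:%R f) s :
  tlift f (\pi_(tens V W) s)%qT = \sum_(p <- s) f p.1 p.2.
Proof.
have fPl a v v' w : f (a *: v + v') w = a *: f v w + f v' w := hf.1 w a v v'.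
have fPr a v w w' : f v (a *: w + w') = a *: f v w + f v w' := hf.2 v a w w'.
have fDl v v' w : f (v + v') w = f v w + f v' w.
  by rewrite -[v in LHS]scale1r fPl scale1r.
have fDr v w w' : f v (w + w') = f v w + f v w'.
  by rewrite -[w in LHS]scale1r fPr scale1r.
have f0l w : f 0 w = 0 by apply: (@addIr _ (f 0 w)); rewrite -fDl !add0r.
have f0r v : f v 0 = 0 by apply: (@addIr _ (f v 0)); rewrite -fDr !add0r.
have fZl a v w : f (a *: v) w = a *: f v w by rewrite -[_ *: v]addr0 fPl f0l addr0.
have fZr a v w : f v (a *: w) = a *: f v w by rewrite -[_ *: w]addr0 fPr f0r addr0.
rewrite /tlift; move: (repr_tens s); set t := repr _; move: t => t.
elim=> {s t} //=.
- by move=> s t u _ -> _ ->.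
- by move=> s s' t t' _ h1 _ h2; rewrite !big_cat h1 h2.
- by move=> s t; rewrite !big_cat /= addrC.
- by move=> v v' w; rewrite !big_cons !big_nil /= fDl !addr0.
- by move=> v w w'; rewrite !big_cons !big_nil /= fDr !addr0.
- by move=> a v w; rewrite !big_cons !big_nil /= fZl fZr.
- by move=> w; rewrite big_cons !big_nil /= f0l addr0.
Qed.

Lemma tliftE f (hf : bilinear_for *:%R *:%R f) v w : tlift f (v *t w) = f v w.
Proof. by rewrite tlift_pi // big_seq1. Qed.

Lemma tlift_linear f (hf : bilinear_for *:%R *:%R f) : linear (tlift f).
Proof.
move=> a x y; elim/tensW: x => s; elim/tensW: y => t.
rewrite [a *: _]tens_scaleE [_ + _ in LHS]tens_addE !tlift_pi //.
rewrite big_cat big_map scaler_sumr /=; congr (_ + _); apply: eq_bigr => p _.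
have fPl b v v' w : f (b *: v + v') w = b *: f v w + f v' w := hf.1 w b v v'.
have f0 : f 0 p.2 = 0.
  apply: (@addIr _ (f 0 p.2)); rewrite add0r.
  by have := fPl 1 0 0 p.2; rewrite scaler0 addr0 scale1r => <-.
by rewrite -[_ *: p.1]addr0 fPl f0 addr0.
Qed.

End TensorLift.

Lemma eq_tlift (k : comNzRingType) (V W X : lmodType k) (f g : V -> W -> X) :
  f =2 g -> tlift f =1 tlift g.
Proof. by move=> fg x; apply: eq_bigr => p _; apply: fg. Qed.

Section TensorMap.
Variables (k : comNzRingType) (V V' W W' : lmodType k).
Variables (f : {linear V -> V'}) (g : {linear W -> W'}).

Definition tmap : tens V W -> tens V' W' := tlift (fun v w => f v *t g w).

Lemma tmap_bilinear : bilinear_for *:%R *:%R (fun v w => f v *t g w).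
Proof.
by split=> [w|v] a x y; rewrite linearP ?ptensDl ?ptensDr ?ptensZl ?ptensZr.
Qed.

Lemma tmapE v w : tmap (v *t w) = f v *t g w.
Proof. exact: tliftE tmap_bilinear v w. Qed.

HB.instance Definition _ :=
  GRing.isLinear.Build k _ _ _ tmap (tlift_linear tmap_bilinear).

End TensorMap.

Lemma linear_pack (k : pzRingType) (V W : lmodType k) (f : V -> W) :
  linear f -> exists g : {linear V -> W}, g =1 f.
Proof.
move=> fL; pose m := GRing.isLinear.Build k V W *:%R f fL.
by exists (HB.pack_for {linear V -> W} f m).
Qed.

Section Retraction.
Variables (k : fieldType) (V W : lmodType k) (f : {linear V -> W}).

(* Linear injections over a field split: a complement of the range is given by *)
(* Zorn's lemma.                                                               *)
Lemma linear_retract : injective f -> exists r : {linear W -> V}, cancel f r.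
Proof.
move=> f_inj.
pose P (D : set W) := (forall a x y, D x -> D y -> D (a *: x + y)) /\
  (forall v, D (f v) -> v = 0).
have [|D [[DL Df] Dmax]] := @Zorn_bigcup W P.
  move=> F FP Ftot; split=> [a x y [A FA Ax] [B FB By]|v [A FA /(FP A FA).2]] //.
  have [AB|BA] := Ftot A B FA FB.
    by exists B => //; apply: (FP B FB).1 => //; apply: AB.
  by exists A => //; apply: (FP A FA).1 => //; apply: BA.
have Dmax' E : D `<=` E -> P E -> E `<=` D.
  by move=> DE PE; apply: contrapT => nED; apply: Dmax PE.
have D0 : D 0.
  apply: contrapT => nD0; apply: (nD0); apply: (@Dmax' [set 0]) => //.
    move=> x Dx; case: nD0.
    by have := DL (-1) x x Dx Dx; rewrite scaleN1r addNr.
  split=> [a x y -> ->|v /= fv0]; first by rewrite /= scaler0 addr0.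
  by apply: f_inj; rewrite fv0 linear0.
have DZ a x : D x -> D (a *: x) by move=> Dx; rewrite -[_ *: _]addr0; apply: DL.
have DD x y : D x -> D y -> D (x + y).
  by move=> Dx Dy; rewrite -[x]scale1r; apply: DL.
have split_W w : exists v, D (w - f v).
  apply: contrapT => nw.
  pose E := [set x | exists a y, D y /\ x = a *: w + y].
  apply: (nw); exists 0; rewrite linear0 subr0; apply: (@Dmax' E).
  - by move=> x Dx; exists 0, x; rewrite scale0r add0r.
  - split; last first.
    move=> v [a [y [Dy fvE]]]; have [a0|a_neq0] := eqVneq a 0.
      by apply: Df; rewrite fvE a0 scale0r add0r.
    case: nw; exists (a^-1 *: v); rewrite linearZ /= fvE scalerDr scalerA.
    rewrite mulVf // scale1r opprD addrA subrr add0r -scaleNr.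
    exact: DZ.
    move=> a x y [b [x' [Dx ->]]] [c [y' [Dy ->]]].
    exists (a * b + c), (a *: x' + y'); split; first exact: DL.
    by rewrite scalerDr scalerDl scalerA addrACA.
  - by exists 1, 0; rewrite scale1r addr0.
have [r rP] := choice split_W.
have r_uniq w v : D (w - f v) -> r w = v.
  move=> Dv; apply/eqP; rewrite -subr_eq0; apply/eqP/Df; rewrite linearB.
  have -> : f (r w) - f v = (-1) *: (w - f (r w)) + (w - f v).
    by rewrite scaleN1r opprB addrA subrK.
  exact: DL.
have rL : linear r.
  move=> a x y; apply: r_uniq; rewrite linearP.
  have -> : a *: x + y - (a *: f (r x) + f (r y)) =
            a *: (x - f (r x)) + (y - f (r y)).
    by rewrite scalerBr opprD addrACA.
  exact: DL.
have [g gE] := linear_pack rL; exists g => v.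
by rewrite gE; apply: r_uniq; rewrite subrr.
Qed.

End Retraction.

Lemma tmap_inj (k : fieldType) (V V' W W' : lmodType k)
    (f : {linear V -> V'}) (g : {linear W -> W'}) :
  injective f -> injective g -> injective (tmap f g).
Proof.
move=> /linear_retract[r rK] /linear_retract[s sK].
apply: (can_inj (g := tmap r s)); apply: tens_ind => [v w||x y hx hy].
- by rewrite !tmapE rK sK.
- by rewrite !linear0.
- by rewrite [tmap f g _]linearD [LHS]linearD /= hx hy.
Qed.

Section Subspaces.
Variables (k : pzRingType) (V W : lmodType k).

Definition sub_of (S : submodClosed V) := {x : V | x \in S}.

HB.instance Definition _ (S : submodClosed V) := SubType.on (sub_of S).
HB.instance Definition _ (S : submodClosed V) := Choice.on (sub_of S).
HB.instance Definition _ (S : submodClosed V) :=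
  [SubChoice_isSubLmodule of sub_of S by <:].

Definition sub_val (S : submodClosed V) : {linear sub_of S -> V} := \val.

Definition lrange (f : {linear V -> W}) : {pred W} :=
  [pred y | `[< exists x, y = f x >]].

Lemma lrange_closed f : submod_closed (lrange f).
Proof.
split=> [|a x y]; first by apply/asboolP; exists 0; rewrite linear0.
move=> /asboolP[x' ->] /asboolP[y' ->]; apply/asboolP.
by exists (a *: x' + y'); rewrite linearP.
Qed.
HB.instance Definition _ f :=
  GRing.isSubmodClosed.Build k W (lrange f) (lrange_closed f).

Definition lpreim (f : {linear V -> W}) (S : submodClosed W) : {pred V} :=
  [pred x | f x \in S].

Lemma lpreim_closed f S : submod_closed (lpreim f S).
Proof.
split=> [|a x y]; first by rewrite inE linear0 rpred0.
by rewrite !inE linearP => fx fy; rewrite rpredD // rpredZ.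
Qed.
HB.instance Definition _ f S :=
  GRing.isSubmodClosed.Build k V (lpreim f S) (lpreim_closed f S).

Definition fullsp : {pred V} := predT.

Lemma fullsp_closed : submod_closed fullsp. Proof. by []. Qed.
HB.instance Definition _ :=
  GRing.isSubmodClosed.Build k V fullsp fullsp_closed.

(* The sum of all the members of a family P of subspaces. *)
Definition sumsp (P : set (submodClosed V)) : {pred V} :=
  [pred x | `[< exists s : seq V,
     (forall v, v \in s -> exists2 S : submodClosed V, P S & v \in S) /\
     x = \sum_(v <- s) v >]].

Lemma sumsp_closed P : submod_closed (sumsp P).
Proof.
split=> [|a x y]; first by apply/asboolP; exists [::]; rewrite big_nil.
move=> /asboolP[s [sP ->]] /asboolP[t [tP ->]]; apply/asboolP.
exists ([seq a *: v | v <- s] ++ t); split; last first.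
  by rewrite big_cat big_map scaler_sumr.
move=> v; rewrite mem_cat => /orP[/mapP[u us ->]|/tP//].
by have [S PS uS] := sP u us; exists S => //; apply: rpredZ.
Qed.
HB.instance Definition _ P :=
  GRing.isSubmodClosed.Build k V (sumsp P) (sumsp_closed P).

Definition addsp (A B : submodClosed V) : submodClosed V :=
  sumsp [set S | S = A \/ S = B].

Definition direct_sum (I : eqType) (F : I -> submodClosed V) :=
  (sumsp (range F) =i fullsp) /\
  (forall (s : seq I) (v : I -> V), uniq s -> (forall i, v i \in F i) ->
    \sum_(i <- s) v i = 0 -> forall i, i \in s -> v i = 0).

End Subspaces.

Arguments fullsp {k} V.

Section SubAlgebra.
Variables (k : pzRingType) (A : algType k) (S : subalgClosed A).

Lemma sub_of_subring : GRing.subring_closed (fun x : A => x \in S).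
Proof.
split; [exact: rpred1|move=> x y xS yS|move=> x y]; last exact: rpredM.
by rewrite /= -scaleN1r rpredD // rpredZ.
Qed.

HB.instance Definition _ :=
  GRing.SubZmodule_isSubNzRing.Build A _ (sub_of S) sub_of_subring.
HB.instance Definition _ := [SubNzRing_SubLmodule_isSubLalgebra of sub_of S by <:].
HB.instance Definition _ := [SubLalgebra_isSubAlgebra of sub_of S by <:].

End SubAlgebra.

(* The image of A (x) B in V (x) W. *)
Definition tens_sub (k : comNzRingType) (V W : lmodType k)
    (A : submodClosed V) (B : submodClosed W) : submodClosed (tens V W) :=
  lrange (tmap (sub_val A) (sub_val B)).

Definition tassoc (k : comNzRingType) (A B C : lmodType k) :
    tens (tens A B) C -> tens A (tens B C) :=
  tlift (fun t c => tlift (fun a b => a *t (b *t c)) t).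

(* The product (a (x) b) (a' (x) b') = a a' (x) b b' of A (x) B. *)
Definition tens_mul (k : comNzRingType) (A B : algType k) (x y : tens A B) :
    tens A B :=
  tlift (fun a b => tlift (fun a' b' => (a * a') *t (b * b')) y) x.

Section TensorAlgebraTheory.
Variable k : comNzRingType.

Lemma linear_tlift (V W X Y : lmodType k) (g : {linear X -> Y})
    (f : V -> W -> X) t :
  g (tlift f t) = tlift (fun v w => g (f v w)) t.
Proof. by rewrite /tlift linear_sum. Qed.

Lemma tlift_tmap (V V' W W' X : lmodType k) (g : {linear V -> V'})
    (h : {linear W -> W'}) (f : V' -> W' -> X) t :
  bilinear_for *:%R *:%R f ->
  tlift f (tmap g h t) = tlift (fun v w => f (g v) (h w)) t.
Proof.
move=> fL; rewrite [in LHS]/tmap {2}/tlift.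
have [F FE] := linear_pack (tlift_linear fL).
rewrite -FE linear_sum; apply: eq_bigr => p _.
by rewrite FE tliftE.
Qed.

Lemma tliftP (V W X : lmodType k) a (f g : V -> W -> X) t :
  tlift (fun v w => a *: f v w + g v w) t = a *: tlift f t + tlift g t.
Proof. by rewrite /tlift big_split scaler_sumr. Qed.

Lemma tens_ext (V W X : lmodType k) (f g : tens V W -> X) :
  linear f -> linear g -> (forall v w, f (v *t w) = g (v *t w)) -> f =1 g.
Proof.
move=> /linear_pack[F FE] /linear_pack[G GE] fg t; rewrite -FE -GE.
move: t; apply: tens_ind => [v w||x y]; first by rewrite FE GE.
  by rewrite !linear0.
by move=> hx hy; rewrite [LHS]linearD [RHS]linearD hx hy.
Qed.

Lemma tmap_comp (V V' V'' W W' W'' : lmodType k) (f : {linear V -> V'})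
    (f' : {linear V' -> V''}) (g : {linear W -> W'}) (g' : {linear W' -> W''})
    (h : {linear V -> V''}) (h' : {linear W -> W''}) :
  f' \o f =1 h -> g' \o g =1 h' ->
  forall t, tmap f' g' (tmap f g t) = tmap h h' t.
Proof.
move=> hE h'E; apply: tens_ind => [v w||x y].
- by rewrite !tmapE -hE -h'E.
- by rewrite !linear0.
- move=> hx hy; rewrite [tmap f g _]linearD [LHS]linearD [RHS]linearD.
  by congr (_ + _).
Qed.

Variables A B C : lmodType k.

Lemma tassoc_linear : linear (@tassoc k A B C).
Proof.
have bilin (c : C) : bilinear_for *:%R *:%R (fun (a : A) (b : B) => a *t (b *t c)).
  split=> [b|b] a x y /=; first by rewrite ptensDl ptensZl.
  by rewrite ptensDl ptensZl ptensDr ptensZr.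
apply: tlift_linear; split=> [c|t]; first exact: tlift_linear (bilin c).
move=> a x y.
rewrite /= -tliftP; apply: eq_tlift => v w.
by rewrite !(ptensDr, ptensZr).
Qed.
HB.instance Definition _ :=
  GRing.isLinear.Build k _ _ _ (@tassoc k A B C) tassoc_linear.

Lemma tassocE (a : A) (b : B) (c : C) :
  tassoc ((a *t b) *t c) = a *t (b *t c).
Proof.
rewrite /tassoc tliftE; last first.
  split=> [c'|t] a' x y; last first.
    by rewrite /= -tliftP; apply: eq_tlift => v w; rewrite !(ptensDr, ptensZr).
  apply: tlift_linear; split=> [b'|b'] a'' x' y' /=.
    by rewrite ptensDl ptensZl.
  by rewrite ptensDl ptensZl ptensDr ptensZr.
rewrite tliftE //; split=> [b'|b'] a'' x' y' /=.
  by rewrite ptensDl ptensZl.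
by rewrite ptensDl ptensZl ptensDr ptensZr.
Qed.

End TensorAlgebraTheory.

Lemma tassoc_tmap (k : comNzRingType) (A A' B B' C C' : lmodType k)
    (f : {linear A -> A'}) (g : {linear B -> B'}) (h : {linear C -> C'}) t :
  tassoc (tmap (tmap f g) h t) = tmap f (tmap g h) (tassoc t).
Proof.
move: t; apply: tens_ind => [t c||x y]; last 2 first.
- by rewrite !linear0.
- move=> hx hy; rewrite !(linearD (tmap _ h)) !(linearD (@tassoc _ _ _ _)) linearD.
  by congr (_ + _).
move: t; apply: tens_ind => [a b||x y].
- by rewrite tassocE !tmapE /= !tmapE tassocE.
- by rewrite ptens0l !linear0.
- move=> hx hy; rewrite ptensDl !(linearD (tmap _ h)) !(linearD (@tassoc _ _ _ _)) linearD.
  by congr (_ + _).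
Qed.

Section TensMul.
Variables (k : comNzRingType) (A B : algType k).
Implicit Types (x y z : tens A B).

Lemma tens_mul_bilinear_r (a : A) (b : B) :
  bilinear_for *:%R *:%R (fun (a' : A) (b' : B) => (a * a') *t (b * b')).
Proof.
by split=> [w|v] c x y /=;
  rewrite mulrDr -scalerAr ?ptensDl ?ptensDr ?ptensZl ?ptensZr.
Qed.

Lemma tens_mul_bilinear_l y : bilinear_for *:%R *:%R
  (fun (a : A) (b : B) => tlift (fun a' b' => (a * a') *t (b * b')) y).
Proof.
by split=> [w|v] c x x' /=; rewrite -tliftP; apply: eq_tlift => a' b';
  rewrite mulrDl -scalerAl ?ptensDl ?ptensDr ?ptensZl ?ptensZr.
Qed.

Lemma tens_mulE a b a' b' :
  tens_mul (a *t b) (a' *t b') = (a * a') *t (b * b') :> tens A B.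
Proof.
rewrite /tens_mul tliftE; last exact: tens_mul_bilinear_l.
by rewrite tliftE; last exact: tens_mul_bilinear_r.
Qed.

Lemma tens_mul_linear_l y : linear (fun x => tens_mul x y).
Proof. exact: tlift_linear (tens_mul_bilinear_l y). Qed.

Lemma tens_mul_linear_r x : linear (tens_mul x).
Proof.
move=> a y z; rewrite /tens_mul -tliftP; apply: eq_tlift => v w.
exact: tlift_linear (tens_mul_bilinear_r v w) _ _ _.
Qed.

End TensMul.

Lemma tmap_tens_mul (k : comNzRingType) (A A' B B' : algType k)
    (f : {linear A -> A'}) (g : {linear B -> B'}) :
  {morph f : x y / x * y} -> {morph g : x y / x * y} ->
  {morph tmap f g : x y / tens_mul x y}.
Proof.
move=> fM gM x y.
have comp_lin (V W X : lmodType k) (u : V -> W) (v : W -> X) :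
    linear u -> linear v -> linear (fun z => v (u z)).
  by move=> uL vL a z t; rewrite uL vL.
have tL := @linearP k _ _ _ (tmap f g).
pose F x' := tmap f g (tens_mul x' y); pose G x' := tens_mul (tmap f g x') (tmap f g y).
rewrite -/(F x) -/(G x).
apply: tens_ext => {x}.
- exact: comp_lin (tens_mul_linear_l y) tL.
- exact: comp_lin tL (tens_mul_linear_l (tmap f g y)).
move=> a b; rewrite /F /G tmapE.
pose F' y' := tmap f g (tens_mul (a *t b) y').
pose G' y' := tens_mul (f a *t g b) (tmap f g y').
rewrite -/(F' y) -/(G' y); apply: tens_ext => {y F G}.
- exact: comp_lin (tens_mul_linear_r (a *t b)) tL.
- exact: comp_lin tL (tens_mul_linear_r (f a *t g b)).
by move=> a' b'; rewrite /F' /G' tens_mulE !tmapE tens_mulE fM gM.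
Qed.

HB.mixin Record isCoalgebra (k : fieldType) C of GRing.Lmodule k C := {
  comul : {linear C -> tens C C};
  counit : {linear C -> k^o};
  comulA : forall x,
    tassoc (tmap comul idfun (comul x)) = tmap idfun comul (comul x);
  counitl : forall x, tlift (fun a b => (counit a : k) *: b) (comul x) = x;
  counitr : forall x, tlift (fun a b => (counit b : k) *: a) (comul x) = x
}.

#[short(type="coalgType")]
HB.structure Definition Coalgebra (k : fieldType) :=
  {C of GRing.Lmodule k C & isCoalgebra k C}.

Definition comul3 (k : fieldType) (C : coalgType k) (x : C) :
    tens (tens C C) C :=
  tmap comul idfun (comul x).

HB.mixin Record Coalgebra_isHopf (k : fieldType) A
    of GRing.Algebra k A & isCoalgebra k A := {
  comul1 : comul (1 : A) = 1 *t 1;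
  comulM : forall x y : A, comul (x * y) = tens_mul (comul x) (comul y);
  counit1 : counit (1 : A) = 1;
  counitM : forall x y : A,
    counit (x * y) = (counit x : k) * (counit y : k);
  antipode : {linear A -> A};
  antipodel : forall x : A,
    tlift (fun a b => antipode a * b) (comul x) = (counit x : k)%:A;
  antipoder : forall x : A,
    tlift (fun a b => a * antipode b) (comul x) = (counit x : k)%:A
}.

#[short(type="hopfAlgType")]
HB.structure Definition HopfAlgebra (k : fieldType) :=
  {A of GRing.Algebra k A & isCoalgebra k A & Coalgebra_isHopf k A}.

(* Stability under the counit is automatic.                                    *)
Record hopfSub (k : fieldType) (A : hopfAlgType k) := HopfSub {
  hopf_sub :> subalgClosed A;
  hopf_sub_comul : forall x, x \in hopf_sub ->
    comul x \in tens_sub hopf_sub hopf_sub;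
  hopf_sub_antipode : forall x, x \in hopf_sub -> antipode x \in hopf_sub
}.

Section HopfSubTheory.
Variables (k : fieldType) (A : hopfAlgType k) (S : hopfSub A).
Local Notation HS := (sub_of S).
Local Notation v := (sub_val S).

Let v_inj : injective v. Proof. exact: val_inj. Qed.

Lemma sub_comul_ex (x : HS) : exists t : tens HS HS, comul (v x) = tmap v v t.
Proof. by have /asboolP := hopf_sub_comul (valP x). Qed.

Definition sub_comul (x : HS) : tens HS HS := projT1 (cid (sub_comul_ex x)).

Lemma sub_comulE x : tmap v v (sub_comul x) = comul (v x).
Proof. by rewrite /sub_comul; case: cid. Qed.

Lemma sub_comul_linear : linear sub_comul.
Proof.
move=> a x y; apply: (tmap_inj v_inj v_inj).
by rewrite sub_comulE (linearP v) linearP -!sub_comulE [RHS]linearP.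
Qed.
HB.instance Definition _ :=
  GRing.isLinear.Build k _ _ _ sub_comul sub_comul_linear.

Definition sub_counit (x : HS) : k^o := counit (v x).

Lemma sub_counit_linear : linear sub_counit.
Proof. by move=> a x y; rewrite /sub_counit !linearP. Qed.
HB.instance Definition _ :=
  GRing.isLinear.Build k _ _ _ sub_counit sub_counit_linear.

Definition sub_antipode (x : HS) : HS :=
  exist _ (antipode (v x)) (hopf_sub_antipode (valP x)).

Lemma sub_antipode_linear : linear sub_antipode.
Proof. by move=> a x y; apply: val_inj; rewrite /= !linearP. Qed.
HB.instance Definition _ :=
  GRing.isLinear.Build k _ _ _ sub_antipode sub_antipode_linear.

Lemma sub_comulA x :
  tassoc (tmap sub_comul idfun (sub_comul x)) =
  tmap idfun sub_comul (sub_comul x).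
Proof.
apply: (tmap_inj v_inj (tmap_inj v_inj v_inj)).
rewrite -tassoc_tmap.
rewrite (tmap_comp (h := comul \o v) (h' := v)) //; last exact: sub_comulE.
rewrite (tmap_comp (h := v) (h' := comul \o v)) //; last exact: sub_comulE.
have e1 t : tmap (comul \o v) v t = tmap comul idfun (tmap v v t).
  by rewrite (tmap_comp (h := comul \o v) (h' := v)).
have e2 t : tmap v (comul \o v) t = tmap idfun comul (tmap v v t).
  by rewrite (tmap_comp (h := v) (h' := comul \o v)).
rewrite e1 e2 sub_comulE.
exact: comulA.
Qed.

Lemma scale_bilinear (C D : lmodType k) (e : {linear C -> k^o}) :
  bilinear_for *:%R *:%R (fun (a : C) (b : D) => (e a : k) *: b).
Proof.
split=> [w|w] a x y /=; first by rewrite linearP scalerDl scalerA.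
by rewrite scalerDr !scalerA mulrC.
Qed.

Lemma scale_bilinear_r (C D : lmodType k) (e : {linear C -> k^o}) :
  bilinear_for *:%R *:%R (fun (b : D) (a : C) => (e a : k) *: b).
Proof. by split=> [w|w] a x y; apply: (scale_bilinear _ _).1 || apply: (scale_bilinear _ _).2. Qed.

Lemma sub_counitl x :
  tlift (fun a b => (sub_counit a : k) *: b) (sub_comul x) = x.
Proof.
apply: v_inj; rewrite linear_tlift -[RHS]counitl -sub_comulE.
rewrite tlift_tmap; last exact: scale_bilinear.
by apply: eq_tlift => a b; rewrite linearZ.
Qed.

Lemma sub_counitr x :
  tlift (fun a b => (sub_counit b : k) *: a) (sub_comul x) = x.
Proof.
apply: v_inj; rewrite linear_tlift -[RHS]counitr -sub_comulE.
rewrite tlift_tmap; last exact: scale_bilinear_r.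
by apply: eq_tlift => a b; rewrite linearZ.
Qed.

HB.instance Definition _ :=
  isCoalgebra.Build k HS sub_comulA sub_counitl sub_counitr.

Lemma sub_comul1 : sub_comul 1 = 1 *t 1.
Proof. by apply: (tmap_inj v_inj v_inj); rewrite sub_comulE tmapE comul1. Qed.

Lemma sub_comulM x y : sub_comul (x * y) = tens_mul (sub_comul x) (sub_comul y).
Proof.
apply: (tmap_inj v_inj v_inj); rewrite tmap_tens_mul // !sub_comulE.
by rewrite -comulM.
Qed.

Lemma sub_counit1 : sub_counit 1 = 1.
Proof. exact: counit1. Qed.

Lemma sub_counitM x y :
  sub_counit (x * y) = (sub_counit x : k) * (sub_counit y : k).
Proof. exact: counitM. Qed.

Lemma sub_antipodel (x : HS) :
  tlift (fun a b => sub_antipode a * b) (sub_comul x) = (sub_counit x : k)%:A.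
Proof.
apply: v_inj; rewrite linear_tlift linearZ /= -[RHS]antipodel -sub_comulE.
rewrite tlift_tmap // ; split=> [w|w] a y z /=.
  by rewrite linearP mulrDl -scalerAl.
by rewrite mulrDr -scalerAr.
Qed.

Lemma sub_antipoder (x : HS) :
  tlift (fun a b => a * sub_antipode b) (sub_comul x) = (sub_counit x : k)%:A.
Proof.
apply: v_inj; rewrite linear_tlift linearZ /= -[RHS]antipoder -sub_comulE.
rewrite tlift_tmap // ; split=> [w|w] a y z /=.
  by rewrite mulrDl -scalerAl.
by rewrite linearP mulrDr -scalerAr.
Qed.

HB.instance Definition _ := Coalgebra_isHopf.Build k HS
  sub_comul1 sub_comulM sub_counit1 sub_counitM sub_antipodel sub_antipoder.

End HopfSubTheory.

Section Coradical.
Variables (k : fieldType) (C : coalgType k).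
Implicit Types D E : submodClosed C.

Definition subcoalgebra D : Prop :=
  forall x, x \in D -> comul x \in tens_sub D D.

Definition simple_subcoalgebra D : Prop :=
  [/\ subcoalgebra D,
      exists2 x, x \in D & x != 0 &
      forall E, subcoalgebra E -> {subset E <= D} ->
        (forall x, x \in E -> x = 0) \/ E =i D].

Definition coradical : submodClosed C := sumsp simple_subcoalgebra.

Definition cosemisimple : Prop := coradical =i fullsp C.

Fixpoint coradical_filtration (n : nat) : submodClosed C :=
  if n is m.+1 then
    lpreim comul (addsp (tens_sub (fullsp C) (coradical_filtration m))
                        (tens_sub coradical (fullsp C)))
  else coradical.

Record graded_coalgebra (I : nmodType) (F : I -> submodClosed C) : Prop :=
  GradedCoalgebra {
    graded_coalgebra_sum : direct_sum F;
    graded_coalgebra_comul : forall i x, x \in F i ->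
      comul x \in sumsp [set S | exists j j', j + j' = i /\
                                   S = tens_sub (F j) (F j')]
  }.

(* [deg] is the total degree on the grading monoid: the identity for gradings  *)
(* by nat, the sum of the coordinates for gradings by tuples of naturals.      *)
Definition coradically_graded (I : nmodType) (deg : I -> nat)
    (F : I -> submodClosed C) : Prop :=
  graded_coalgebra F /\
  forall n, coradical_filtration n =i
    sumsp [set S | exists2 i, (deg i <= n)%N & S = F i].

End Coradical.

Record ydModule (k : fieldType) (H : hopfAlgType k) (V : lmodType k) := YDModule {
  yd_act : H -> V -> V;
  yd_coact : {linear V -> tens H V};
  yd_act_bilinear : bilinear_for *:%R *:%R yd_act;
  yd_act1 : forall x, yd_act 1 x = x;
  yd_actM : forall g h x, yd_act (g * h) x = yd_act g (yd_act h x);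
  yd_coactA : forall x,
    tassoc (tmap comul idfun (yd_coact x)) = tmap idfun yd_coact (yd_coact x);
  yd_coact_counit : forall x,
    tlift (fun g y => (counit g : k) *: y) (yd_coact x) = x;
  (* coact (h x) = h1 x(-1) S(h3) (x) h2 x(0) *)
  yd_compat : forall h x,
    yd_coact (yd_act h x) =
      tlift (fun h12 h3 => tlift (fun h1 h2 =>
        tlift (fun g y => (h1 * g * antipode h3) *t yd_act h2 y) (yd_coact x))
        h12) (comul3 h)
}.

Section YDTensor.
Variables (k : fieldType) (H : hopfAlgType k) (R : lmodType k).
Variable M : ydModule H R.

Definition yd_submodule (S : submodClosed R) : Prop :=
  (forall h x, x \in S -> yd_act M h x \in S) /\
  (forall x, x \in S -> yd_coact M x \in tens_sub (fullsp H) S).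

(* The diagonal action and the codiagonal coaction on R (x) R. *)
Definition yd_act2 (h : H) (t : tens R R) : tens R R :=
  tlift (fun h1 h2 => tlift (fun x y => yd_act M h1 x *t yd_act M h2 y) t)
    (comul h).

Definition yd_coact2 (t : tens R R) : tens H (tens R R) :=
  tlift (fun x y => tlift (fun g x0 => tlift (fun g' y0 =>
    (g * g') *t (x0 *t y0)) (yd_coact M y)) (yd_coact M x)) t.

End YDTensor.

(* The product (x (x) y) (x' (x) y') = x (y(-1) x') (x) y(0) y' that the        *)
(* braiding c(y (x) x') = y(-1) x' (x) y(0) defines on R (x) R.                 *)
Definition yd_tens_mul (k : fieldType) (H : hopfAlgType k) (R : algType k)
    (M : ydModule H R) (s t : tens R R) : tens R R :=
  tlift (fun x y => tlift (fun x' y' => tlift (fun g y0 =>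
    (x * yd_act M g x') *t (y0 * y')) (yd_coact M y)) t) s.

(* Hopf algebras in the category of Yetter-Drinfeld modules over H, on a given *)
(* algebra R: all structure maps are linear and colinear over H.               *)
Record ydHopf (k : fieldType) (H : hopfAlgType k) (R : algType k) := YDHopf {
  yd_module :> ydModule H R;
  yd_comul : {linear R -> tens R R};
  yd_counit : {linear R -> k^o};
  yd_antipode : {linear R -> R};
  yd_comulA : forall x,
    tassoc (tmap yd_comul idfun (yd_comul x)) =
    tmap idfun yd_comul (yd_comul x);
  yd_counitl : forall x,
    tlift (fun a b => (yd_counit a : k) *: b) (yd_comul x) = x;
  yd_counitr : forall x,
    tlift (fun a b => (yd_counit b : k) *: a) (yd_comul x) = x;
  yd_comul_one : yd_comul 1 = 1 *t 1;
  yd_comul_mul : forall x y,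
    yd_comul (x * y) = yd_tens_mul yd_module (yd_comul x) (yd_comul y);
  yd_counit_one : yd_counit 1 = 1;
  yd_counit_mul : forall x y,
    yd_counit (x * y) = (yd_counit x : k) * (yd_counit y : k);
  yd_antipodel : forall x,
    tlift (fun a b => yd_antipode a * b) (yd_comul x) = (yd_counit x : k)%:A;
  yd_antipoder : forall x,
    tlift (fun a b => a * yd_antipode b) (yd_comul x) = (yd_counit x : k)%:A;
  yd_act_one : forall h, yd_act yd_module h 1 = (counit h : k)%:A;
  yd_act_mul : forall h x y,
    yd_act yd_module h (x * y) =
      tlift (fun h1 h2 => yd_act yd_module h1 x * yd_act yd_module h2 y)
        (comul h);
  yd_act_counit : forall h x,
    yd_counit (yd_act yd_module h x) = (counit h : k) * (yd_counit x : k);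
  yd_act_comul : forall h x,
    yd_comul (yd_act yd_module h x) = yd_act2 yd_module h (yd_comul x);
  yd_act_antipode : forall h x,
    yd_antipode (yd_act yd_module h x) = yd_act yd_module h (yd_antipode x);
  yd_coact_one : yd_coact yd_module 1 = 1 *t 1;
  yd_coact_mul : forall x y,
    yd_coact yd_module (x * y) =
      tens_mul (yd_coact yd_module x) (yd_coact yd_module y);
  yd_coact_eps : forall x,
    tlift (fun g y => (yd_counit y : k) *: g) (yd_coact yd_module x) =
      (yd_counit x : k)%:A;
  yd_coact_comul : forall x,
    tmap idfun yd_comul (yd_coact yd_module x) =
      yd_coact2 yd_module (yd_comul x);
  yd_coact_antipode : forall x,
    yd_coact yd_module (yd_antipode x) =
      tmap idfun yd_antipode (yd_coact yd_module x)
}.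

Section YDCoalgebra.
Variables (k : fieldType) (H : hopfAlgType k) (R : algType k) (B : ydHopf H R).

Definition yd_coalg : coalgType k :=
  HB.pack (GRing.Algebra.sort R)
    (isCoalgebra.Build k R (yd_comulA B) (yd_counitl B) (yd_counitr B)).

Record coradically_graded_ydHopf (F : nat -> submodClosed R) : Prop :=
  CoradicallyGradedYDHopf {
    gr_yd_submodule : forall i, yd_submodule B (F i);
    gr_yd_one : 1 \in F 0;
    gr_yd_mul : forall i j x y, x \in F i -> y \in F j -> x * y \in F (i + j)%N;
    gr_yd_antipode : forall i x, x \in F i -> yd_antipode B x \in F i;
    gr_yd_coradical : @coradically_graded k yd_coalg nat id F
  }.

End YDCoalgebra.

(* An algebra morphism compatible with the rest of the Hopf algebra structure. *)
Definition hopf_morphism (k : fieldType) (A B : hopfAlgType k)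
    (f : {lrmorphism A -> B}) : Prop :=
  [/\ forall x, comul (f x) = tmap f f (comul x),
      forall x, counit (f x) = counit x &
      forall x, antipode (f x) = f (antipode x)].

Definition coinvariant (k : fieldType) (A B : hopfAlgType k)
    (f : {linear A -> B}) (a : A) : Prop :=
  tmap idfun f (comul a) = a *t 1.

Definition adjoint (k : fieldType) (A : hopfAlgType k) (h n : A) : A :=
  tlift (fun a b => a * n * antipode b) (comul h).

(* The structure maps of B are those that the Hopf algebra map pi : A -> H      *)
(* induces on N; the element a of A below is n, seen in A.                      *)
Record induced_ydHopf (k : fieldType) (U : hopfAlgType k) (H A : hopfSub U)
    (N : subalgClosed U) (pi : {lrmorphism sub_of A -> sub_of H})
    (B : ydHopf (sub_of H) (sub_of N)) : Prop := InducedYDHopf {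
  induced_act : forall (h : sub_of H) (n : sub_of N),
    val (yd_act B h n) = adjoint (val h) (val n);
  induced_coact : forall (n : sub_of N) (a : sub_of A), val a = val n ->
    tmap idfun (sub_val N) (yd_coact B n) = tmap pi (sub_val A) (comul a);
  induced_comul : forall (n : sub_of N) (a : sub_of A), val a = val n ->
    tmap (sub_val N) (sub_val N) (yd_comul B n) =
      tlift (fun a12 a3 => tlift (fun a1 a2 =>
        (val a1 * val (antipode (pi a2))) *t val a3) a12) (comul3 a)
}.

Section IteratedTensor.
Variables (k : fieldType) (U : algType k).

Definition tlift_mul (V W : lmodType k) (f : {linear V -> U})
    (g : {linear W -> U}) : tens V W -> U :=
  tlift (fun v w => f v * g w).

Lemma tlift_mul_linear V W f g : linear (@tlift_mul V W f g).
Proof.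
apply: tlift_linear; split=> [w|v] a x y /=.
  by rewrite linearP mulrDl -scalerAl.
by rewrite linearP mulrDr -scalerAr.
Qed.
HB.instance Definition _ V W f g :=
  GRing.isLinear.Build k _ _ _ (@tlift_mul V W f g) (tlift_mul_linear f g).

(* A1 (x) (A2 (x) ( ... (x) K)) for s = [:: A1; A2; ...]. *)
Fixpoint tens_seq (s : seq (submodClosed U)) (K : submodClosed U) : lmodType k :=
  if s is A :: s' then tens (sub_of A) (tens_seq s' K) else sub_of K.

Fixpoint mul_seq (s : seq (submodClosed U)) (K : submodClosed U) :
    {linear tens_seq s K -> U} :=
  if s is A :: s' then tlift_mul (sub_val A) (mul_seq s' K) else sub_val K.

End IteratedTensor.

(* A subspace of the subspace N of V, as a subspace of V. *)
Definition sub_image (k : pzRingType) (V : lmodType k) (N : submodClosed V)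
    (S : submodClosed (sub_of N)) : submodClosed V :=
  lrange (sub_val N \o sub_val S).

Definition total_degree (T : nat) (i : {ffun 'I_T -> nat}) : nat :=
  (\sum_(l < T) i l)%N.

Definition product_component (k : fieldType) (U : hopfAlgType k) (H : hopfSub U)
    (T : nat) (N : 'I_T -> subalgClosed U)
    (F : forall l, nat -> submodClosed (sub_of (N l)))
    (i : {ffun 'I_T -> nat}) : submodClosed U :=
  lrange (mul_seq [seq sub_image (F l (i l)) | l <- enum 'I_T] H).

(* Main.v *)
From HB Require Import structures.
Require Import Defs.
From mathcomp Require Import all_boot all_algebra.
From mathcomp Require Import zify boolp classical_sets.

Set Implicit Arguments.
Unset Strict Implicit.
Unset Printing Implicit Defensive.

Import GRing.Theory.
Local Open Scope ring_scope.

(* Starting from H, adjoin the N_l one at a time: if X is the product of the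
   factors already adjoined, then the comultiplication of U restricts to a smash
   coproduct on N_l (x) X, because Delta(n) = n^1 (n^2)_(-1) (x) (n^2)_0.

   Degree zero lies in the coradical because it is coseparable. An integral on
   N_l(0), extended by 0, gives the expectation E(n h) = lambda(n) h onto H, and
   sigma'(n x, n' x') = E(n sigma(x, x') S(n')) extends an H-valued form sigma
   from X to N_l (x) X; it starts from sigma(g, h) = g S(h) on H. Composed with
   the integral of the cosemisimple H, sigma makes the degree zero part
   coseparable; there every subcoalgebra has a complement, hence it is a sum of
   simple subcoalgebras. N_l(0) is not assumed to be the ground field.

   For a graded coalgebra C with C(0) inside the coradical, being coradically
   graded amounts to: for all m, an element of degree m + 1 is determined by its
   component of degree (1, m) under Delta. By coassociativity it suffices that
   it is determined by its components of degree (1, m) and (m, 1) together,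
   which passes from N_l and X to N_l (x) X. *)

(** * Linear maps and tensors *)

(** On a Hopf algebra with integral lambda, lambda(c S(d)) is a coseparability form. Here the degree
    zero part of U is only a subcoalgebra: neither it nor a partial product X is known to be closed
    under multiplication, so there is no Hopf algebra whose integral could be taken. But S reverses
    products, so that (n x) S(n' x') = n (x S(x')) S(n'): the factors of c S(d) are nested around H
    and can be integrated out one at a time, starting from the innermost. This is where the formula
    for sigma' comes from. The form keeps its values in H until the last factor is adjoined, because
    each expectation needs an element of H between n and S(n'), and because the smash coproduct lets
    coaction terms from H act on X, which the form must be able to pull out as factors of its
    value. *)

Notation bilin f := (bilinear_for *:%R *:%R f).

Section LinearFunctions.
Variable k : comNzRingType.
Implicit Types U V W X Y : lmodType k.

(** A folded name for linearity, on which [lin1] can match. *)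
Definition lin U V (f : U -> V) : Prop := linear f.

Lemma lin_id V : lin (fun x : V => x). Proof. by []. Qed.
Lemma lin_app U V W (g : {linear V -> W}) (u : U -> V) :
  lin u -> lin (fun x => g (u x)).
Proof. by move=> uL a x y; rewrite uL linearP. Qed.
Lemma lin_ptl U V W (u : U -> V) (w : W) : lin u -> lin (fun x => u x *t w).
Proof. by move=> uL a x y; rewrite uL ptensDl ptensZl. Qed.
Lemma lin_ptr U V W (u : U -> V) (w : W) : lin u -> lin (fun x => w *t u x).
Proof. by move=> uL a x y; rewrite uL ptensDr ptensZr. Qed.
Lemma lin_tlift_r U V W X (f : U -> V -> W -> X) t :
  (forall v w, lin (fun x => f x v w)) -> lin (fun x => tlift (f x) t).
Proof. by move=> fL a x y; rewrite -tliftP; apply: eq_tlift => v w; apply: fL. Qed.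
Lemma lin_tlift_a U V W X (f : V -> W -> X) (u : U -> tens V W) :
  (forall w, lin (fun v => f v w)) -> (forall v, lin (fun w => f v w)) ->
  lin u -> lin (fun x => tlift f (u x)).
Proof. by move=> f1 f2 uL a x y; rewrite uL; apply: tlift_linear; split. Qed.
Lemma lin_add U V (u v : U -> V) : lin u -> lin v -> lin (fun x => u x + v x).
Proof. by move=> uL vL a x y; rewrite uL vL scalerDr addrACA. Qed.
Lemma lin_opp U V (u : U -> V) : lin u -> lin (fun x => - u x).
Proof. by move=> uL a x y; rewrite uL opprD scalerN. Qed.
Lemma lin_scaler U V c (u : U -> V) : lin u -> lin (fun x => c *: u x).
Proof. by move=> uL a x y; rewrite uL scalerDr !scalerA mulrC. Qed.
Lemma lin_scalel U V (u : U -> k) w :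
  lin (u : U -> k^o) -> lin (fun x => u x *: w : V).
Proof. by move=> uL a x y; rewrite (uL a x y) scalerDl -scalerA. Qed.
Lemma lin_sum U V (I : Type) (r : seq I) (F : U -> I -> V) :
  (forall i, lin (fun x => F x i)) -> lin (fun x => \sum_(i <- r) F x i).
Proof.
by move=> FL a x y; rewrite scaler_sumr -big_split /=; apply: eq_bigr => i _; apply: FL.
Qed.
Lemma lin_mull U (A : algType k) (b : A) (u : U -> A) : lin u -> lin (fun x => u x * b).
Proof. by move=> uL a x y; rewrite uL mulrDl scalerAl. Qed.
Lemma lin_mulr U (A : algType k) (b : A) (u : U -> A) : lin u -> lin (fun x => b * u x).
Proof. by move=> uL a x y; rewrite uL mulrDr scalerAr. Qed.

Lemma bilin_lin U V W (f : U -> V -> W) :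
  (forall v, lin (fun u => f u v)) -> (forall u, lin (fun v => f u v)) -> bilin f.
Proof. by move=> f1 f2; split=> u; [apply: f1|apply: f2]. Qed.

Lemma ptensNl V W (v : V) (w : W) : (- v) *t w = - (v *t w).
Proof. by rewrite -scaleN1r ptensZl scaleN1r. Qed.
Lemma ptensNr V W (v : V) (w : W) : v *t (- w) = - (v *t w).
Proof. by rewrite -scaleN1r ptensZr scaleN1r. Qed.
Lemma ptensBl V W (v v' : V) (w : W) : (v - v') *t w = v *t w - v' *t w.
Proof. by rewrite ptensDl ptensNl. Qed.
Lemma ptens0r V W (v : V) : v *t (0 : W) = 0.
Proof. by rewrite -(scale0r 0) ptensZr scale0r. Qed.

Lemma lin_tmulr U (A B : algType k) (c : tens A B) (u : U -> tens A B) :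
  lin u -> lin (fun x => tens_mul c (u x)).
Proof. by move=> uL a x y; rewrite uL; apply: tens_mul_linear_r. Qed.
Lemma lin_tmull U (A B : algType k) (c : tens A B) (u : U -> tens A B) :
  lin u -> lin (fun x => tens_mul (u x) c).
Proof. by move=> uL a x y; rewrite uL; apply: tens_mul_linear_l. Qed.
Lemma lin_0 U V : lin (fun _ : U => 0 : V).
Proof. by move=> a x y; rewrite scaler0 addr0. Qed.
Lemma lin_fst U V W (u : U -> V * W) : lin u -> lin (fun x => (u x).1).
Proof. by move=> uL a x y; rewrite uL. Qed.
Lemma lin_snd U V W (u : U -> V * W) : lin u -> lin (fun x => (u x).2).
Proof. by move=> uL a x y; rewrite uL. Qed.

End LinearFunctions.

Section LinearAction.
Variables (k : fieldType) (H : hopfAlgType k) (R : lmodType k) (M : ydModule H R).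
Implicit Types V : lmodType k.

Lemma lin_actl V (u : V -> H) n : lin u -> lin (fun x => yd_act M (u x) n).
Proof. by move=> uL a x y; rewrite uL; apply: (yd_act_bilinear M).1. Qed.
Lemma lin_actr V (u : V -> R) h : lin u -> lin (fun x => yd_act M h (u x)).
Proof. by move=> uL a x y; rewrite uL; apply: (yd_act_bilinear M).2. Qed.

End LinearAction.

(** Chooses a linearity rule by the syntax of the function. [lin_app] is the last rule, since it
    fits every application of a linear map; a function that is not an abstraction is eta-expanded,
    so that the rules can see its body. *)
Ltac lin1 := intros; cbv beta;
  match goal with
  | |- bilinear_for _ _ _ => apply: bilin_lin
  | H : context [lin] |- lin _ => exact: H
  | |- lin (fun x => x) => apply: lin_id
  | |- lin (fun x => 0) => apply: lin_0
  | |- lin (fun x => fst _) => apply: lin_fst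
  | |- lin (fun x => snd _) => apply: lin_snd
  | |- lin (fun x => ?w *t _) => apply: (@lin_ptr _ _ _ _ _ w)
  | |- lin (fun x => _ *t ?w) => apply: (@lin_ptl _ _ _ _ _ w)
  | |- lin (fun x => tlift _ ?t) => apply: (@lin_tlift_r _ _ _ _ _ _ t)
  | |- lin (fun x => tlift ?f _) => apply: (@lin_tlift_a _ _ _ _ _ f)
  | |- lin (fun x => _ + _) => apply: lin_add
  | |- lin (fun x => - _) => apply: lin_opp
  | |- lin (fun x => ?c *: _) => apply: (@lin_scaler _ _ _ c)
  | |- lin (fun x => _ *: ?w) => apply: (@lin_scalel _ _ _ _ w)
  | |- lin (fun x => ?w * @?u x) => refine (@lin_mulr _ _ _ w u _)
  | |- lin (fun x => @?u x * ?w) => refine (@lin_mull _ _ _ w u _)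
  | |- lin (fun x => tens_mul ?w (@?u x)) => refine (@lin_tmulr _ _ _ _ w u _)
  | |- lin (fun x => tens_mul (@?u x) ?w) => refine (@lin_tmull _ _ _ _ w u _)
  | |- lin (fun x => yd_act ?M ?h _) => apply: (@lin_actr _ _ _ M _ _ h)
  | |- lin (fun x => yd_act ?M _ ?n) => apply: (@lin_actl _ _ _ M _ _ n)
  | |- lin (fun x => \sum_(i <- _) _) => apply: lin_sum
  | |- lin (fun x => _) => apply: lin_app
  | |- lin ?f =>
      match f with
      | fun x => _ => fail 1
      | _ => change (lin (fun x => f x))
      end
  | |- GRing.linear_for _ ?f => change (lin (fun x => f x))
  end.
Ltac lin := repeat lin1.

Section Pack.
Variable k : comNzRingType.
Implicit Types U V W X Y : lmodType k.

Definition linpack V W (f : V -> W) (fL : lin f) : {linear V -> W} :=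
  HB.pack_for {linear V -> W} f (GRing.isLinear.Build k V W *:%R f fL).

Lemma linpackE V W (f : V -> W) (fL : lin f) x : linpack fL x = f x.
Proof. by []. Qed.

(* An opaque version of [linpack]: rewriting with [linpackE] unifies with the
   application of any linear map. *)
Lemma mklin_sig V W (f : V -> W) (fL : lin f) : {g : {linear V -> W} | g =1 f}.
Proof. by exists (linpack fL). Qed.

Definition mklin V W (f : V -> W) (fL : lin f) : {linear V -> W} := sval (mklin_sig fL).

Lemma mklinE V W (f : V -> W) (fL : lin f) x : mklin fL x = f x.
Proof. exact: svalP (mklin_sig fL) x. Qed.

Lemma tens_eq_lin V W X (f g : {linear tens V W -> X}) :
  (forall v w, f (v *t w) = g (v *t w)) -> f =1 g.
Proof. by apply: tens_ext; apply: linearP. Qed.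

Lemma tmap_id V W (f : {linear V -> V}) (g : {linear W -> W}) :
  f =1 id -> g =1 id -> tmap f g =1 id.
Proof.
move=> f1 g1; apply: tens_ext; [by lin|by lin|] => v w.
by rewrite tmapE f1 g1.
Qed.

Lemma eq_tmap V V' W W' (f f' : {linear V -> V'}) (g g' : {linear W -> W'}) :
  f =1 f' -> g =1 g' -> tmap f g =1 tmap f' g'.
Proof. by move=> ff gg; apply: tens_eq_lin => v w; rewrite /= !tmapE ff gg. Qed.

Lemma submodB V (S : submodClosed V) x y : x \in S -> y \in S -> x - y \in S.
Proof. by move=> xS yS; rewrite -scaleN1r rpredD ?rpredZ. Qed.

(** Turns a property stable under linear combinations into a subspace; by [sumsp_sub] or
    [tens_sub_sub] it then has to be checked on generators only. *)
Lemma submod_pack V (D : V -> Prop) :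
  D 0 -> (forall a x y, D x -> D y -> D (a *: x + y)) ->
  exists S : submodClosed V, forall x, x \in S <-> D x.
Proof.
move=> D0 DL; pose P : {pred V} := [pred x | `[< D x >]].
have PL : submod_closed P.
  split=> [|a x y]; first exact/asboolP.
  by move=> /asboolP Dx /asboolP Dy; apply/asboolP/DL.
pose m := GRing.isSubmodClosed.Build k V P PL.
by exists (HB.pack_for (submodClosed V) P m) => x; split=> /asboolP.
Qed.

End Pack.

Section LinearAlgebra.
Variable k : fieldType.
Implicit Types V W X Y Z : lmodType k.

Lemma subspace_projection V (S : submodClosed V) :
  exists p : {linear V -> V}, (forall x, p x \in S) /\ {in S, forall x, p x = x}.
Proof.
have [|r rK] := @linear_retract k _ _ (sub_val S); first exact: val_inj.
exists (sub_val S \o r); split=> [x|x xS] /=; first exact: valP.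
by rewrite -[x in RHS](congr1 val (rK (exist _ x xS))).
Qed.

(** Project [y] to the range and choose any preimage [c y]. Two choices differ by an element of the
    kernel, so subtracting from [c y] its projection to the kernel makes the choice linear. *)
Lemma generalized_inverse V W (f : {linear V -> W}) :
  exists h : {linear W -> V}, forall x, f (h (f x)) = f x.
Proof.
have [|a x y fx0 fy0|K KE] := @submod_pack _ _ (fun x => f x = 0).
- exact: linear0.
- by rewrite linearP fx0 fy0 scaler0 addr0.
have [p [pK pid]] := subspace_projection K.
have [r [rR rid]] := subspace_projection (lrange f).
have /choice[c cE] : forall y, exists x, f x = r y.
  by move=> y; have /asboolP[x ->] := rR y; exists x.
have hL : lin (fun y => c y - p (c y)).
  move=> a y z; have : c (a *: y + z) - (a *: c y + c z) \in K.
    by apply/KE; rewrite linearB linearP !cE linearP subrr.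
  have e (b d b' d' : V) : b - d = b' - d' -> b' - b = d' - d.
    by move=> h; rewrite -(subrK d' b') -h addrAC [b - d - b]addrAC subrr add0r addrC.
  move=> /pid; rewrite linearB linearP => /e ->.
  by rewrite scalerBr addrACA -opprD.
exists (mklin hL) => x; rewrite mklinE linearB cE rid.
  by have /KE -> := pK (c (f x)); rewrite subr0.
by apply/asboolP; exists x.
Qed.

(** This is how the injectivity of a component of a comultiplication is put to use: an implication
    between vanishing statements becomes a linear map that recovers [g x] from [f x] and can be
    applied inside a tensor product. *)
Lemma linear_factor V W Z (f : {linear V -> W}) (g : {linear V -> Z}) :
  (forall x, f x = 0 -> g x = 0) ->
  exists h : {linear W -> Z}, forall x, h (f x) = g x.
Proof.
move=> fg; have [h hE] := generalized_inverse f; exists (g \o h) => x /=.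
by apply/eqP; rewrite -subr_eq0 -linearB fg // linearB hE subrr.
Qed.

Lemma linear_lift V W Z (f : {linear V -> W}) (g : {linear Z -> W}) :
  (forall x, exists y, g x = f y) ->
  exists h : {linear Z -> V}, forall x, f (h x) = g x.
Proof.
move=> gf; have [h hE] := generalized_inverse f; exists (h \o g) => x /=.
by have [y ->] := gf x.
Qed.

Lemma separating_functional V (S : submodClosed V) g : g \notin S ->
  exists f : {linear V -> k^o}, f g = 1 /\ {in S, forall x, f x = 0}.
Proof.
have [p [pS pid]] := subspace_projection S.
move=> gS; pose w := g - p g; have w0 : w != 0.
  by apply: contraNneq gS => /eqP; rewrite subr_eq0 => /eqP ->.
have [|r rK] := @linear_retract k _ _ (mklin (ltac:(lin) : lin (fun a : k^o => (a : k) *: w))).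
  move=> a b /eqP; rewrite !mklinE -subr_eq0 -scalerBl scaler_eq0 (negPf w0) orbF.
  by rewrite subr_eq0 => /eqP.
exists (mklin (ltac:(lin) : lin (fun x => r (x - p x)))); split=> [|x xS].
  by have := rK 1; rewrite !mklinE scale1r.
by rewrite mklinE pid // subrr linear0.
Qed.

Lemma tens_subE V W (A : submodClosed V) (B : submodClosed W) z :
  z \in tens_sub A B ->
  exists s : tens (sub_of A) (sub_of B), z = tmap (sub_val A) (sub_val B) s.
Proof. by move/asboolP. Qed.

Lemma tens_sub_pt V W (A : submodClosed V) (B : submodClosed W) a b :
  a \in A -> b \in B -> a *t b \in tens_sub A B.
Proof.
move=> aA bB; apply/asboolP.
by exists ((exist _ a aA : sub_of A) *t (exist _ b bB : sub_of B)); rewrite /= tmapE.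
Qed.

Lemma tens_mem V W (E : submodClosed (tens V W)) :
  (forall a b, a *t b \in E) -> forall z, z \in E.
Proof. by move=> Ept; apply: tens_ind => [||x y xE yE] //; rewrite ?rpred0 ?rpredD. Qed.

Lemma tens_sub_sub V W (A : submodClosed V) (B : submodClosed W)
    (E : submodClosed (tens V W)) :
  (forall a b, a \in A -> b \in B -> a *t b \in E) -> {subset tens_sub A B <= E}.
Proof.
move=> Ept z /tens_subE[s ->]; move: s; apply: tens_ind => [a b||x y xE yE].
- by rewrite tmapE; apply: Ept; apply: valP.
- by rewrite linear0 rpred0.
- by rewrite linearD /= rpredD.
Qed.

Lemma tmap_sub V V' W W' (f : {linear V -> V'}) (g : {linear W -> W'})
    (A : submodClosed V) (B : submodClosed W) (A' : submodClosed V')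
    (B' : submodClosed W') :
  {in A, forall x, f x \in A'} -> {in B, forall x, g x \in B'} ->
  {in tens_sub A B, forall z, tmap f g z \in tens_sub A' B'}.
Proof.
move=> fA gB; apply: (tens_sub_sub (E := lpreim (tmap f g) (tens_sub A' B'))) => a b aA bB.
by change (tmap f g (a *t b) \in tens_sub A' B'); rewrite tmapE tens_sub_pt ?fA ?gB.
Qed.

Lemma tens_sub_full V W z : z \in tens_sub (fullsp V) (fullsp W).
Proof. by apply: tens_mem => a b; apply: tens_sub_pt. Qed.

Lemma tmap_in V V' W W' (f : {linear V -> V'}) (g : {linear W -> W'})
    (A : submodClosed V') (B : submodClosed W') :
  (forall x, f x \in A) -> (forall x, g x \in B) ->
  forall z, tmap f g z \in tens_sub A B.
Proof. by move=> fA gB z; apply: tmap_sub (tens_sub_full z) => x _. Qed.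

Lemma tens_subS V W (A A' : submodClosed V) (B B' : submodClosed W) :
  {subset A <= A'} -> {subset B <= B'} -> {subset tens_sub A B <= tens_sub A' B'}.
Proof. by move=> AA BB; apply: tens_sub_sub => a b /AA ? /BB ?; apply: tens_sub_pt. Qed.

Lemma tlift_eq_in V W X (A : submodClosed V) (B : submodClosed W) (f g : V -> W -> X) z :
  bilin f -> bilin g -> z \in tens_sub A B ->
  {in A & B, forall a b, f a b = g a b} -> tlift f z = tlift g z.
Proof.
move=> fL gL /tens_subE[s ->] fg; rewrite !tlift_tmap //.
by apply: eq_tlift => a b; apply: fg; apply: valP.
Qed.

Lemma tlift_mem V W X (A : submodClosed V) (B : submodClosed W)
    (E : submodClosed X) (f : V -> W -> X) z :
  bilin f -> z \in tens_sub A B -> {in A & B, forall a b, f a b \in E} ->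
  tlift f z \in E.
Proof.
move=> fL /tens_subE[s ->] fE; rewrite tlift_tmap // /tlift.
by apply: rpred_sum => p _; apply: fE; apply: valP.
Qed.

Lemma tmap_eq_in V V' W W' (A : submodClosed V) (B : submodClosed W)
    (f f' : {linear V -> V'}) (g g' : {linear W -> W'}) z :
  z \in tens_sub A B -> {in A, f =1 f'} -> {in B, g =1 g'} ->
  tmap f g z = tmap f' g' z.
Proof.
move=> zAB ff gg; apply: tlift_eq_in zAB _ => [||a b aA bB]; try exact: tmap_bilinear.
by rewrite ff ?gg.
Qed.

(** A projection onto [A] in the first factor fixes [z], and it does not affect membership of the
    second factor in [B]. *)
Lemma tens_subI V W (A : submodClosed V) (B : submodClosed W) z :
  z \in tens_sub A (fullsp W) -> z \in tens_sub (fullsp V) B -> z \in tens_sub A B.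
Proof.
move=> zA zB; have [p [pA pid]] := subspace_projection A.
rewrite -[z](@tmap_id _ _ _ idfun idfun) //.
rewrite (tmap_eq_in (f' := p) (g' := idfun) zA) => // [|x xA /=]; last by rewrite pid.
by apply: tmap_sub zB => // x _; apply: pA.
Qed.

(** With [p] a projection onto [B], the map [g] is 1 - p on [A], with kernel the intersection of [A]
    and [B]. If [h] is a generalized inverse of [g], then [e] = 1 - h g projects [A] onto this
    kernel; since [g] (x) id kills the element, [e] (x) id fixes it. *)
Lemma tens_sub_capl V W (A B C : submodClosed V) z :
  (forall x, x \in A -> x \in B -> x \in C) ->
  z \in tens_sub A (fullsp W) -> z \in tens_sub B (fullsp W) ->
  z \in tens_sub C (fullsp W).
Proof.
move=> ABC /tens_subE[s ->]; have [p [pB pid]] := subspace_projection B.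
have gL : lin (fun x : sub_of A => sub_val A x - p (sub_val A x)) by lin.
pose g := mklin gL.
have [h hE] := generalized_inverse g.
set z' := tmap _ _ s => zB.
have gz : tmap g (sub_val (fullsp W)) s = 0.
  have dL : lin (fun x : V => x - p x) by lin.
  pose d := mklin dL.
  rewrite -(tmap_comp (f := sub_val A) (f' := d) (g' := idfun) (g := sub_val _)) //; last first.
    by move=> x; rewrite /= !mklinE.
  rewrite -/z' (tmap_eq_in (f' := \0) (g' := idfun) zB) => // [|x xB]; last first.
    by rewrite mklinE pid // subrr.
  move: z' {zB}; apply: tens_ind => [a b||x y xE yE].
  - by rewrite tmapE ptens0l.
  - by rewrite linear0.
  - by rewrite linearD /= xE yE addr0.
have eL : lin (fun x : sub_of A => x - h (g x)) by lin.
pose e := mklin eL.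
have -> : z' = tmap (sub_val A \o e) (sub_val (fullsp W)) s.
  have -> : z' = z' - tmap (sub_val A \o h) idfun (tmap g (sub_val (fullsp W)) s).
    by rewrite gz linear0 subr0.
  rewrite /z'; clear gz zB z'; move: s; apply: tens_ext; [by lin|by lin|].
  move=> a b; rewrite !tmapE -ptensBl; congr (_ *t _).
  by rewrite -[RHS]/(sub_val A (e a)) [e a]mklinE linearB.
apply: tmap_in => [x|x]; last by [].
apply: ABC; first exact: valP.
have /eqP : g (e x) = 0 by rewrite [e x]mklinE linearB hE subrr.
rewrite mklinE subr_eq0 => /eqP eB.
by change (sub_val A (e x) \in B); rewrite eB.
Qed.

Lemma sumsp_mem V (P : set (submodClosed V)) S x : P S -> x \in S -> x \in sumsp P.
Proof.
move=> PS xS; apply/asboolP; exists [:: x]; split; last by rewrite big_seq1.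
by move=> v; rewrite inE => /eqP ->; exists S.
Qed.

Lemma sumsp_sub V (P : set (submodClosed V)) (E : submodClosed V) :
  (forall S, P S -> {subset S <= E}) -> {subset sumsp P <= E}.
Proof.
move=> PE x /asboolP[s [sP ->]]; rewrite big_seq; apply: rpred_sum => v /sP[S PS vS].
exact: PE vS.
Qed.

Lemma addsp_memP V (A B : submodClosed V) x :
  x \in addsp A B <-> exists a b, [/\ a \in A, b \in B & x = a + b].
Proof.
split=> [|[a [b [aA bB ->]]]]; last first.
  by apply: rpredD; [apply: (sumsp_mem (S := A))|apply: (sumsp_mem (S := B))]; rewrite //=; [left|right].
have [|c x' y' [a [b [aA bB ->]]] [a' [b' [aA' bB' ->]]]|E EE] :=
    @submod_pack _ V (fun x => exists a b, [/\ a \in A, b \in B & x = a + b]).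
- by exists 0, 0; rewrite !rpred0 addr0.
- exists (c *: a + a'), (c *: b + b'); rewrite scalerDr addrACA.
  by rewrite !(rpredD, rpredZ).
move=> xAB; apply/EE; move: x xAB; apply: sumsp_sub => S [->|->] y yS; apply/EE.
  by exists y, 0; rewrite rpred0 addr0.
by exists 0, y; rewrite rpred0 add0r.
Qed.

End LinearAlgebra.

(** * Sweedler calculus and subcoalgebras *)

(** Coassociativity in Sweedler form, with four spaces, two maps and two tensors kept apart so that
    it serves comultiplications, braided comultiplications and coactions alike. *)
Lemma tlift_assoc (k : comNzRingType) (P C A B R X : lmodType k)
    (d1 : {linear P -> tens A B}) (d2 : {linear R -> tens B C})
    (f : A -> B -> C -> X) (z : tens P C) (w : tens A R) :
  (forall b c, lin (fun a => f a b c)) -> (forall a c, lin (fun b => f a b c)) ->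
  (forall a b, lin (f a b)) ->
  tassoc (tmap d1 idfun z) = tmap idfun d2 w ->
  tlift (fun p c => tlift (fun a b => f a b c) (d1 p)) z =
  tlift (fun a r => tlift (fun b c => f a b c) (d2 r)) w.
Proof.
move=> f1 f2 f3 zw.
rewrite -(@tlift_tmap _ _ _ _ _ _ idfun d2 (fun a t => tlift (f a) t)); last by lin.
rewrite -zw.
rewrite -(@tlift_tmap _ _ _ _ _ _ d1 idfun (fun t c => tlift (fun a b => f a b c) t)); last by lin.
move: (tmap _ _ z); apply: tens_ext; [by lin|by lin|] => t c.
rewrite tliftE; last by lin.
move: t; apply: tens_ext; [by lin|by lin|] => a b.
by rewrite tassocE !tliftE; lin.
Qed.

Lemma tlift_ptens (k : comNzRingType) (V W : lmodType k) (z : tens V W) :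
  tlift (fun a b => a *t b) z = z.
Proof. by move: z; apply: tens_ext; [lin|lin|move=> a b; rewrite tliftE //; lin]. Qed.

Lemma tliftZ (k : comNzRingType) (V W X : lmodType k) c (f : V -> W -> X) z :
  c *: tlift f z = tlift (fun a b => c *: f a b) z.
Proof. by rewrite /tlift scaler_sumr. Qed.

Lemma tlift_exchange (k : comNzRingType) (V W V' W' X : lmodType k)
    (f : V -> W -> V' -> W' -> X) z w :
  tlift (fun a b => tlift (fun c d => f a b c d) w) z =
  tlift (fun c d => tlift (fun a b => f a b c d) z) w.
Proof. by rewrite /tlift exchange_big. Qed.

Lemma tliftMr (k : comNzRingType) (V W : lmodType k) (A : algType k) c (f : V -> W -> A) z :
  c * tlift f z = tlift (fun a b => c * f a b) z.
Proof. by rewrite /tlift mulr_sumr. Qed.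

Lemma tliftMl (k : comNzRingType) (V W : lmodType k) (A : algType k) c (f : V -> W -> A) z :
  tlift f z * c = tlift (fun a b => f a b * c) z.
Proof. by rewrite /tlift mulr_suml. Qed.

Lemma tens_mul_tliftr (k : comNzRingType) (V W : lmodType k) (A B : algType k)
    (c : tens A B) (f : V -> W -> tens A B) z :
  tens_mul c (tlift f z) = tlift (fun a b => tens_mul c (f a b)) z.
Proof.
have cL : lin (fun u : tens A B => tens_mul c u) by lin.
by rewrite -[LHS](mklinE cL) linear_tlift; apply: eq_tlift => a b; rewrite mklinE.
Qed.

Lemma tens_mul_tliftl (k : comNzRingType) (V W : lmodType k) (A B : algType k)
    (c : tens A B) (f : V -> W -> tens A B) z :
  tens_mul (tlift f z) c = tlift (fun a b => tens_mul (f a b) c) z.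
Proof.
have cL : lin (fun u : tens A B => tens_mul u c) by lin.
by rewrite -[LHS](mklinE cL) linear_tlift; apply: eq_tlift => a b; rewrite mklinE.
Qed.

Lemma tens_mul_tmap (k : comNzRingType) (V W : lmodType k) (A B : algType k)
    (f : {linear V -> A}) (g : {linear W -> B}) u w z :
  tens_mul (u *t w) (tmap f g z) = tlift (fun c d => (u * f c) *t (w * g d)) z.
Proof.
move: z; apply: tens_ext; [by lin|by lin|] => c d.
by rewrite tmapE tens_mulE tliftE //; lin.
Qed.

Lemma tlift_ptl (k : comNzRingType) (V W X Y : lmodType k) (y : Y) (f : V -> W -> X) z :
  tlift f z *t y = tlift (fun a b => f a b *t y) z.
Proof.
have yL : lin (fun x : X => x *t y) by lin.
by rewrite -[LHS](mklinE yL) linear_tlift; apply: eq_tlift => a b; rewrite mklinE.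
Qed.

Lemma tlift_ptr (k : comNzRingType) (V W X Y : lmodType k) (y : Y) (f : V -> W -> X) z :
  y *t tlift f z = tlift (fun a b => y *t f a b) z.
Proof.
have yL : lin (fun x : X => y *t x) by lin.
by rewrite -[LHS](mklinE yL) linear_tlift; apply: eq_tlift => a b; rewrite mklinE.
Qed.

Section Sweedler.
Variables (k : fieldType) (C : coalgType k).

Lemma sw_assoc (X : lmodType k) (f : C -> C -> C -> X) x :
  (forall b c, lin (fun a => f a b c)) -> (forall a c, lin (fun b => f a b c)) ->
  (forall a b, lin (f a b)) ->
  tlift (fun a b => tlift (fun a1 a2 => f a1 a2 b) (comul a)) (comul x) =
  tlift (fun a b => tlift (fun b1 b2 => f a b1 b2) (comul b)) (comul x).
Proof. by move=> f1 f2 f3; apply: tlift_assoc => //; apply: comulA. Qed.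

Lemma sw_counitl (X : lmodType k) (f : C -> X) x : lin f ->
  tlift (fun a b => (counit a : k) *: f b) (comul x) = f x.
Proof.
move=> fL; rewrite -[x in RHS]counitl -[f _]/(linpack fL _) linear_tlift.
by apply: eq_tlift => a b; rewrite linearZ.
Qed.

Lemma sw_counitr (X : lmodType k) (f : C -> X) x : lin f ->
  tlift (fun a b => (counit b : k) *: f a) (comul x) = f x.
Proof.
move=> fL; rewrite -[x in RHS]counitr -[f _]/(linpack fL _) linear_tlift.
by apply: eq_tlift => a b; rewrite linearZ.
Qed.

Lemma sumsp_subcoalgebra (P : set (submodClosed C)) :
  (forall S, P S -> subcoalgebra S) -> subcoalgebra (sumsp P).
Proof.
move=> PS x.
apply: (sumsp_sub (E := lpreim comul (tens_sub (sumsp P) (sumsp P)))) => S PSS y yS.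
by apply: (tens_subS _ _ (PS S PSS y yS)) => z zS; apply: sumsp_mem zS.
Qed.

(** Write g as a sum of elements of members of [P], the first being v in S. If g is not in S, take a
    functional f with f(g) = 1 that vanishes on S. The map [T] = (f (x) id) Delta fixes g, kills v
    and preserves every subcoalgebra, so it rewrites g as a sum with one term fewer. *)
Lemma grouplike_sumsp (P : set (submodClosed C)) g :
  comul g = g *t g -> counit g = 1 :> k -> (forall S, P S -> subcoalgebra S) ->
  g \in sumsp P -> exists2 S : submodClosed C, P S & g \in S.
Proof.
move=> gg g1 PS /asboolP[s [sP gE]].
move: {2}(size s) (leqnn (size s)) => n; elim: n s sP gE => [|n IHn] [|v s] sP gE //.
- by move: g1; rewrite gE big_nil linear0 => /eqP; rewrite eq_sym oner_eq0.
- by move: g1; rewrite gE big_nil linear0 => /eqP; rewrite eq_sym oner_eq0.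
rewrite /= ltnS => sn; have [S PSS vS] := sP v (mem_head _ _).
have [gS|/separating_functional[f [fg fS]]] := boolP (g \in S); first by exists S.
have TL : lin (fun x => tlift (fun a b => (f a : k) *: b) (comul x)) by lin.
pose T := linpack TL.
have Tg : T g = g by rewrite linpackE gg tliftE ?fg ?scale1r //; lin.
have Tv : T v = 0.
  rewrite linpackE (tlift_eq_in (g := fun _ _ => 0) _ _ (PS S PSS v vS)); [|by lin|by lin|].
    by rewrite /tlift big1.
  by move=> a b aS _; rewrite fS // scale0r.
apply: (IHn [seq T u | u <- s]); last by rewrite size_map.
  move=> _ /mapP[u us ->]; have [|S' PS' uS'] := sP u; first by rewrite inE us orbT.
  exists S' => //; apply: (tlift_mem _ (PS S' PS' u uS')); first by lin.
  by move=> a b _ bS'; apply: rpredZ.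
by rewrite -{1}Tg gE linear_sum big_cons Tv add0r big_map.
Qed.

(** By [grouplike_sumsp], g does not lie in the sum of the simple subcoalgebras avoiding it, so a
    functional can be 1 at g and 0 on all of these. It is a two-sided integral; the proof uses g =
    1, both in H and in each N_l. *)
Lemma coradical_integral (g : C) :
  comul g = g *t g -> counit g = 1 :> k ->
  exists lam : {linear C -> k^o}, lam g = 1 /\ {in coradical C, forall x,
    tlift (fun a b => (lam b : k) *: a) (comul x) = (lam x : k) *: g /\
    tlift (fun a b => (lam a : k) *: b) (comul x) = (lam x : k) *: g}.
Proof.
move=> gg g1.
have g_neq0 : g != 0.
  by apply: contra_eq_neq g1 => ->; rewrite linear0 eq_sym oner_eq0.
pose R (S : submodClosed C) := simple_subcoalgebra S /\ g \notin S.
have [|lam [lamg lamR]] := @separating_functional _ _ (sumsp R) g.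
  apply/negP => /(grouplike_sumsp gg g1)[S [[]] //|S [_ gS] gS'].
  by rewrite gS' in gS.
exists lam; split=> // x.
have tL1 : lin (fun x => tlift (fun a b => (lam b : k) *: a) (comul x) - (lam x : k) *: g) by lin.
have tL2 : lin (fun x => tlift (fun a b => (lam a : k) *: b) (comul x) - (lam x : k) *: g) by lin.
have [|a y z [y1 y2] [z1 z2]|E EE] := @submod_pack _ _ (fun x => linpack tL1 x = 0 /\ linpack tL2 x = 0).
- by rewrite !linear0.
- by rewrite !linearP y1 y2 z1 z2 scaler0 addr0.
suff xE : {subset coradical C <= E}.
  by move=> /xE/EE; rewrite !linpackE => -[/eqP + /eqP]; rewrite !subr_eq0 => /eqP -> /eqP ->.
apply: sumsp_sub => S Ssimple v vS; apply/EE.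
(* If S avoids g, both sides vanish on S. Otherwise the line through g is a nonzero subcoalgebra of
   the simple S, hence equal to S. *)
have [gS|gS] := boolP (g \in S); last first.
  have lamS u : u \in S -> lam u = 0 by move=> uS; apply: lamR; apply: (sumsp_mem (S := S)).
  rewrite !linpackE lamS // scale0r !subr0.
  have [Scoalg _ _] := Ssimple.
  by split; (rewrite (tlift_eq_in (g := fun _ _ => 0) _ _ (Scoalg v vS)); [|by lin|by lin|by move=> a b aS bS /=; rewrite lamS // scale0r]; rewrite /tlift big1).
have gL : lin (fun a : k^o => (a : k) *: g) by lin.
have gE : g \in lrange (linpack gL) by apply/asboolP; exists 1; rewrite linpackE scale1r.
have [Scoalg _ /(_ (lrange (linpack gL)))[||/(_ g gE)/eqP|/(_ v)]] := Ssimple.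
- move=> _ /asboolP[a ->]; rewrite linpackE linearZ /= gg -ptensZl.
  by apply: tens_sub_pt => //; apply/asboolP; exists a.
- by move=> _ /asboolP[a ->]; rewrite linpackE rpredZ.
- by rewrite (negPf g_neq0).
rewrite vS => /asboolP[a ->]; rewrite !linpackE [comul _]linearZ /= gg -ptensZl.
have lamag : (lam ((a : k) *: g) : k) = a by rewrite linearZ /= lamg [LHS]mulr1.
by rewrite !tliftE; [rewrite lamag lamg scale1r subrr|by lin|by lin].
Qed.

End Sweedler.

(** * Coseparable subcoalgebras lie in the coradical *)

Section Subcoalgebras.
Variables (k : fieldType) (C : coalgType k).

Lemma tens_sub_cap (V : lmodType k) (A B E : submodClosed V) z :
  (forall x, x \in A -> x \in B -> x \in E) ->
  z \in tens_sub A A -> z \in tens_sub B B -> z \in tens_sub E E.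
Proof.
move=> ABE zA zB; apply: tens_subI.
  by apply: (tens_sub_capl ABE); [apply: tens_subS zA|apply: tens_subS zB].
(* The flip carries [tens_sub_capl], which concerns the first factor, over to the second. *)
have swL : lin (tlift (fun a b : V => b *t a)) by lin.
pose sw := linpack swL.
have swE a b : sw (a *t b) = b *t a by rewrite linpackE tliftE //; lin.
have swK : involutive sw.
  by apply: tens_ext; [by lin|by lin|move=> a b; rewrite !swE].
have sw_sub (D F : submodClosed V) : {subset tens_sub D F <= lpreim sw (tens_sub F D)}.
  apply: tens_sub_sub => a b aD bF; change (sw (a *t b) \in tens_sub F D).
  by rewrite swE tens_sub_pt.
rewrite -(swK z); apply: (sw_sub E (fullsp V)); apply: (tens_sub_capl ABE).
  by apply: (sw_sub (fullsp V) A); apply: tens_subS zA.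
by apply: (sw_sub (fullsp V) B); apply: tens_subS zB.
Qed.

Lemma subcoalgebra_cap (A B E : submodClosed C) :
  (forall x, x \in E <-> x \in A /\ x \in B) ->
  subcoalgebra A -> subcoalgebra B -> subcoalgebra E.
Proof.
move=> EE cA cB x /EE[/cA xA /cB xB].
by apply: tens_sub_cap xA xB => y yA yB; apply/EE.
Qed.

Lemma addsp_subcoalgebra (A B : submodClosed C) :
  subcoalgebra A -> subcoalgebra B -> subcoalgebra (addsp A B).
Proof. by move=> cA cB; apply: sumsp_subcoalgebra => S [->|->]. Qed.

End Subcoalgebras.

Section Coseparable.
Variables (k : fieldType) (C : coalgType k) (Z : submodClosed C).
(** [tau] is a coseparability form on [Z]: by the two hypotheses on it below, c (x) d |-> c_1
    tau(c_2, d) = tau(c, d_1) d_2 is a bicomodule map that splits the comultiplication of [Z]. *)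
Variable tau : {linear tens C C -> k^o}.
Hypothesis Zcoalg : subcoalgebra Z.
Hypothesis tau_balanced : {in Z & Z, forall c d,
  tlift (fun a b => (tau (b *t d) : k) *: a) (comul c) =
  tlift (fun a b => (tau (c *t a) : k) *: b) (comul d)}.
Hypothesis tau_counit : {in Z, forall c, tau (comul c) = counit c}.

(* [phi] and [psi] are the right and left actions of a functional on [C] that,
   restricted to [Z], is the central idempotent of the dual algebra cutting out
   [D]. *)
Lemma coseparable_idempotent (D : submodClosed C) :
  subcoalgebra D -> {subset D <= Z} ->
  exists phi psi : {linear C -> C}, [/\ {in Z, phi =1 psi},
    {in Z, forall c, phi c \in D}, {in D, forall d, phi d = d},
    forall c, comul (phi c) = tmap idfun phi (comul c) &
    forall c, comul (psi c) = tmap psi idfun (comul c)].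
Proof.
move=> Dcoalg DZ; have [p [pD pid]] := subspace_projection D.
have pZ c : p c \in Z by apply: DZ.
pose f : {linear C -> k^o} := tau \o (tmap idfun p \o comul).
pose f' : {linear C -> k^o} := tau \o (tmap p idfun \o comul).
have fE c : f c = tlift (fun a b => tau (a *t p b)) (comul c).
  by rewrite [f c]linear_tlift.
have f'E c : f' c = tlift (fun a b => tau (p a *t b)) (comul c).
  by rewrite [f' c]linear_tlift.
have phiL : lin (fun c => tlift (fun a b => (f b : k) *: a) (comul c)) by lin.
have psiL : lin (fun c => tlift (fun a b => (f' a : k) *: b) (comul c)) by lin.
pose phi := linpack phiL; pose psi := linpack psiL.
(* As in Maschke's theorem, the projection [p] is averaged: phi(c) = c_1 tau(c_2, p c_3). Balancing
   turns this into tau(c_1, (p c_2)_1) (p c_2)_2, which lies in the subcoalgebra [D]. The map [psi]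
   is the mirror image. *)
have phiD : {in Z, forall c, phi c \in D}.
  move=> c cZ.
  have -> : phi c = tlift (fun a b =>
      tlift (fun a1 a2 => (tau (a2 *t p b) : k) *: a1) (comul a)) (comul c).
    rewrite sw_assoc; [|by lin|by lin|by lin].
    by apply: eq_tlift => a b; rewrite fE /tlift scaler_suml.
  apply: (tlift_mem _ (Zcoalg cZ)) => [|a b aZ bZ]; first by lin.
  rewrite tau_balanced //; apply: (tlift_mem _ (Dcoalg _ (pD b))); first by lin.
  by move=> x y _ yD; apply: rpredZ.
have psiD : {in Z, forall c, psi c \in D}.
  move=> c cZ.
  have -> : psi c = tlift (fun a b =>
      tlift (fun b1 b2 => (tau (p a *t b1) : k) *: b2) (comul b)) (comul c).
    rewrite -(@sw_assoc _ _ _ (fun a b c => (tau (p a *t b) : k) *: c)); [|by lin|by lin|by lin].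
    by apply: eq_tlift => a b; rewrite f'E /tlift scaler_suml.
  apply: (tlift_mem _ (Zcoalg cZ)) => [|a b aZ bZ]; first by lin.
  rewrite -tau_balanced //; apply: (tlift_mem _ (Dcoalg _ (pD a))); first by lin.
  by move=> x y xD _; apply: rpredZ.
have fD : {in D, forall d, f d = counit d}.
  move=> d dD; rewrite -tau_counit ?DZ //; congr (tau _).
  rewrite -[RHS](@tmap_id _ _ _ idfun idfun) //.
  by apply: tmap_eq_in (Dcoalg d dD) _ _ => // x xD /=; rewrite pid.
have f'D : {in D, forall d, f' d = counit d}.
  move=> d dD; rewrite -tau_counit ?DZ //; congr (tau _).
  rewrite -[RHS](@tmap_id _ _ _ idfun idfun) //.
  by apply: tmap_eq_in (Dcoalg d dD) _ _ => // x xD /=; rewrite pid.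
have f'phi c : f' (phi c) = f (psi c).
  rewrite ![f (psi c)]linear_tlift ![f' (phi c)]linear_tlift.
  by apply: eq_tlift => a b; rewrite !linearZ /=; apply: mulrC.
have eps_phi c : counit (phi c) = f c.
  rewrite linear_tlift -[RHS](sw_counitl _ (f := f)); last by lin.
  by apply: eq_tlift => a b; rewrite !linearZ /=; apply: mulrC.
have eps_psi c : counit (psi c) = f' c.
  rewrite linear_tlift -[RHS](sw_counitr _ (f := f')); last by lin.
  by apply: eq_tlift => a b; rewrite !linearZ /=; apply: mulrC.
(* On [D] both functionals are the counit, so f(c) = eps(phi c) = f'(phi c) = f(psi c) = eps(psi c)
   = f'(c). *)
have ff' : {in Z, f =1 f'}.
  by move=> c cZ; rewrite -eps_phi -eps_psi -f'D ?phiD // -fD ?psiD.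
have phid : {in D, forall d, phi d = d}.
  move=> d dD; rewrite -[RHS]counitr linpackE; apply: tlift_eq_in (Dcoalg d dD) _; [by lin|by lin|].
  by move=> a b _ bD; rewrite fD.
have psid : {in D, forall d, psi d = d}.
  move=> d dD; rewrite -[RHS]counitl linpackE; apply: tlift_eq_in (Dcoalg d dD) _; [by lin|by lin|].
  by move=> a b aD _; rewrite f'D.
(* Both sides are f'(c_1) c_2 f(c_3). As [phi] and [psi] map [Z] to [D] and are the identity there,
   it follows that they agree on [Z]. *)
have phipsi c : psi (phi c) = phi (psi c).
  rewrite [phi (psi c)](linear_tlift phi) [psi (phi c)](linear_tlift psi).
  transitivity (tlift (fun a b => tlift (fun a1 a2 =>
    (f b : k) *: ((f' a1 : k) *: a2)) (comul a)) (comul c)).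
    by apply: eq_tlift => a b; rewrite linearZ /= tliftZ.
  rewrite (@sw_assoc _ _ _ (fun x y z => (f z : k) *: ((f' x : k) *: y))); [|by lin|by lin|by lin].
  apply: eq_tlift => a b; rewrite linearZ /= tliftZ.
  by apply: eq_tlift => x y; rewrite !scalerA mulrC.
exists phi, psi; split=> // [c cZ|c|c].
- by rewrite -(psid (phi c)) ?phiD // phipsi phid ?psiD.
- rewrite [LHS](linear_tlift comul).
  transitivity (tlift (fun a b => tlift (fun a1 a2 =>
    (f b : k) *: (a1 *t a2)) (comul a)) (comul c)).
    by apply: eq_tlift => a b; rewrite linearZ /= -tliftZ tlift_ptens.
  rewrite (@sw_assoc _ _ _ (fun x y z => (f z : k) *: (x *t y))); [|by lin|by lin|by lin].
  apply: eq_tlift => a b; rewrite /= /tlift -[RHS](linpackE (lin_ptr a (@lin_id _ _))) linear_sum.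
  by apply: eq_bigr => q _; rewrite linpackE ptensZr.
- rewrite [LHS](linear_tlift comul).
  transitivity (tlift (fun a b => tlift (fun b1 b2 =>
    (f' a : k) *: (b1 *t b2)) (comul b)) (comul c)).
    by apply: eq_tlift => a b; rewrite linearZ /= -tliftZ tlift_ptens.
  rewrite -(@sw_assoc _ _ _ (fun x y z => (f' x : k) *: (y *t z))); [|by lin|by lin|by lin].
  apply: eq_tlift => a b; rewrite /= /tlift -[RHS](linpackE (lin_ptl b (@lin_id _ _))) linear_sum.
  by apply: eq_bigr => q _; rewrite linpackE ptensZl.
Qed.

(** The complement is the kernel of [phi] in [E]. Because [phi] and [psi] are colinear on opposite
    sides and agree on [Z], the comultiplication of an element of the kernel is fixed by 1 - phi in
    either factor, which makes the kernel a subcoalgebra. *)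
Lemma coseparable_complement (D E : submodClosed C) :
  subcoalgebra D -> subcoalgebra E -> {subset D <= E} -> {subset E <= Z} ->
  exists E' : submodClosed C, [/\ subcoalgebra E', {subset E' <= E},
    forall x, x \in D -> x \in E' -> x = 0 &
    forall x, x \in E -> exists2 d, d \in D & x - d \in E'].
Proof.
move=> Dcoalg Ecoalg DE EZ.
have [|phi [psi [phipsi phiD phid Dphi Dpsi]]] := coseparable_idempotent Dcoalg.
  by move=> x /DE/EZ.
have [|a x y [xE x0] [yE y0]|E' E'E] := @submod_pack _ _ (fun x => x \in E /\ phi x = 0).
- by rewrite rpred0 linear0.
- by rewrite linearP x0 y0 scaler0 addr0 rpredD ?rpredZ.
have thL : lin (fun x => x - phi x) by lin.
pose th := linpack thL.
have thE x : x \in E -> th x \in E'.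
  move=> xE; have xZ := EZ x xE; have xD := phiD x xZ.
  apply/E'E; split; first by rewrite linpackE; apply: submodB => //; apply: DE.
  by rewrite linpackE linearB [phi (phi x)]phid // subrr.
exists E'; split=> [x|x /E'E[] //|x xD /E'E[_]|x xE]; last 2 first.
- by rewrite phid.
- by exists (phi x); [apply/phiD/EZ|apply: thE].
move=> /E'E[xE phix0].
have e1 : tmap idfun th (comul x) = comul x.
  transitivity (comul x - tmap idfun phi (comul x)); last first.
    by rewrite -Dphi phix0 linear0 subr0.
  move: (comul x); apply: tens_ext; [by lin|by lin|] => a b.
  by rewrite !tmapE /= ptensDr ptensNr.
have e2 : tmap th idfun (comul x) = comul x.
  transitivity (comul x - tmap psi idfun (comul x)); last first.
    by rewrite -Dpsi -phipsi ?EZ // phix0 linear0 subr0.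
  transitivity (comul x - tmap phi idfun (comul x)).
    move: (comul x); apply: tens_ext; [by lin|by lin|] => a b.
    by rewrite !tmapE /= ptensBl.
  congr (_ - _); apply: (tmap_eq_in (Zcoalg (EZ x xE))) => //.
rewrite -e1 -e2 (tmap_comp (h := th) (h' := th)) //.
by apply: tmap_sub (Ecoalg x xE).
Qed.

(** Let Q be a complement in [Z] of the sum of its simple subcoalgebras, with q nonzero in Q. Take M
    maximal among the subcoalgebras of Q avoiding q, and a complement M' of M in Q. Then M' is
    simple: a nonzero proper E in M' would have a nonzero complement E' in M', and by maximality q
    would lie both in M + E and in M + E', hence in M. But Q contains no simple subcoalgebra. *)
Lemma coseparable_coradical : {subset Z <= coradical C}.
Proof.
move=> z zZ; apply: contrapT => z_corad.
pose simpleZ (S : submodClosed C) := simple_subcoalgebra S /\ {subset S <= Z}.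
have S0coalg : subcoalgebra (sumsp simpleZ).
  by apply: sumsp_subcoalgebra => S [[]].
have [|Q [Qcoalg QZ S0Q Qsplit]] := coseparable_complement S0coalg Zcoalg _ (fun _ => id).
  by apply: sumsp_sub => S [].
have [s sS0 zsQ] := Qsplit z zZ; set q := z - s in zsQ.
have q0 : q != 0.
  apply/negP => /eqP/subr0_eq zs; apply: z_corad; rewrite zs.
  by apply: sumsp_sub sS0 => S [Ssimple _] x xS; apply: sumsp_mem xS.
(* A subcoalgebra is recorded by the small subcoalgebras around its elements, a condition that
   passes to unions of chains. *)
pose P (D : set C) := [/\ forall a x y, D x -> D y -> D (a *: x + y),
  forall x, D x -> exists S : submodClosed C,
    [/\ subcoalgebra S, forall y, y \in S -> D y & x \in S],
  forall x, D x -> x \in Q & ~ D q].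
have [|D [[DL Dcoalg DQ Dq] Dmax]] := @Zorn_bigcup C P.
  move=> F FP Ftot; split=> [a x y [A FA Ax] [B FB By]|x [A FA Ax]|x [A FA Ax]|[A FA Aq]].
  - have [AB|BA] := Ftot A B FA FB.
      by exists B => //; have [BL _ _ _] := FP B FB; apply: BL => //; apply: AB.
    by exists A => //; have [AL _ _ _] := FP A FA; apply: AL => //; apply: BA.
  - have [_ /(_ x Ax)[S [Scoalg SA xS]] _ _] := FP A FA.
    by exists S; split=> // y yS; exists A => //; apply: SA.
  - by have [_ _ + _] := FP A FA; apply.
  - by have [_ _ _] := FP A FA.
have Dmax' (B : set C) : (D `<=` B)%classic -> P B -> (B `<=` D)%classic.
  by move=> DB PB; apply: contrapT => nBD; apply: Dmax PB; split.
(* The union of the empty chain is empty, so [P] cannot ask for 0; maximality supplies it. *)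
have D0 : D 0.
  apply: contrapT => nD0; apply: (nD0); apply: (Dmax' [set 0]%classic) => //.
    by move=> x Dx; case: nD0; have := DL (-1) x x Dx Dx; rewrite scaleN1r addNr.
  split=> [a x y -> ->|x ->|x ->|/esym/eqP]; last by rewrite eq_sym (negPf q0).
  - by rewrite /= scaler0 addr0.
  - exists (sumsp (set0 : set (submodClosed C)) : submodClosed C); split=> [||]; last exact: rpred0.
      by apply: sumsp_subcoalgebra.
    move=> y; apply: contraPP => /= y0 /asboolP[s' [s'P yE]]; apply: y0.
    by rewrite yE big1_seq // => v /andP[_ /s'P[]].
  - exact: rpred0.
have [//|//|M ME] := @submod_pack _ _ D.
have Mcoalg : subcoalgebra M.
  move=> x /ME/Dcoalg[S [Scoalg SD xS]].
  by apply: tens_subS (Scoalg x xS) => y yS; apply/ME/SD.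
have MQ : {subset M <= Q} by move=> x /ME/DQ.
have qM : q \notin M by apply/negP => /ME.
have [M' [M'coalg M'Q MM' Msplit]] := coseparable_complement Mcoalg Qcoalg MQ QZ.
have [m mM qmM'] := Msplit q zsQ.
have M'max (E : submodClosed C) e : subcoalgebra E -> {subset E <= M'} ->
    e \in E -> e != 0 -> exists a b, [/\ a \in M, b \in E & q = a + b].
  move=> Ecoalg EM' eE e0; apply/addsp_memP; apply: contrapT => /negP qME.
  have ME_D : (D `<=` [set x | x \in addsp M E])%classic.
    by move=> x /ME xM; apply/addsp_memP; exists x, 0; rewrite rpred0 addr0.
  have ED : ([set x | x \in addsp M E] `<=` D)%classic.
    apply: Dmax' ME_D _; split=> [a x y|x /= xME|x|] /=.
    - by move=> xME yME; rewrite rpredD ?rpredZ.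
    - by exists (addsp M E); split=> //; apply: addsp_subcoalgebra.
    - by move=> /addsp_memP[a [b [/MQ aQ /EM'/M'Q bQ ->]]]; apply: rpredD.
    - exact/negP.
  have /ME eM : D e by apply: ED; apply/addsp_memP; exists 0, e; rewrite rpred0 add0r.
  by move/eqP: e0; apply; apply: MM' => //; apply: EM'.
have M'simple : simple_subcoalgebra M'.
  split=> // [|E Ecoalg EM'].
    exists (q - m) => //; apply/eqP => /subr0_eq qm; by rewrite qm mM in qM.
  have [E0|nE0] := pselect (forall x, x \in E -> x = 0); [by left|right=> x].
  apply/idP/idP => [/EM' //|xM']; apply: contrapT => xE.
  have [e eE e0] : exists2 e, e \in E & e != 0.
    apply: contrapT => ne; apply: nE0 => e eE; apply: contrapT => e0; apply: ne.
    by exists e => //; apply/eqP.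
  have [E' [E'coalg E'M' EE' Esplit]] :=
    coseparable_complement Ecoalg M'coalg EM' (fun x h => QZ x (M'Q x h)).
  have [d dE xdE'] := Esplit x xM'.
  have [a [b [aM bE qE]]] := M'max E e Ecoalg EM' eE e0.
  have [|a' [b' [a'M b'E' qE']]] := M'max E' (x - d) E'coalg E'M' xdE'.
    by apply/eqP => /subr0_eq xd; rewrite xd in xE.
  (* Since q = a + b = a' + b', the difference b - b' lies both in M and in M', hence is 0. Then b
     lies in E and in E', so it is 0 as well and q = a is in M. *)
  have bb' : b - b' = 0.
    apply: MM'; last by apply: submodB; [apply: EM'|apply: E'M'].
    have -> : b - b' = a' - a.
      by apply/eqP; rewrite subr_eq addrAC eq_sym subr_eq -qE' addrC qE.
    exact: submodB.
  have b0 : b = 0 by apply: EE' => //; rewrite (subr0_eq bb').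
  by case/negP: qM; rewrite qE b0 addr0.
have [e eM' e0] : exists2 e, e \in M' & e != 0 by case: M'simple.
move/eqP: e0; apply; apply: S0Q (M'Q e eM').
by apply: (sumsp_mem (S := M')) => //; split=> // x /M'Q/QZ.
Qed.

End Coseparable.

(** * Graded coalgebras and their coradical filtration *)

Lemma big_support (I : eqType) (V : nmodType) (s t : seq I) (v : I -> V) :
  uniq s -> uniq t -> {subset s <= t} -> (forall i, i \notin s -> v i = 0) ->
  \sum_(i <- t) v i = \sum_(i <- s) v i.
Proof.
move=> us ut st v0; rewrite (bigID (mem s)) /= [X in _ + X]big1 ?addr0 => [|i]; last exact: v0.
rewrite -big_filter; apply: perm_big; apply: uniq_perm => [||i] //; first exact: filter_uniq.
by rewrite mem_filter; apply/andP/idP => [[]|is_] //; split=> //; apply: st.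
Qed.

Section DirectSum.
Variables (k : fieldType) (V : lmodType k) (I : eqType) (F : I -> submodClosed V).
Hypothesis F_sum : direct_sum F.

Lemma sumsp_finite_support (J : pred I) x :
  x \in sumsp [set S | exists2 i, J i & S = F i]%classic ->
  exists (s : seq I) (v : I -> V), [/\ uniq s, forall i, v i \in F i,
    forall i, i \notin s -> v i = 0, forall i, i \in s -> J i & x = \sum_(i <- s) v i].
Proof.
have [|a y z [s [v [us vF v0 sJ ->]]] [t [w [ut wF w0 tJ ->]]]|E EE] :=
    @submod_pack _ V (fun x => exists (s : seq I) (v : I -> V),
      [/\ uniq s, forall i, v i \in F i, forall i, i \notin s -> v i = 0,
          forall i, i \in s -> J i & x = \sum_(i <- s) v i]).
- exists [::], (fun _ => 0); split=> // [i|]; last by rewrite big_nil.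
  exact: rpred0.
- exists (undup (s ++ t)), (fun i => a *: v i + w i); split.
  + exact: undup_uniq.
  + by move=> i; rewrite rpredD ?rpredZ.
  + move=> i; rewrite mem_undup mem_cat negb_or => /andP[/v0 -> /w0 ->].
    by rewrite scaler0 addr0.
  + by move=> i; rewrite mem_undup mem_cat => /orP[/sJ|/tJ].
  rewrite big_split -scaler_sumr /=; congr (a *: _ + _); apply/esym/big_support => //;
    rewrite ?undup_uniq // => i iS; rewrite mem_undup mem_cat iS ?orbT //.
move=> xJ; apply/EE; move: x xJ; apply: sumsp_sub => _ [i Ji ->] x xF; apply/EE.
exists [:: i], (fun j => if j == i then x else 0); split=> // [j|j|j|].
- by case: eqP => [->|_]; rewrite ?rpred0.
- by rewrite inE => /negPf ->.
- by rewrite inE => /eqP ->.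
- by rewrite big_seq1 eqxx.
Qed.

Lemma direct_sum_projection : exists P : I -> {linear V -> V},
  [/\ forall i x, P i x \in F i,
      forall i j x, x \in F j -> P i x = if i == j then x else 0 &
      forall x, exists2 s : seq I, uniq s &
        (forall i, i \notin s -> P i x = 0) /\ x = \sum_(i <- s) P i x].
Proof.
have decomp x : exists sv : seq I * (I -> V), [/\ uniq sv.1,
    forall i, sv.2 i \in F i, forall i, i \notin sv.1 -> sv.2 i = 0 &
    x = \sum_(i <- sv.1) sv.2 i].
  have [|s [v [us vF v0 _ xE]]] := @sumsp_finite_support xpredT x.
    have: x \in sumsp (range F) by rewrite F_sum.1.
    apply: sumsp_sub => S [i _ <-] y yS; apply: sumsp_mem yS.
    by exists i.
  by exists (s, v).
have [sv svP] := choice decomp; pose p i x := (sv x).2 i.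
have p_unique x s v : uniq s -> (forall i, v i \in F i) ->
    (forall i, i \notin s -> v i = 0) -> x = \sum_(i <- s) v i ->
    forall i, p i x = v i.
  move=> us vF v0 xE i; have [us' pF p0 xE'] := svP x.
  apply/eqP; rewrite -subr_eq0; apply/eqP; set t := (sv x).1 in us' p0 xE'.
  have ut : uniq (undup (s ++ t)) by exact: undup_uniq.
  have [it|] := boolP (i \in undup (s ++ t)); last first.
    rewrite mem_undup mem_cat negb_or => /andP[/v0 -> /p0 px0].
    by rewrite /p px0 subrr.
  apply: (F_sum.2 (undup (s ++ t)) (fun i => p i x - v i)) => // [j|].
    by apply: submodB; [apply: pF|apply: vF].
  rewrite big_split sumrN /=; apply/eqP; rewrite subr_eq0; apply/eqP.
  have -> : \sum_(i <- undup (s ++ t)) v i = \sum_(i <- s) v i.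
    by apply: big_support => // j js; rewrite mem_undup mem_cat js.
  rewrite -xE [in RHS]xE'; apply: big_support => // j jt.
  by rewrite mem_undup mem_cat jt orbT.
have pL i : lin (p i).
  move=> a x y; have [usx pFx p0x xE] := svP x; have [usy pFy p0y yE] := svP y.
  apply: (p_unique _ (undup ((sv x).1 ++ (sv y).1)) (fun i => a *: p i x + p i y)).
  - exact: undup_uniq.
  - by move=> j; rewrite rpredD ?rpredZ // ?pFx ?pFy.
  - move=> j; rewrite mem_undup mem_cat negb_or => /andP[/p0x px0 /p0y py0].
    by rewrite /p px0 py0 scaler0 addr0.
  rewrite big_split -scaler_sumr /= {1}xE {1}yE; congr (a *: _ + _); apply/esym/big_support => //;
    rewrite ?undup_uniq // => j jS; rewrite mem_undup mem_cat jS ?orbT //.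
exists (fun i => linpack (pL i)); split=> [i x|i j x xF|x].
- by have [_ pF _ _] := svP x; apply: pF.
- rewrite linpackE; apply: (p_unique x [:: j] (fun i => if i == j then x else 0)) => // [i'|i'|].
  + by case: eqP => [->|_]; rewrite ?rpred0.
  + by rewrite inE => /negPf ->.
  + by rewrite big_seq1 eqxx.
- by have [us pF p0 xE] := svP x; exists (sv x).1 => //; split=> // i /p0.
Qed.

End DirectSum.

(** Gradings are handled through their projections: a statement on homogeneous components of Delta
    becomes an equation between linear maps, which can be checked on pure tensors and transported
    along injections. *)
Record nat_graded (k : fieldType) (C : coalgType k) (P : nat -> {linear C -> C}) : Prop :=
  NatGraded {
    proj_orth : forall i j x, P i (P j x) = if i == j then P j x else 0;
    proj_sum : forall x, exists M, x = \sum_(i < M) P i x;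
    proj_comul : forall i j x,
      tmap (P i) (P j) (comul x) = tmap (P i) (P j) (comul (P (i + j)%N x))
  }.

Lemma graded_coalgebra_nat (k : fieldType) (C : coalgType k)
    (F : nat -> submodClosed C) : graded_coalgebra F ->
  exists P, [/\ nat_graded P, forall i x, P i x \in F i &
    forall i j x, x \in F j -> P i x = if i == j then x else 0].
Proof.
move=> [Fsum Fcomul]; have [P [PF PFE Psum]] := direct_sum_projection Fsum.
have P_comul i j m x : x \in F m -> (i + j)%N != m -> tmap (P i) (P j) (comul x) = 0.
  move=> xF ijm; have [|a y z y0 z0|E EE] := @submod_pack _ _ (fun z => tmap (P i) (P j) z = 0).
  - by rewrite linear0.
  - by rewrite linearP /= y0 z0 scaler0 addr0.
  apply/EE; move: (comul x) (Fcomul m x xF).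
  apply: sumsp_sub => _ [a [b [abm ->]]]; apply: tens_sub_sub => y z yF zF; apply/EE.
  rewrite tmapE (PFE _ _ _ yF) (PFE _ _ _ zF).
  case: eqP => [ia|]; last by rewrite ptens0l.
  by case: eqP => [jb|]; [rewrite ia jb -abm eqxx in ijm|rewrite ptens0r].
exists P; split=> //; split=> [i j x|x|i j x]; first exact: PFE.
  have [s us [P0 xE]] := Psum x; exists (\max_(i <- s) i).+1.
  rewrite {1}xE -(big_mkord xpredT (fun i => P i x)) /=; apply/esym/big_support => //.
    exact: iota_uniq.
  by move=> i is_; rewrite mem_index_iota /= ltnS leq_bigmax_seq.
have [s us [P0 xE]] := Psum x; rewrite {1}xE !linear_sum.
have [ij|/P0 Pij] := boolP ((i + j)%N \in s).
  rewrite (bigD1_seq _ ij us) /= big1 ?addr0 // => m mij.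
  by apply: (@P_comul _ _ m); rewrite ?PF 1?eq_sym.
rewrite Pij !linear0 big1_seq // => m /andP[_ ms].
have [ijm|ijm] := eqVneq (i + j)%N m; last by apply: P_comul ijm; apply: PF.
by rewrite -ijm Pij !linear0.
Qed.

Section NatGraded.
Variables (k : fieldType) (C : coalgType k) (P : nat -> {linear C -> C}).
Hypothesis gP : nat_graded P.

Lemma proj_bound x : exists M, forall i, (M <= i)%N -> P i x = 0.
Proof.
have [M xE] := proj_sum gP x; exists M => i Mi.
rewrite xE linear_sum big1 // => j _; rewrite (proj_orth gP) gtn_eqF //.
exact: leq_trans (ltn_ord j) Mi.
Qed.

Lemma proj_ext x y : (forall i, P i x = P i y) -> x = y.
Proof.
move=> xy; apply/eqP; rewrite -subr_eq0; apply/eqP.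
have [M ->] := proj_sum gP (x - y); rewrite big1 // => i _.
by rewrite linearB xy subrr.
Qed.

(** Asked for all large [N], so that the bounds of two summands can be merged. *)
Lemma tens_proj_sum z : exists M, forall N, (M <= N)%N ->
    z = \sum_(i < N) \sum_(j < N) tmap (P i) (P j) z.
Proof.
move: z; apply: tens_ind => [a b||x y [M xE] [N yE]]; last 1 first.
- exists (maxn M N) => K; rewrite geq_max => /andP[/xE {1}-> /yE {1}->].
  rewrite -big_split; apply: eq_bigr => i _; rewrite -big_split.
  by apply: eq_bigr => j _; rewrite linearD.
- have bound x : exists M, forall N, (M <= N)%N -> x = \sum_(i < N) P i x.
    have [M xE] := proj_sum gP x; have [N x0] := proj_bound x; exists (maxn M N) => K.
    rewrite geq_max => /andP[MK NK]; rewrite {1}xE (big_ord_widen K (fun i => P i x)) // big_mkcond.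
    apply: eq_bigr => i _; case: ifPn => //; rewrite -leqNgt => Mi.
    rewrite xE linear_sum big1 // => j _; rewrite (proj_orth gP) gtn_eqF //.
    exact: leq_trans (ltn_ord j) Mi.
  have [M aE] := bound a; have [N bE] := bound b; exists (maxn M N) => K.
  rewrite geq_max => /andP[/aE aK /bE bK].
  transitivity (\sum_(i < K) P i a *t b).
    by rewrite {1}aK -[LHS](linpackE (lin_ptl b (@lin_id _ _))) linear_sum.
  apply: eq_bigr => i _.
  rewrite {1}bK -[LHS](linpackE (lin_ptr (P i a) (@lin_id _ _))) linear_sum.
  by apply: eq_bigr => j _; rewrite tmapE.
- by exists 0%N => N _; rewrite big1 // => i _; rewrite big1 // => j _; rewrite linear0.
Qed.

Lemma tens_proj_mem (S : submodClosed (tens C C)) z :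
  (forall i j, tmap (P i) (P j) z \in S) -> z \in S.
Proof.
have [M zE] := tens_proj_sum z => zS; rewrite (zE M) //.
by apply: rpred_sum => i _; apply: rpred_sum.
Qed.

Lemma tens_proj_ext (Y : lmodType k) (L : {linear tens C C -> Y}) z :
  (forall i j, L (tmap (P i) (P j) z) = 0) -> L z = 0.
Proof.
move=> Lz; have [M zE] := tens_proj_sum z.
by rewrite (zE M) // linear_sum big1 // => i _; rewrite linear_sum big1.
Qed.

Lemma tmap_proj i j a b z :
  tmap (P i) (P j) (tmap (P a) (P b) z) =
  if (i == a) && (j == b) then tmap (P i) (P j) z else 0.
Proof.
move: z; apply: tens_ext; [by lin|by case: (_ && _) => /=; lin|] => x y.
rewrite !tmapE !(proj_orth gP).
have [->|_] := eqVneq i a; last by rewrite ptens0l.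
by have [->|_] := eqVneq j b; rewrite ?ptens0r.
Qed.

Lemma proj_comul0 i j x : P (i + j)%N x = 0 -> tmap (P i) (P j) (comul x) = 0.
Proof. by move=> x0; rewrite (proj_comul gP) x0 !linear0. Qed.

(** The functional eps P_0 is also a right counit, and a right counit agrees with the left counit
    eps. Indeed the degree j part of x_1 eps(P_0 x_2) sees only the bidegree (j, 0) part of Delta,
    and thus only the degree j part of x. *)
Lemma counit_proj0 x : counit (P 0 x) = counit x.
Proof.
have e0 y : tlift (fun a b => (counit (P 0 b) : k) *: a) (comul y) = y.
  apply: proj_ext => j; rewrite (linear_tlift (P j)).
  pose L := linpack (ltac:(lin) : lin (fun z : tens C C =>
    tlift (fun a b => P j ((counit (P 0 b) : k) *: a)) z)).
  pose L' := linpack (ltac:(lin) : lin (fun z : tens C C =>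
    tlift (fun a b => P j ((counit b : k) *: a)) z)).
  have LE z : L z = L (tmap (P j) (P 0) z).
    rewrite !linpackE tlift_tmap; last by lin.
    by apply: eq_tlift => a b; rewrite !linearZ /= !(proj_orth gP) !eqxx.
  have rhs : P j y = L' (comul (P j y)).
    by rewrite linpackE -(linear_tlift (P j)) counitr (proj_orth gP) eqxx.
  rewrite -[LHS]/(L (comul y)) LE (proj_comul gP) addn0 -LE [RHS]rhs.
  apply/eqP; rewrite -subr_eq0; apply/eqP.
  rewrite -[LHS](linpackE (ltac:(lin) : lin (fun z => L z - L' z))).
  apply: tens_proj_ext => a b; have [->|b0] := eqVneq b 0%N.
    rewrite !linpackE !tlift_tmap; [|by lin|by lin].
    apply/eqP; rewrite subr_eq0; apply/eqP; apply: eq_tlift => u v.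
    by rewrite (proj_orth gP).
  have [->|aj] := eqVneq a j; last first.
    rewrite !linpackE !tlift_tmap; [|by lin|by lin].
    by rewrite /tlift !big1 ?subrr // => p _; rewrite linearZ /= [P j (P a _)](proj_orth gP) eq_sym (negPf aj) scaler0.
  rewrite proj_comul0 ?linear0 // (proj_orth gP).
  by have /negPf -> // : (j + b)%N != j by rewrite -[X in _ != X]addn0 eqn_add2l.
rewrite -[x in RHS]e0 linear_tlift -(@sw_counitl _ C _ (fun a => counit (P 0 a))); last by lin.
by apply: eq_tlift => a b; rewrite linearZ /=; apply: mulrC.
Qed.

(** In a simple D, the elements of degree zero form a subcoalgebra, so they are all of D or only 0.
    In the second case some functional f is eps on D and 0 on C(0). Then y = f(y_1) y_2 for y in D,
    where y_1 contributes only in positive degree, so that the top degree of y can be lowered again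
    and again and D = 0. *)
Lemma coradical_proj x : x \in coradical C -> forall i, (0 < i)%N -> P i x = 0.
Proof.
move=> xC i i0; have [|a y z y0 z0|E EE] := @submod_pack _ _ (fun x => P i x = 0).
- by rewrite linear0.
- by rewrite linearP /= y0 z0 scaler0 addr0.
apply/EE; move: x xC; apply: sumsp_sub => D [Dcoalg [d dD d0] Dsimple] x xD; apply/EE.
have [|a y z [yD yP] [zD zP]|B BE] := @submod_pack _ _ (fun x => x \in D /\ P 0 x = x).
- by rewrite rpred0 linear0.
- by rewrite linearP yP zP rpredD ?rpredZ.
have Bcoalg : subcoalgebra B.
  have [|a y z yP zP|A AE] := @submod_pack _ _ (fun x => P 0 x = x).
  - by rewrite linear0.
  - by rewrite linearP yP zP.
  apply: (subcoalgebra_cap (A := D) (B := A)) => // [y|y].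
    by split=> [/BE[yD /AE]|[yD /AE yA]] //; apply/BE.
  move=> /AE yP; suff -> : comul y = tmap (P 0) (P 0) (comul y).
    by apply: tmap_in => u; apply/AE; rewrite (proj_orth gP).
  apply/eqP; rewrite -subr_eq0; apply/eqP.
  rewrite -[LHS](linpackE (ltac:(lin) : lin (fun z => z - tmap (P 0) (P 0) z))).
  apply: tens_proj_ext => a b; rewrite linpackE tmap_proj.
  case: ifP => [/andP[/eqP <- /eqP <-]|]; first by rewrite subrr.
  rewrite subr0 => ab0; apply: proj_comul0; rewrite -yP (proj_orth gP) addn_eq0.
  by rewrite ![_ == 0%N]eq_sym ab0.
have [|B0|BD] := Dsimple B Bcoalg; first by move=> y /BE[].
  case/eqP: d0.
  (* [f] is prescribed on D + C(0); since D meets C(0) only in 0, the prescription is consistent. *)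
  have uL : lin (fun p : sub_of D * C => sub_val D p.1 + P 0 p.2).
    by lin.
  have wL : lin (fun p : sub_of D * C => counit (sub_val D p.1)) by lin.
  have [|f fE] := linear_factor (f := linpack uL) (g := linpack wL).
    move=> [u v]; rewrite (linpackE uL) (linpackE wL) /= => /eqP; rewrite addr_eq0 => /eqP uv.
    have -> : sval u = 0; last by rewrite linear0.
    by apply: B0; apply/BE; split; [apply: valP|rewrite uv linearN (proj_orth gP) eqxx].
  have fD y : y \in D -> f y = counit y.
    move=> yD; have := fE (exist _ y yD, 0).
    by rewrite (linpackE uL) (linpackE wL) /= linear0 addr0.
  have fP0 y : f (P 0 y) = 0.
    by have := fE (0, y); rewrite (linpackE uL) (linpackE wL) /= linear0 add0r.
  have [M dM] := proj_bound d.
  elim: M d dD dM => [|M IHM] y yD yM.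
    by apply: proj_ext => j; rewrite linear0 yM.
  apply: IHM => // j Mj.
  have -> : y = tlift (fun a b => (f a : k) *: b) (comul y).
    rewrite -[LHS]counitl; apply: tlift_eq_in (Dcoalg y yD) _; [by lin|by lin|].
    by move=> a b aD _; rewrite fD.
  have TL : lin (fun z => P j (tlift (fun a b => (f a : k) *: b) z)) by lin.
  apply: (tens_proj_ext (L := linpack TL)) => a b.
  have [bj|bj] := eqVneq b j; last first.
    rewrite linpackE (linear_tlift (P j)) tlift_tmap; last by lin.
    by rewrite /tlift big1 // => p _; rewrite linearZ /= (proj_orth gP) eq_sym (negPf bj) scaler0.
  have [a0|a0] := posnP a.
    rewrite linpackE tlift_tmap; last by lin.
    by rewrite /tlift big1 ?linear0 // => p _; rewrite a0 fP0 scale0r.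
  by rewrite proj_comul0 ?linear0 // yM // bj -addn1 addnC leq_add.
by have /BE[_ <-] : x \in B; rewrite ?BD // (proj_orth gP) gtn_eqF.
Qed.

(** Modulo C (x) C_n + C_0 (x) C, only the bidegrees (i, j) with i > 0 and j > n survive. *)
Lemma coradical_filtrationS n :
  (forall x, P 0 x \in coradical C) ->
  (forall x, x \in coradical_filtration C n <-> forall i, (n < i)%N -> P i x = 0) ->
  forall x, x \in coradical_filtration C n.+1 <->
    forall i j, (0 < i)%N -> (n < j)%N -> tmap (P i) (P j) (comul x) = 0.
Proof.
move=> P0C nP x; split=> [xC i j i0 nj|xP].
  have [|a y z y0 z0|E EE] := @submod_pack _ _ (fun z => tmap (P i) (P j) z = 0).
  - by rewrite linear0.
  - by rewrite linearP /= y0 z0 scaler0 addr0.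
  have /addsp_memP[u [v [uA vB ->]]] : comul x \in addsp _ _ := xC.
  apply/EE; apply: rpredD; [move: u uA|move: v vB]; apply: tens_sub_sub => a b aC bC; apply/EE; rewrite tmapE.
    by rewrite (iffLR (nP b)) ?ptens0r.
  by rewrite coradical_proj ?ptens0l.
change (comul x \in addsp (tens_sub (fullsp C) (coradical_filtration C n))
                          (tens_sub (coradical C) (fullsp C))).
apply: tens_proj_mem => i j; apply/addsp_memP.
have [->|i0] := posnP i.
  exists 0, (tmap (P 0) (P j) (comul x)); rewrite rpred0 add0r; split=> //.
  by apply: tmap_in.
have [nj|jn] := ltnP n j.
  by exists 0, 0; rewrite !rpred0 addr0 xP.
exists (tmap (P i) (P j) (comul x)), 0; rewrite rpred0 addr0; split=> //.
apply: tmap_in => // y; apply/nP => l nl; rewrite (proj_orth gP) gtn_eqF //.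
exact: leq_ltn_trans jn nl.
Qed.

(** The maps [g] say that a component of degree m + 1 is determined by its part of bidegree (1, m).
    For an element of C_{n+1} this part is 0 as soon as m > n. *)
Lemma coradical_filtrationP :
  (forall x, P 0 x \in coradical C) ->
  (forall m, exists g : {linear tens C C -> C}, forall x,
     g (tmap (P 1) (P m) (comul x)) = P m.+1 x) ->
  forall n x, x \in coradical_filtration C n <-> forall i, (n < i)%N -> P i x = 0.
Proof.
move=> P0C Pinj; elim=> [|n IHn] x.
  split=> [|xP]; first exact: coradical_proj.
  have -> : x = P 0 x; last exact: P0C.
  apply: proj_ext => -[|i]; first by rewrite (proj_orth gP).
  by rewrite xP // (proj_orth gP).
rewrite coradical_filtrationS //; split=> [xP [//|i] ni|xP i j i0 nj].
  by have [g <-] := Pinj i; rewrite xP ?linear0.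
by apply: proj_comul0; apply: xP; rewrite -addn1 addnC leq_add.
Qed.

(** If the bidegree (1, m + 1) part of an element of degree m + 2 vanishes, the element passes the
    test of [coradical_filtrationS] for C_{m+1}, which contains nothing of degree m + 2. *)
Lemma coradical_filtration_inj :
  (forall n x, x \in coradical_filtration C n <-> forall i, (n < i)%N -> P i x = 0) ->
  forall m, exists g : {linear tens C C -> C}, forall x,
     g (tmap (P 1) (P m) (comul x)) = P m.+1 x.
Proof.
move=> CP m; apply: (linear_factor (f := tmap (P 1) (P m) \o comul)) => x /= x0.
case: m x0 => [|m] x0.
  (* For m = 0 the counit of the second factor recovers the degree one part, because eps factors
     through degree zero. *)
  have L : lin (fun z : tens C C => tlift (fun a b => (counit b : k) *: a) z) by lin.
  transitivity (linpack L (tmap (P 1) (P 0) (comul x))); last by rewrite x0 linear0.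
  rewrite linpackE tlift_tmap; last by lin.
  rewrite -[x in LHS]counitr (linear_tlift (P 1)); apply: eq_tlift => a b.
  by rewrite linearZ /= counit_proj0.
suff : P m.+2 (P m.+2 x) = 0 by rewrite (proj_orth gP) eqxx.
apply: (iffLR (CP m.+1 _)); last exact: ltnSn.
have P0C y : P 0 y \in coradical C.
  by apply/(CP 0%N) => i i0; rewrite (proj_orth gP) gtn_eqF.
apply/coradical_filtrationS => // i j i0 mj.
have [ij|ij] := eqVneq (i + j)%N m.+2; last first.
  by apply: proj_comul0; rewrite (proj_orth gP) (negPf ij).
(* With i >= 1, j >= m + 1 and i + j = m + 2, this is the only bidegree left. *)
have [i1 jm] : i = 1%N /\ j = m.+1 by lia.
rewrite i1 jm in ij *; rewrite -x0 (proj_comul gP) [in RHS](proj_comul gP).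
by rewrite -ij (proj_orth gP) eqxx.
Qed.

End NatGraded.

(** * One extreme component of the comultiplication suffices *)

Section Injectivity.
Variables (k : fieldType) (X : lmodType k).
Variables (D : {linear X -> tens X X}) (e : {linear X -> k^o}).
Variable P : nat -> {linear X -> X}.
Hypothesis DA : forall x, tassoc (tmap D idfun (D x)) = tmap idfun D (D x).
Hypothesis De : forall x, tlift (fun a b => (e a : k) *: b) (D x) = x.
Hypothesis eD : forall x, tlift (fun a b => (e b : k) *: a) (D x) = x.
Hypothesis P_comul : forall i j x,
  tmap (P i) (P j) (D x) = tmap (P i) (P j) (D (P (i + j)%N x)).
Hypothesis P_counit : forall x, e (P 0 x) = e x.
Hypothesis P_inj : forall m x, tmap (P 1) (P m) (D x) = 0 ->
  tmap (P m) (P 1) (D x) = 0 -> P m.+1 x = 0.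

(* Coassociativity turns the vanishing of one extreme component of the
   comultiplication into the vanishing of the other one, by induction on the
   degree. *)
Lemma graded_injective m x :
  (tmap (P 1) (P m) (D x) = 0 -> P m.+1 x = 0) /\
  (tmap (P m) (P 1) (D x) = 0 -> P m.+1 x = 0).
Proof.
elim: m x => [|m IHm] x.
  split=> x0.
    have TL : lin (tlift (fun a b : X => (e b : k) *: a)) by lin.
    have := congr1 (mklin TL) x0; rewrite linear0 mklinE tlift_tmap => [<-|]; last by lin.
    rewrite -[in LHS](eD x) (linear_tlift (P 1)).
    by apply: eq_tlift => a b; rewrite P_counit linearZ.
  have TL : lin (tlift (fun a b : X => (e a : k) *: b)) by lin.
  have := congr1 (mklin TL) x0; rewrite linear0 mklinE tlift_tmap => [<-|]; last by lin.
  rewrite -[in LHS](De x) (linear_tlift (P 1)).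
  by apply: eq_tlift => a b; rewrite P_counit linearZ.
have [g gE] := linear_factor (f := tmap (P 1) (P m) \o D) (fun x => (IHm x).1).
have [h hE] := linear_factor (f := tmap (P m) (P 1) \o D) (fun x => (IHm x).2).
split=> x0; apply: P_inj => //.
  (* Summed over the iterated comultiplication with the first two legs grouped, [f] gives the (m +
     1, 1) component of x; with the last two legs grouped it factors through the (1, m + 1)
     component, which is 0. The second half of the proof is the mirror image. *)
  pose f a b c := g (P 1 a *t P m b) *t P 1 c.
  have PsiL : lin (tlift (fun a b => tlift (fun b1 b2 => g (a *t P m b1) *t P 1 b2) (D b))) by lin.
  transitivity (mklin PsiL (tmap (P 1) (P m.+1) (D x))); last by rewrite x0 linear0.
  transitivity (tlift (fun a b => tlift (fun a1 a2 => f a1 a2 b) (D a)) (D x)).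
    apply: eq_tlift => a b; rewrite -(gE a) /= linear_tlift tlift_ptl.
    by apply: eq_tlift.
  rewrite (@tlift_assoc _ _ _ _ _ _ _ D D f _ (D x)); [|by rewrite /f; lin|by rewrite /f; lin|by rewrite /f; lin|exact: DA].
  rewrite mklinE tlift_tmap; last by lin.
  apply: eq_tlift => a b.
  have PhiL : lin (tlift (fun b1 b2 : X => g (P 1 a *t b1) *t b2)) by lin.
  have PhiE y : tlift (fun b1 b2 => f a b1 b2) (D y) =
      mklin PhiL (tmap (P m) (P 1) (D y)).
    by rewrite mklinE tlift_tmap //; lin.
  by rewrite PhiE P_comul addn1 -PhiE.
pose f a b c := P 1 a *t h (P m b *t P 1 c).
have PsiL : lin (tlift (fun a b => tlift (fun a1 a2 => P 1 a1 *t h (P m a2 *t b)) (D a))) by lin.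
transitivity (mklin PsiL (tmap (P m.+1) (P 1) (D x))); last by rewrite x0 linear0.
transitivity (tlift (fun a b => tlift (fun b1 b2 => f a b1 b2) (D b)) (D x)).
  apply: eq_tlift => a b; rewrite -(hE b) /= linear_tlift tlift_ptr.
  by apply: eq_tlift.
rewrite -(@tlift_assoc _ _ _ _ _ _ _ D D f (D x) (D x)); [|by rewrite /f; lin|by rewrite /f; lin|by rewrite /f; lin|exact: DA].
rewrite mklinE tlift_tmap; last by lin.
apply: eq_tlift => a b.
have PhiL : lin (tlift (fun a1 a2 : X => a1 *t h (a2 *t P 1 b))) by lin.
have PhiE y : tlift (fun a1 a2 => f a1 a2 b) (D y) =
    mklin PhiL (tmap (P 1) (P m) (D y)).
  by rewrite mklinE tlift_tmap //; lin.
by rewrite PhiE P_comul add1n -PhiE.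
Qed.

End Injectivity.

(** * Hopf algebras and bosonization *)

Section HopfLemmas.
Variables (k : fieldType) (A : hopfAlgType k).

Lemma antipode1 : antipode (1 : A) = 1.
Proof.
have := antipodel (1 : A); rewrite comul1 counit1 scale1r.
by rewrite tliftE ?mulr1 //; lin.
Qed.

Lemma counit_antipode (x : A) : counit (antipode x) = counit x.
Proof.
have := congr1 counit (antipodel x).
rewrite (linear_tlift counit) linearZ /= counit1 [_ *: _]mulr1 => <-.
rewrite -[LHS](@sw_counitr _ A _ (fun a => counit (antipode a))); last by lin.
by apply: eq_tlift => a b; rewrite counitM [LHS]mulrC.
Qed.

(** The sum of S(x_1 y_1) x_2 y_2 S(y_3) S(x_3) is evaluated twice: cancelling the last four terms
    leaves S(x y), cancelling the first three terms leaves S(y) S(x). *)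
Lemma antipodeM (x y : A) : antipode (x * y) = antipode y * antipode x.
Proof.
pose G x1 x2 x3 := tlift (fun y1 y' => tlift (fun y2 y3 =>
  antipode (x1 * y1) * (x2 * (y2 * antipode y3) * antipode x3)) (comul y')) (comul y).
transitivity (tlift (fun x1 x' => tlift (fun x2 x3 => G x1 x2 x3) (comul x')) (comul x)).
  rewrite -[LHS](@sw_counitr _ _ _ (fun x => antipode (x * y))); last by lin.
  apply: eq_tlift => x1 x'; rewrite /G tlift_exchange.
  rewrite -(@sw_counitr _ _ _ (fun y => antipode (x1 * y))) ?tliftZ; last by lin.
  apply: eq_tlift => y1 y'.
  transitivity (tlift (fun x2 x3 => (counit y' : k) *: (antipode (x1 * y1) * (x2 * antipode x3))) (comul x')); last first.
    apply: eq_tlift => x2 x3.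
    transitivity (antipode (x1 * y1) * (x2 * tlift (fun y2 y3 => y2 * antipode y3) (comul y') * antipode x3)).
      by rewrite antipoder -scalerAr mulr1 -scalerAl -scalerAr.
    by rewrite !(tliftMr, tliftMl).
  rewrite -tliftZ -tliftMr antipoder -scalerAr mulr1.
  by rewrite !scalerA mulrC.
rewrite -(@sw_assoc _ _ _ G); [|by rewrite /G; lin|by rewrite /G; lin|by rewrite /G; lin].
rewrite -[RHS](@sw_counitl _ _ _ (fun x => antipode y * antipode x)); last by lin.
apply: eq_tlift => x' x3.
rewrite -(@sw_counitl _ _ _ (fun y => antipode y * antipode x3)) ?tliftZ; last by lin.
transitivity (tlift (fun x1 x2 => tlift (fun y' y3 => tlift (fun y1 y2 =>
   antipode (x1 * y1) * (x2 * (y2 * antipode y3) * antipode x3)) (comul y')) (comul y)) (comul x')).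
  apply: eq_tlift => x1 x2; rewrite /G.
  by rewrite -(@sw_assoc _ _ _ (fun y1 y2 y3 => antipode (x1 * y1) * (x2 * (y2 * antipode y3) * antipode x3)));
    [|by lin|by lin|by lin].
rewrite tlift_exchange; apply: eq_tlift => y' y3.
transitivity (tlift (fun a b => antipode a * b) (comul (x' * y')) * (antipode y3 * antipode x3)).
  rewrite comulM /tens_mul.
  have TL : lin (tlift (fun a b : A => antipode a * b)) by lin.
  rewrite -(mklinE TL) linear_tlift tliftMl; apply: eq_tlift => x1 x2.
  rewrite linear_tlift tliftMl; apply: eq_tlift => y1 y2.
  by rewrite mklinE tliftE ?mulrA //; lin.
by rewrite antipodel counitM -scalerAl mul1r scalerA.
Qed.

(** Delta S and [R] = (S (x) S) Delta^op are a left and a right convolution inverse of Delta; the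
    product Delta(S(x_1)) Delta(x_2) R(x_3) is contracted from either end. *)
Lemma comul_antipode (x : A) :
  comul (antipode x) = tlift (fun a b => antipode b *t antipode a) (comul x).
Proof.
have mul1l (u : tens A A) : tens_mul (1 *t 1) u = u.
  by move: u; apply: tens_ext; [by lin|by lin|] => a b; rewrite tens_mulE !mul1r.
have mul1r' (u : tens A A) : tens_mul u (1 *t 1) = u.
  by move: u; apply: tens_ext; [by lin|by lin|] => a b; rewrite tens_mulE !mulr1.
have mulA (u v w : tens A A) : tens_mul u (tens_mul v w) = tens_mul (tens_mul u v) w.
  move: u; apply: tens_ext; [by lin|by lin|] => a b.
  move: v; apply: tens_ext; [by lin|by lin|] => c d.
  move: w; apply: tens_ext; [by lin|by lin|] => e f.
  by rewrite !tens_mulE !mulrA.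
pose R (z : A) := tlift (fun a b => antipode b *t antipode a) (comul z).
have invr z : tlift (fun z1 z2 => tens_mul (comul z1) (R z2)) (comul z) =
    (counit z : k) *: (1 *t 1).
  transitivity (tlift (fun z1 z' => tlift (fun z2 z'' => tlift (fun z3 z4 =>
    (z1 * antipode z4) *t (z2 * antipode z3)) (comul z'')) (comul z')) (comul z)).
    rewrite -(@sw_assoc _ _ _ (fun z1 z2 z'' => tlift (fun z3 z4 =>
      (z1 * antipode z4) *t (z2 * antipode z3)) (comul z''))); [|by lin|by lin|by lin].
    apply: eq_tlift => a b; rewrite -[comul a]tlift_ptens tens_mul_tliftl tlift_ptens.
    apply: eq_tlift => z1 z2; rewrite /R tens_mul_tliftr; apply: eq_tlift => z3 z4.
    by rewrite tens_mulE.
  transitivity (tlift (fun z1 z' => (z1 * antipode z') *t (1 : A)) (comul z)).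
    apply: eq_tlift => z1 z'.
    rewrite -(@sw_assoc _ _ _ (fun z2 z3 z4 => (z1 * antipode z4) *t (z2 * antipode z3)));
      [|by lin|by lin|by lin].
    rewrite -[RHS](@sw_counitl _ _ _ (fun z' => (z1 * antipode z') *t (1 : A))); last by lin.
    by apply: eq_tlift => c z4; rewrite -tlift_ptr antipoder ptensZr.
  by rewrite -tlift_ptl antipoder ptensZl.
transitivity (tlift (fun a b => tlift (fun b1 b2 =>
    tens_mul (comul (antipode a)) (tens_mul (comul b1) (R b2))) (comul b)) (comul x)).
  rewrite -[LHS](@sw_counitr _ _ _ (fun a => comul (antipode a))); last by lin.
  apply: eq_tlift => a b; rewrite -tens_mul_tliftr invr.
  by rewrite -ptensZl -[_ *t _]/(_) -[in LHS](mul1r' (comul _)) ptensZl;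
     rewrite -[RHS](mklinE (lin_tmulr (comul (antipode a)) (@lin_id _ _))) linearZ /= mklinE.
rewrite -(@sw_assoc _ _ _ (fun a b c => tens_mul (comul (antipode a)) (tens_mul (comul b) (R c))));
  [|by rewrite /R; lin|by rewrite /R; lin|by rewrite /R; lin].
rewrite -[RHS](@sw_counitl _ _ _ R); last by rewrite /R; lin.
apply: eq_tlift => a c.
transitivity (tens_mul (comul (tlift (fun x y => antipode x * y) (comul a))) (R c)).
  rewrite (linear_tlift comul) tens_mul_tliftl; apply: eq_tlift => y z.
  by rewrite mulA -comulM.
rewrite antipodel linearZ /= comul1.
by rewrite -[LHS](mklinE (lin_tmull (R c) (@lin_id _ _))) linearZ /= mklinE mul1l.
Qed.

End HopfLemmas.

(** Stated for a linear map, so that the inclusions [sub_val] and the projections [pi] are treated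
    alike. *)
Record hopf_map (k : fieldType) (A B : hopfAlgType k) (f : {linear A -> B}) : Prop := HopfMap {
  hopf_map1 : f 1 = 1;
  hopf_mapM : forall x y, f (x * y) = f x * f y;
  hopf_map_comul : forall x, comul (f x) = tmap f f (comul x);
  hopf_map_counit : forall x, counit (f x) = counit x;
  hopf_map_antipode : forall x, antipode (f x) = f (antipode x)
}.

Lemma hopf_map_antipodel (k : fieldType) (A B : hopfAlgType k) (f : {linear A -> B}) b : hopf_map f ->
  tlift (fun a1 a2 => antipode (f a1) * f a2) (comul b) = (counit b : k)%:A.
Proof.
move=> fH; rewrite -(hopf_map_counit fH) -antipodel (hopf_map_comul fH).
by rewrite tlift_tmap //; lin.
Qed.

Section YDSweedler.
Variables (k : fieldType) (H : hopfAlgType k) (N : algType k) (B : ydHopf H N).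

Lemma yd_sw_assoc (X : lmodType k) (f : N -> N -> N -> X) x :
  (forall b c, lin (fun a => f a b c)) -> (forall a c, lin (fun b => f a b c)) ->
  (forall a b, lin (f a b)) ->
  tlift (fun a b => tlift (fun a1 a2 => f a1 a2 b) (yd_comul B a)) (yd_comul B x) =
  tlift (fun a b => tlift (fun b1 b2 => f a b1 b2) (yd_comul B b)) (yd_comul B x).
Proof. by move=> f1 f2 f3; apply: tlift_assoc => //; apply: yd_comulA. Qed.

Lemma yd_coact_assoc (X : lmodType k) (f : H -> H -> N -> X) x :
  (forall b c, lin (fun a => f a b c)) -> (forall a c, lin (fun b => f a b c)) ->
  (forall a b, lin (f a b)) ->
  tlift (fun a b => tlift (fun a1 a2 => f a1 a2 b) (comul a)) (yd_coact B x) =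
  tlift (fun a b => tlift (fun b1 b2 => f a b1 b2) (yd_coact B b)) (yd_coact B x).
Proof. by move=> f1 f2 f3; apply: tlift_assoc => //; apply: yd_coactA. Qed.

Lemma yd_sw_counitr (X : lmodType k) (f : N -> X) x : lin f ->
  tlift (fun a b => (yd_counit B b : k) *: f a) (yd_comul B x) = f x.
Proof.
move=> fL; rewrite -[x in RHS](yd_counitr B) -[RHS](mklinE fL) linear_tlift.
by apply: eq_tlift => a b; rewrite linearZ mklinE.
Qed.

Lemma yd_coact_counitE (X : lmodType k) (f : N -> X) x : lin f ->
  tlift (fun g y => (counit g : k) *: f y) (yd_coact B x) = f x.
Proof.
move=> fL; rewrite -[x in RHS](yd_coact_counit B) -[RHS](mklinE fL) linear_tlift.
by apply: eq_tlift => a b; rewrite linearZ mklinE.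
Qed.

Lemma yd_act0 h : yd_act B h 0 = 0.
Proof.
have aL : lin (fun x => yd_act B h x) by lin.
by rewrite -[LHS](mklinE aL) linear0.
Qed.

Lemma yd_actZ h c x : yd_act B h (c *: x) = c *: yd_act B h x.
Proof.
have aL : lin (fun x => yd_act B h x) by lin.
by rewrite -[LHS](mklinE aL) linearZ /= mklinE.
Qed.

Lemma yd_act_tlift (V W : lmodType k) h (f : V -> W -> N) z :
  yd_act B h (tlift f z) = tlift (fun a b => yd_act B h (f a b)) z.
Proof.
have aL : lin (fun x => yd_act B h x) by lin.
rewrite -[LHS](mklinE aL) linear_tlift.
by apply: eq_tlift => a b; rewrite mklinE.
Qed.

End YDSweedler.

(** * The relations of one factor inside U *)

Section Factor.
Variables (k : fieldType) (U H A : hopfAlgType k) (N : algType k).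
Variables (vH : {linear H -> U}) (vA : {linear A -> U}) (vN : {linear N -> U}).
Variables (pi : {linear A -> H}) (B : ydHopf H N).
Hypotheses (vH_hopf : hopf_map vH) (vA_hopf : hopf_map vA) (pi_hopf : hopf_map pi).
Hypotheses (vA_inj : injective vA) (vN_inj : injective vN).
Hypothesis vN1 : vN 1 = 1.
Hypothesis vNM : forall x y, vN (x * y) = vN x * vN y.
Hypothesis NA : forall n, exists a, vN n = vA a.
Hypothesis act_def : forall h n, vN (yd_act B h n) = adjoint (vH h) (vN n).
Hypothesis coact_def : forall n a, vA a = vN n ->
  tmap idfun vN (yd_coact B n) = tmap pi vA (comul a).
Hypothesis comul_def : forall n a, vA a = vN n ->
  tmap vN vN (yd_comul B n) = tlift (fun a12 a3 => tlift (fun a1 a2 =>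
    (vA a1 * vH (antipode (pi a2))) *t vA a3) a12) (comul3 a).

(** Inserting the induced structure maps, the right-hand side is n_1 S(pi(n_2)) pi(n_3) (x) n_4,
    where the middle terms cancel. *)
Lemma factor_comul n : comul (vN n) =
  tlift (fun a b => tlift (fun g b0 => (vN a * vH g) *t vN b0) (yd_coact B b))
    (yd_comul B n).
Proof.
have [i iE] := linear_lift NA.
have vA_inj' : injective (tmap (@idfun U) vA) by apply: tmap_inj.
set z := yd_comul B n; pose a := i n.
have LE (x y : N) :
    tlift (fun g b0 => (vN x * vH g) *t vN b0) (yd_coact B y) =
    tlift (fun c d => (vN x * vH (pi c)) *t vA d) (comul (i y)).
  have := coact_def (iE y).
  move/(congr1 (tlift (fun g u => (vN x * vH g) *t u))).
  by rewrite !tlift_tmap; [|by lin|by lin].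
(* The second leg of the braided comultiplication is moved to A, where the coaction is given by [pi]
   and Delta. *)
have z'E : tmap vN i z = tlift (fun a12 a3 => tlift (fun a1 a2 =>
        (vA a1 * vH (antipode (pi a2))) *t a3) a12) (comul3 a).
  apply: vA_inj'; rewrite (tmap_comp (h := vN) (h' := vN)) //.
  rewrite (comul_def (iE n)) (linear_tlift (tmap idfun vA)).
  apply: eq_tlift => t c; rewrite (linear_tlift (tmap idfun vA)).
  by apply: eq_tlift => x y; rewrite /= tmapE.
transitivity (tlift (fun x y => tlift (fun c d => (x * vH (pi c)) *t vA d)
    (comul y)) (tmap vN i z)); last first.
  by rewrite tlift_tmap; [apply: eq_tlift => x y; rewrite LE|lin].
rewrite {}z'E.
pose F (x : U) (y : A) := tlift (fun c d => (x * vH (pi c)) *t vA d) (comul y).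
have FL : lin (tlift F) by rewrite /F; lin.
rewrite -/F -[RHS](mklinE FL) linear_tlift.
transitivity (tlift (fun a12 a3 => tlift (fun a1 a2 =>
    F (vA a1 * vH (antipode (pi a2))) a3) a12) (comul3 a)); last first.
  apply: eq_tlift => t c; rewrite linear_tlift; apply: eq_tlift => x y.
  by rewrite mklinE tliftE // /F; lin.
rewrite -iE (hopf_map_comul vA_hopf) /comul3 tlift_tmap; last by rewrite /F; lin.
rewrite /= (@sw_assoc _ _ _ (fun a1 a2 a3 => F (vA a1 * vH (antipode (pi a2))) a3));
  [|by rewrite /F; lin|by rewrite /F; lin|by rewrite /F; lin].
rewrite /tmap; apply: eq_tlift => x y.
rewrite /F -(@sw_assoc _ _ _ (fun b c d => (vA x * vH (antipode (pi b)) * vH (pi c)) *t vA d));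
  [|by lin|by lin|by lin].
rewrite -[LHS](@sw_counitl _ _ _ (fun y => vA x *t vA y)); last by lin.
apply: eq_tlift => b d.
have GL : lin (fun h : H => (vA x * vH h) *t vA d) by lin.
transitivity (mklin GL (tlift (fun a1 a2 => antipode (pi a1) * pi a2) (comul b))).
  rewrite hopf_map_antipodel // [RHS]linearZ /= mklinE.
  by rewrite (hopf_map1 vH_hopf) mulr1.
by rewrite linear_tlift; apply: eq_tlift => b1 b2; rewrite mklinE (hopf_mapM vH_hopf) mulrA.
Qed.

(** The adjoint action gives h_1 n S(h_2) h_3 on the right. *)
Lemma factor_mul h n :
  vH h * vN n = tlift (fun h1 h2 => vN (yd_act B h1 n) * vH h2) (comul h).
Proof.
transitivity (tlift (fun h1 h2 => tlift (fun x y =>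
    vH x * vN n * antipode (vH y) * vH h2) (comul h1)) (comul h)); last first.
  apply: eq_tlift => h1 h2; rewrite act_def /adjoint (hopf_map_comul vH_hopf).
  rewrite tlift_tmap; last by lin.
  have GL : lin (fun u : U => u * vH h2) by lin.
  rewrite -[RHS](mklinE GL) linear_tlift.
  by apply: eq_tlift => x y; rewrite mklinE.
rewrite (@sw_assoc _ _ _ (fun x y z => vH x * vN n * antipode (vH y) * vH z));
  [|by lin|by lin|by lin].
rewrite -[LHS](@sw_counitr _ _ _ (fun h => vH h * vN n)); last by lin.
apply: eq_tlift => a b.
have GL : lin (fun h : H => vH a * vN n * vH h) by lin.
transitivity (mklin GL (tlift (fun x y => antipode x * y) (comul b))).
  by rewrite antipodel [RHS]linearZ /= mklinE (hopf_map1 vH_hopf) mulr1.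
by rewrite linear_tlift; apply: eq_tlift => b1 b2; rewrite mklinE (hopf_mapM vH_hopf) (hopf_map_antipode vH_hopf) !mulrA.
Qed.

(** By [factor_comul] the counit of U is a left counit for the braided comultiplication, so it
    agrees with the right counit [yd_counit]. *)
Lemma factor_counit n : yd_counit B n = counit (vN n).
Proof.
have nE : n = tlift (fun a b => (counit (vN a) : k) *: b) (yd_comul B n).
  apply: vN_inj; rewrite -[LHS]counitl factor_comul.
  have TL : lin (fun z : tens U U => tlift (fun a b => (counit a : k) *: b) z) by lin.
  rewrite -[LHS](mklinE TL) linear_tlift (linear_tlift vN).
  apply: eq_tlift => a b; rewrite linear_tlift linearZ /=.
  rewrite -[b in RHS](yd_coact_counit B) (linear_tlift vN) tliftZ.
  apply: eq_tlift => g b0; rewrite mklinE tliftE; last by lin.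
  by rewrite linearZ /= scalerA counitM (hopf_map_counit vH_hopf).
rewrite {1}nE linear_tlift -[n in RHS](yd_counitr B) (linear_tlift vN) (linear_tlift counit).
by apply: eq_tlift => a b; rewrite !linearZ /=; apply: mulrC.
Qed.

(** With S' the braided antipode, contract S'(n^1) n^2 (n^3)_{-1} S((n^3)_0) in two ways: the last
    three terms are m_1 S(m_2) for m the second leg of n, which leaves S'(n); the first two give the
    formula. *)
Lemma factor_yd_antipode n : vN (yd_antipode B n) =
  tlift (fun g n0 => vH g * antipode (vN n0)) (yd_coact B n).
Proof.
transitivity (tlift (fun a b => tlift (fun b1 b2 => tlift (fun g b0 =>
   vN (yd_antipode B a) * vN b1 * (vH g * antipode (vN b0))) (yd_coact B b2)) (yd_comul B b)) (yd_comul B n)).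
  rewrite -[n in LHS](yd_counitr B) !linear_tlift.
  apply: eq_tlift => a b; rewrite !linearZ /= factor_counit.
  have GL : lin (fun u => vN (yd_antipode B a) * u) by lin.
  transitivity (mklin GL (tlift (fun x y => x * antipode y) (comul (vN b)))).
    by rewrite antipoder [RHS]linearZ /= mklinE mulr1.
  rewrite linear_tlift factor_comul.
  have TL : lin (tlift (fun x y : U => mklin GL (x * antipode y))) by lin.
  rewrite -[LHS](mklinE TL) linear_tlift; apply: eq_tlift => b1 b2.
  rewrite linear_tlift; apply: eq_tlift => g b0.
  by rewrite mklinE tliftE ?mklinE ?mulrA //; lin.
rewrite -(@yd_sw_assoc _ _ _ B _ (fun a b c => tlift (fun g b0 =>
   vN (yd_antipode B a) * vN b * (vH g * antipode (vN b0))) (yd_coact B c)));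
  [|by lin|by lin|by lin].
have TL : lin (fun n => tlift (fun g n0 => vH g * antipode (vN n0)) (yd_coact B n)) by lin.
rewrite -[RHS](mklinE TL) -{2}(yd_counitl B n) linear_tlift.
apply: eq_tlift => a b; rewrite linearZ /=.
have GL : lin (fun u : N => vN u * mklin TL b) by lin.
transitivity (mklin GL (tlift (fun x y => yd_antipode B x * y) (yd_comul B a))).
  rewrite linear_tlift; apply: eq_tlift => x y.
  by rewrite mklinE vNM mklinE tliftMr.
by rewrite yd_antipodel linearZ /= mklinE vN1 mul1r.
Qed.

(** Inverts [factor_yd_antipode] by S(n_{-2}) n_{-1}. It is used to keep S(n) in N(0) H when n has
    degree zero. *)
Lemma factor_antipode n : antipode (vN n) =
  tlift (fun g n0 => antipode (vH g) * vN (yd_antipode B n0)) (yd_coact B n).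
Proof.
transitivity (tlift (fun g n0 => tlift (fun g' n00 =>
    antipode (vH g) * (vH g' * antipode (vN n00))) (yd_coact B n0)) (yd_coact B n)); last first.
  by apply: eq_tlift => g n0; rewrite factor_yd_antipode tliftMr.
rewrite -(@yd_coact_assoc _ _ _ B _ (fun g g' n0 => antipode (vH g) * (vH g' * antipode (vN n0))));
  [|by lin|by lin|by lin].
rewrite -[LHS](@yd_coact_counitE _ _ _ B _ (fun n => antipode (vN n))); last by lin.
apply: eq_tlift => g n0.
transitivity (tlift (fun x y => antipode (vH x) * vH y) (comul g) * antipode (vN n0)).
  by rewrite hopf_map_antipodel // -scalerAl mul1r.
by rewrite tliftMl; apply: eq_tlift => x y; rewrite mulrA.
Qed.

End Factor.

(** * Gradings and integrals of Yetter-Drinfeld Hopf algebras *)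

(** The form in which the grading of a factor is used: [ydg_inj] is what the coradical filtration
    contributes, by [coradical_filtration_inj], and product and antipode appear in degree zero,
    where the integral is evaluated. *)
Record yd_grading (k : fieldType) (H : hopfAlgType k) (N : algType k)
    (B : ydHopf H N) (P : nat -> {linear N -> N}) : Prop := YDGrading {
  ydg_orth : forall i j x, P i (P j x) = if i == j then P j x else 0;
  ydg_sum : forall x, exists M, x = \sum_(i < M) P i x;
  ydg_comul : forall i j x,
    tmap (P i) (P j) (yd_comul B x) = tmap (P i) (P j) (yd_comul B (P (i + j)%N x));
  ydg_comul0 : forall x, P 0 x = x ->
    tmap (P 0) (P 0) (yd_comul B x) = yd_comul B x;
  ydg_inj : forall m, exists g : {linear tens N N -> N}, forall x,
    g (tmap (P 1) (P m) (yd_comul B x)) = P m.+1 x;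
  ydg_counit : forall i x, yd_counit B (P i x) = if i == 0 then yd_counit B x else 0;
  ydg_act : forall i h x, P i (yd_act B h x) = yd_act B h (P i x);
  ydg_coact : forall i x, yd_coact B (P i x) = tmap idfun (P i) (yd_coact B x);
  ydg_one : P 0 1 = 1;
  ydg_mul : forall x y, P 0 x = x -> P 0 y = y -> P 0 (x * y) = x * y;
  ydg_antipode : forall x, P 0 x = x -> P 0 (yd_antipode B x) = yd_antipode B x
}.

Lemma nat_graded_comul0 (k : fieldType) (C : coalgType k)
    (P : nat -> {linear C -> C}) x : nat_graded P -> P 0 x = x ->
  tmap (P 0) (P 0) (comul x) = comul x.
Proof.
move=> gP x0; apply/esym/eqP; rewrite -subr_eq0; apply/eqP.
have TL : lin (fun z => z - tmap (P 0) (P 0) z) by lin.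
rewrite -[LHS](mklinE TL); apply: (tens_proj_ext gP) => i j.
rewrite mklinE (tmap_proj gP); case: ifP => [/andP[/eqP <- /eqP <-]|ij].
  by rewrite subrr.
rewrite subr0; apply: (proj_comul0 gP); rewrite -x0 (proj_orth gP).
by rewrite addn_eq0 ![_ == 0%N]eq_sym ij.
Qed.

Lemma sumsp_proj (k : fieldType) (C : coalgType k) (P : nat -> {linear C -> C})
    (F : nat -> submodClosed C) n x :
  nat_graded P -> (forall i x, P i x \in F i) ->
  (forall i j x, x \in F j -> P i x = if i == j then x else 0) ->
  x \in sumsp [set S | exists2 i, (i <= n)%N & S = F i]%classic <->
  forall i, (n < i)%N -> P i x = 0.
Proof.
move=> gP PF PFE; split=> [xS i ni|x0].
  have [|a y z y0 z0|E EE] := @submod_pack _ _ (fun x => P i x = 0).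
  - by rewrite linear0.
  - by rewrite linearP /= y0 z0 scaler0 addr0.
  apply/EE; move: x xS; apply: sumsp_sub => _ [j jn ->] x xF; apply/EE.
  by rewrite (PFE i j) // gtn_eqF // (leq_ltn_trans jn ni).
have [M ->] := proj_sum gP x; apply: rpred_sum => i _.
have [ni|jn] := ltnP n i; first by rewrite x0 // rpred0.
by apply: (sumsp_mem (S := F i)) => //; exists (i : nat).
Qed.

Section YDGradings.
Variables (k : fieldType) (H : hopfAlgType k) (N : algType k) (B : ydHopf H N).
Variable F : nat -> submodClosed N.
Hypothesis F_graded : coradically_graded_ydHopf B F.

Lemma coradically_graded_yd_grading : exists P : nat -> {linear N -> N},
  [/\ yd_grading B P, forall i x, P i x \in F i,
      forall i j x, x \in F j -> P i x = if i == j then x else 0 &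
      coradical (yd_coalg B) =i F 0].
Proof.
have [Fyd F1 FM FS [Fcoalg Fcorad]] := F_graded.
have [P [gP PF PFE]] := @graded_coalgebra_nat k (yd_coalg B) F Fcoalg.
have cfP n x : x \in coradical_filtration (yd_coalg B) n <->
    forall i, (n < i)%N -> P i x = 0.
  by rewrite Fcorad; apply: sumsp_proj.
have P0F x : P 0 x = x <-> x \in F 0.
  by split=> [<-|xF] //; rewrite (PFE 0%N 0%N).
have decomp (Y : lmodType k) (f g : {linear N -> Y}) :
    (forall i x, x \in F i -> f x = g x) -> f =1 g.
  move=> fg x; have [M ->] := proj_sum gP x; rewrite !linear_sum.
  by apply: eq_bigr => i _; apply: fg (PF i x).
exists P; split=> //; last first.
  move=> x; apply/idP/idP => [xC|xF].
    apply/P0F; apply: (proj_ext gP) => -[|i]; first by rewrite (proj_orth gP).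
    have Pi0 : P i.+1 x = 0 by apply: (iffLR (cfP 0%N x) xC).
    by rewrite Pi0 (proj_orth gP).
  by apply/(cfP 0%N) => i i0; rewrite (PFE i 0%N) // gtn_eqF.
split.
- exact: (proj_orth gP).
- exact: (proj_sum gP).
- exact: (proj_comul gP).
- by move=> x x0; apply: (nat_graded_comul0 gP x0).
- exact: (coradical_filtration_inj gP cfP).
- move=> i x; case: eqP => [->|/eqP i0]; first exact: (counit_proj0 gP).
  have := counit_proj0 gP (P i x); rewrite (proj_orth gP) eq_sym (negPf i0) linear0.
  by move/esym.
- move=> i h x.
  have fL : lin (fun x => P i (yd_act B h x)) by lin.
  have gL : lin (fun x => yd_act B h (P i x)) by lin.
  rewrite -[LHS](mklinE fL) -[RHS](mklinE gL); apply: decomp => j {}x xF.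
  rewrite !mklinE !(PFE i j) //; last by have [+ _] := Fyd j; apply.
  by case: eqP => // _; rewrite yd_act0.
- move=> i x; have fL : lin (fun x => yd_coact B (P i x)) by lin.
  have gL : lin (fun x => tmap idfun (P i) (yd_coact B x)) by lin.
  rewrite -[LHS](mklinE fL) -[RHS](mklinE gL); apply: decomp => j {}x xF.
  rewrite !mklinE (PFE i j) //; have [_ /(_ x xF) xHF] := Fyd j.
  case: eqP => [->|ij].
    rewrite -[LHS](@tmap_id _ _ _ idfun idfun) //.
    by apply: tmap_eq_in xHF _ _ => // y yF /=; rewrite (PFE j j) // eqxx.
  rewrite linear0 (tmap_eq_in (f' := idfun) (g' := \0) xHF) // => [|y yF /=].
    move: (yd_coact B x); apply: tens_ext; [by lin|by lin|] => a b.
    by rewrite tmapE /= ptens0r.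
  by rewrite (PFE i j) //; case: eqP.
- exact/P0F.
- by move=> x y /P0F xF /P0F yF; apply/P0F; apply: (FM 0%N 0%N).
- by move=> x /P0F xF; apply/P0F; apply: FS.
Qed.

Variable P : nat -> {linear N -> N}.
Hypothesis gP : yd_grading B P.
Hypothesis P0C : forall x, P 0 x \in coradical (yd_coalg B).

(** The integral attached to the grouplike 1. That it is H-linear and H-colinear follows from the
    two-sided integral property, by evaluating one expression in two ways, as in a proof that
    integrals are unique. *)
Lemma yd_integral : exists lam : {linear N -> k^o}, [/\ lam 1 = 1,
  forall x, P 0 x = x -> tlift (fun a b => (lam b : k) *: a) (yd_comul B x) = (lam x : k) *: 1,
  forall h x, lam (yd_act B h x) = (counit h : k) * (lam x : k) &
  forall x, tlift (fun g y => (lam y : k) *: g) (yd_coact B x) = (lam x : k) *: 1].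
Proof.
have [||lam0 [lam01 lam0P]] := @coradical_integral k (yd_coalg B) (1 : N).
- exact: yd_comul_one.
- exact: yd_counit_one.
(* The integral property holds on the coradical N(0) only; composing with [P 0] extends it by 0 to
   the positive degrees. *)
pose lam : {linear N -> k^o} := lam0 \o P 0.
have lamP0 x : lam (P 0 x) = lam x by rewrite /= (ydg_orth gP).
have lamE x : P 0 x = x -> lam x = lam0 x by rewrite /= => ->.
have intl x : P 0 x = x -> tlift (fun a b => (lam b : k) *: a) (yd_comul B x) = (lam x : k) *: 1.
  move=> x0; have := P0C x; rewrite x0 => /lam0P[+ _].
  rewrite lamE // => <-; rewrite -(ydg_comul0 gP x0) !tlift_tmap; [|by lin|by lin].
  by apply: eq_tlift => a b; rewrite /= (ydg_orth gP).
have intr x : P 0 x = x -> tlift (fun a b => (lam a : k) *: b) (yd_comul B x) = (lam x : k) *: 1.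
  move=> x0; have := P0C x; rewrite x0 => /lam0P[_ +].
  rewrite lamE // => <-; rewrite -(ydg_comul0 gP x0) !tlift_tmap; [|by lin|by lin].
  by apply: eq_tlift => a b; rewrite /= (ydg_orth gP).
have lam1 : lam 1 = 1 by rewrite lamE ?(ydg_one gP).
have lam_act1 h : lam (yd_act B h 1) = counit h.
  by rewrite yd_act_one linearZ /= -[lam0 _]/(lam 1) lam1 [LHS]mulr1.
clearbody lam.
exists lam; split=> // [h x0|x0].
- rewrite -(lamP0 (yd_act B h x0)) (ydg_act gP) -(lamP0 x0).
  have xE : P 0 (P 0 x0) = P 0 x0 by rewrite (ydg_orth gP).
  move: (P 0 x0) xE => x xE {x0}.
  (* [W] is lam(S(h_1) (h_2 x)^1) lam((h_2 x)^2). The integral property at h_2 x gives lam(h x).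
     Expanding the comultiplication of h_2 x cancels S(h_1) h_2 and leaves lam(x^1) lam(h x^2),
     which is eps(h) lam(x) by the integral property at x. *)
  pose W := tlift (fun h1 h2 => lam (yd_act B (antipode h1)
    (tlift (fun a b => (lam b : k) *: a) (yd_comul B (yd_act B h2 x))))) (comul h).
  transitivity W.
    rewrite -[LHS](@sw_counitl _ _ _ (fun h => lam (yd_act B h x))); last by lin.
    apply: eq_tlift => h1 h2; rewrite intl ?(ydg_act gP) ?xE // yd_actZ linearZ.
    by rewrite lam_act1 counit_antipode; apply: mulrC.
  pose G h1 h' h'' := tlift (fun a b =>
    (lam (yd_act B h'' b) : k) *: lam (yd_act B (antipode h1 * h') a)) (yd_comul B x).
  transitivity (tlift (fun h1 h2 => tlift (fun h' h'' => G h1 h' h'') (comul h2)) (comul h)).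
    apply: eq_tlift => h1 h2; rewrite yd_act_comul /yd_act2.
    have TL : lin (tlift (fun a b : N => (lam b : k) *: a)) by lin.
    rewrite -[tlift _ (tlift _ _)](mklinE TL) linear_tlift yd_act_tlift linear_tlift.
    apply: eq_tlift => h' h''; rewrite linear_tlift yd_act_tlift linear_tlift.
    apply: eq_tlift => a b; rewrite mklinE tliftE; last by lin.
    by rewrite yd_actZ linearZ yd_actM.
  rewrite -(@sw_assoc _ _ _ G); [|by rewrite /G; lin|by rewrite /G; lin|by rewrite /G; lin].
  pose K h'' := tlift (fun a b => (lam (yd_act B h'' b) : k) *: lam a) (yd_comul B x).
  transitivity (K h).
    rewrite -[RHS](@sw_counitl _ _ _ K); last by rewrite /K; lin.
    apply: eq_tlift => c h''; rewrite /G tlift_exchange /K tliftZ.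
    apply: eq_tlift => a b; rewrite -tliftZ [RHS]scalerA [in RHS]mulrC -[RHS]scalerA.
    congr (_ *: _); have AL : lin (fun h => lam (yd_act B h a)) by lin.
    transitivity (mklin AL (tlift (fun h1 h' => antipode h1 * h') (comul c))).
      by rewrite linear_tlift; apply: eq_tlift => h1 h'; rewrite mklinE.
    by rewrite antipodel linearZ /= mklinE yd_act1.
  transitivity (lam (yd_act B h (tlift (fun a b => (lam a : k) *: b) (yd_comul B x)))).
    rewrite yd_act_tlift linear_tlift; apply: eq_tlift => a b.
    by rewrite yd_actZ linearZ; apply: mulrC.
  by rewrite intr // yd_actZ linearZ lam_act1; apply: mulrC.
transitivity (tlift (fun g y => (lam y : k) *: g) (yd_coact B (P 0 x0))).
  rewrite (ydg_coact gP) tlift_tmap; last by lin.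
  by apply: eq_tlift => g y; rewrite lamP0.
rewrite -(lamP0 x0).
have xE : P 0 (P 0 x0) = P 0 x0 by rewrite (ydg_orth gP).
move: (P 0 x0) xE => x xE {x0}.
have muL : lin (fun x => tlift (fun g y => (lam y : k) *: g) (yd_coact B x)) by lin.
have PsiL : lin (fun y => tlift (fun g y0 => (lam y0 : k) *: antipode g) (yd_coact B y)) by lin.
(* With mu(y) = y_{-1} lam(y_0) and Psi(y) = S(y_{-1}) lam(y_0), the expression evaluated twice is
   x_{-1} lam((x_0)^1) Psi((x_0)^2). The integral property gives mu(x). Colinearity of the
   comultiplication gives mu(x^1) lam(x^2), since y_{-1} Psi(y_0) = lam(y) 1, and this is lam(x)
   1. *)
pose mu := mklin muL; pose Psi := mklin PsiL.
have mu1 : mu 1 = 1.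
  by rewrite mklinE yd_coact_one tliftE ?lam1 ?scale1r //; lin.
have Psi1 : Psi 1 = 1.
  by rewrite mklinE yd_coact_one tliftE ?lam1 ?scale1r ?antipode1 //; lin.
have PhiL : lin (tlift (fun g t => g * tlift (fun a b => (lam a : k) *: Psi b) t)) by lin.
transitivity (mklin PhiL (tmap idfun (yd_comul B) (yd_coact B x))).
  rewrite mklinE tlift_tmap; last by lin.
  rewrite -xE (ydg_coact gP) !tlift_tmap; [|by lin|by lin].
  apply: eq_tlift => g y /=; have yE : P 0 (P 0 y) = P 0 y by rewrite (ydg_orth gP).
  transitivity (g * Psi (tlift (fun a b => (lam a : k) *: b) (yd_comul B (P 0 y)))).
    by rewrite intr // linearZ /= Psi1 -scalerAr mulr1.
  by congr (_ * _); rewrite linear_tlift; apply: eq_tlift => a b; rewrite linearZ.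
rewrite yd_coact_comul /yd_coact2 linear_tlift.
transitivity (tlift (fun a b => (lam b : k) *: mu a) (yd_comul B x)); last first.
  transitivity (mu (tlift (fun a b => (lam b : k) *: a) (yd_comul B x))).
    by rewrite linear_tlift; apply: eq_tlift => a b; rewrite linearZ.
  by rewrite intl // linearZ /= mu1.
apply: eq_tlift => a b; rewrite linear_tlift mklinE tliftZ.
apply: eq_tlift => g a0; rewrite linear_tlift.
have bE : tlift (fun g' b0 => g' * Psi b0) (yd_coact B b) = (lam b : k) *: 1.
  transitivity (tlift (fun g' b0 => tlift (fun g'' b00 =>
      (lam b00 : k) *: (g' * antipode g'')) (yd_coact B b0)) (yd_coact B b)).
    apply: eq_tlift => g' b0; rewrite mklinE tliftMr.
    by apply: eq_tlift => g'' b00; rewrite scalerAr.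
  rewrite -(@yd_coact_assoc _ _ _ B _ (fun g' g'' b0 => (lam b0 : k) *: (g' * antipode g'')));
    [|by lin|by lin|by lin].
  rewrite -[RHS](@yd_coact_counitE _ _ _ B _ (fun b => (lam b : k) *: 1)); last by lin.
  apply: eq_tlift => c b0; rewrite -tliftZ antipoder !scalerA.
  by rewrite [in LHS]mulrC.
transitivity ((lam a0 : k) *: (g * tlift (fun g' b0 => g' * Psi b0) (yd_coact B b))).
  rewrite tliftMr tliftZ; apply: eq_tlift => g' b0.
  rewrite mklinE tliftE; last by lin.
  by rewrite tliftE ?scalerAr ?mulrA //; lin.
by rewrite bE -scalerAr mulr1 !scalerA mulrC.
Qed.

End YDGradings.

(** * The expectation of a bosonization onto the base *)

Section Expectation.
Variables (k : fieldType) (U H : hopfAlgType k) (N : algType k).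
Variables (vH : {linear H -> U}) (vN : {linear N -> U}) (B : ydHopf H N).
Hypotheses (vH_hopf : hopf_map vH) (vN1 : vN 1 = 1).
Hypothesis vNM : forall x y, vN (x * y) = vN x * vN y.
Hypothesis comulN : forall n, comul (vN n) =
  tlift (fun a b => tlift (fun g b0 => (vN a * vH g) *t vN b0) (yd_coact B b))
    (yd_comul B n).
Hypothesis mulHN : forall h n,
  vH h * vN n = tlift (fun h1 h2 => vN (yd_act B h1 n) * vH h2) (comul h).
Hypothesis antipodeN : forall n, antipode (vN n) =
  tlift (fun g n0 => antipode (vH g) * vN (yd_antipode B n0)) (yd_coact B n).

Section ProductSpan.
Variable Q : {linear N -> N}.
Hypothesis Q_id : forall x, Q (Q x) = Q x.
Hypothesis Q_act : forall h x, Q (yd_act B h x) = yd_act B h (Q x).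
Hypothesis Q_coact : forall x, yd_coact B (Q x) = tmap idfun Q (yd_coact B x).
Hypothesis Q1 : Q 1 = 1.
Hypothesis QM : forall x y, Q x = x -> Q y = y -> Q (x * y) = x * y.
Hypothesis QS : forall x, Q x = x -> Q (yd_antipode B x) = yd_antipode B x.

(** Used twice: with [Q] the identity it is N H, with [Q] the projection to degree zero it is N(0)
    H. *)
Definition product_span : submodClosed U := lrange (tlift_mul (vN \o Q) vH).

Lemma tlift_mulE (V W : lmodType k) (f : {linear V -> U}) (g : {linear W -> U}) x y :
  tlift_mul f g (x *t y) = f x * g y.
Proof. by rewrite /tlift_mul tliftE //; lin. Qed.

Lemma product_span_pt n h : Q n = n -> vN n * vH h \in product_span.
Proof.
by move=> nQ; apply/asboolP; exists (n *t h); rewrite /= tlift_mulE /= nQ.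
Qed.

Lemma product_span_sub (E : submodClosed U) :
  (forall n h, Q n = n -> vN n * vH h \in E) -> {subset product_span <= E}.
Proof.
move=> ptE u /asboolP[t ->]; apply: (tens_mem (E := lpreim (tlift_mul (vN \o Q) vH) E)) => n h.
by change (tlift_mul (vN \o Q) vH (n *t h) \in E); rewrite tlift_mulE /=; apply: ptE.
Qed.

Lemma product_span_mull u h : u \in product_span -> vH h * u \in product_span.
Proof.
have fL : lin (fun u : U => vH h * u) by lin.
rewrite -[vH h * u](mklinE fL); move: u.
apply: (product_span_sub (E := lpreim (mklin fL) product_span)) => n g nQ.
change (mklin fL (vN n * vH g) \in product_span).
rewrite mklinE mulrA mulHN tliftMl /tlift; apply: rpred_sum => p _.
by rewrite -mulrA -(hopf_mapM vH_hopf); apply: product_span_pt; rewrite Q_act nQ.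
Qed.

Lemma product_span_mulNl u n : Q n = n -> u \in product_span ->
  vN n * u \in product_span.
Proof.
move=> nQ; have fL : lin (fun u : U => vN n * u) by lin.
rewrite -[vN n * u](mklinE fL); move: u.
apply: (product_span_sub (E := lpreim (mklin fL) product_span)) => m g mQ.
change (mklin fL (vN m * vH g) \in product_span).
by rewrite mklinE mulrA -vNM; apply: product_span_pt; apply: QM.
Qed.

Lemma product_span_antipode n : Q n = n -> antipode (vN n) \in product_span.
Proof.
move=> nQ; rewrite antipodeN -nQ Q_coact tlift_tmap; last by lin.
rewrite /tlift; apply: rpred_sum => p _; rewrite /= (hopf_map_antipode vH_hopf).
apply: product_span_mull; rewrite -[vN _]mulr1 -(hopf_map1 vH_hopf).
by apply: product_span_pt; apply: QS.
Qed.

Lemma product_span_triple n h m : Q n = n -> Q m = m ->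
  vN n * vH h * antipode (vN m) \in product_span.
Proof.
move=> nQ mQ; rewrite -mulrA; apply: product_span_mulNl => //.
by apply: product_span_mull; apply: product_span_antipode.
Qed.

End ProductSpan.

Variable P : nat -> {linear N -> N}.
Hypothesis gP : yd_grading B P.
Variable lam : {linear N -> k^o}.
Hypothesis lam1 : lam 1 = 1.
Hypothesis lam_integral : forall x, P 0 x = x ->
  tlift (fun a b => (lam b : k) *: a) (yd_comul B x) = (lam x : k) *: 1.
Hypothesis lam_act : forall h x, lam (yd_act B h x) = (counit h : k) * (lam x : k).
Hypothesis lam_coact : forall x,
  tlift (fun g y => (lam y : k) *: g) (yd_coact B x) = (lam x : k) *: 1.
Hypothesis NH_inj : injective (tlift_mul vN vH).

(* [E] is the expectation [n h |-> lam n h] of the bosonization onto [H]. *)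
Lemma smash_expectation : exists E : {linear U -> H}, [/\ E 1 = 1,
  forall n s m h, E (vH h * (vN n * vH s * antipode (vN m))) =
    h * E (vN n * vH s * antipode (vN m)),
  forall n s m h, E (vN n * vH s * antipode (vN m) * vH h) =
    E (vN n * vH s * antipode (vN m)) * h &
  forall n s m, P 0 n = n -> P 0 m = m ->
    tmap idfun E (comul (vN n * vH s * antipode (vN m))) =
    tmap vH idfun (comul (E (vN n * vH s * antipode (vN m))))].
Proof.
(* A retraction extends the expectation to all of U. Its values outside N H are arbitrary, which is
   why the other clauses speak of elements n s S(m) only. *)
have [r rK] := linear_retract (f := tlift_mul vN vH) NH_inj.
have EL : lin (fun u => tlift (fun n h => (lam n : k) *: h) (r u)) by lin.
pose E := mklin EL.
have E0 n h : E (vN n * vH h) = (lam n : k) *: h.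
  by rewrite mklinE -(tlift_mulE vN vH) [r _]rK tliftE //; lin.
have idspan n s m : vN n * vH s * antipode (vN m) \in product_span idfun.
  by apply: product_span_triple => // x; rewrite tmap_id.
exists E; split.
- by rewrite -[1 in LHS]mulr1 -{1}vN1 -(hopf_map1 vH_hopf) E0 lam1 scale1r.
- move=> n s m h; move: (_ * antipode _) (idspan n s m) => u uA.
  have fL : lin (fun u => E (vH h * u) - h * E u) by lin.
  apply/eqP; rewrite -subr_eq0 -[_ - _](mklinE fL).
  have [|a y z y0 z0|D DE] := @submod_pack _ _ (fun u => mklin fL u = 0).
  + by rewrite linear0.
  + by rewrite linearP /= y0 z0 scaler0 addr0.
  apply/eqP/DE; move: u uA; apply: (product_span_sub (Q := idfun)) => [//|n' g _]; apply/DE.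
  move: n' => {}n.
  rewrite mklinE E0 mulrA mulHN tliftMl linear_tlift.
  apply/eqP; rewrite subr_eq0; apply/eqP.
  transitivity (tlift (fun h1 h2 => (counit h1 : k) *: ((lam n : k) *: (h2 * g))) (comul h)).
    apply: eq_tlift => h1 h2; rewrite -mulrA -(hopf_mapM vH_hopf) E0 lam_act.
    by rewrite scalerA.
  by rewrite (@sw_counitl _ _ _ (fun h2 => (lam n : k) *: (h2 * g))) ?scalerAr //; lin.
- move=> n s m h; move: (_ * antipode _) (idspan n s m) => u uA.
  have fL : lin (fun u => E (u * vH h) - E u * h) by lin.
  apply/eqP; rewrite -subr_eq0 -[_ - _](mklinE fL).
  have [|a y z y0 z0|D DE] := @submod_pack _ _ (fun u => mklin fL u = 0).
  + by rewrite linear0.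
  + by rewrite linearP /= y0 z0 scaler0 addr0.
  apply/eqP/DE; move: u uA; apply: (product_span_sub (Q := idfun)) => [//|n' g _]; apply/DE.
  move: n' => {}n.
  by rewrite mklinE -mulrA -(hopf_mapM vH_hopf) !E0 scalerAl subrr.
- move=> n s m n0 m0.
  have : vN n * vH s * antipode (vN m) \in product_span (P 0).
    apply: product_span_triple => //; [by move=> x; rewrite (ydg_orth gP)|exact: (ydg_act gP)|
      exact: (ydg_coact gP)|exact: (ydg_mul gP)|exact: (ydg_antipode gP)].
  move: (_ * antipode _) => {s m n0 m0} u uA.
  have fL : lin (fun u => tmap idfun E (comul u) - tmap vH idfun (comul (E u))) by lin.
  apply/eqP; rewrite -subr_eq0 -[_ - _](mklinE fL).
  have [|a y z y0 z0|D DE] := @submod_pack _ _ (fun u => mklin fL u = 0).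
  + by rewrite linear0.
  + by rewrite linearP /= y0 z0 scaler0 addr0.
  apply/eqP/DE; move: u uA; apply: product_span_sub => [x|{}n h n0]; first by rewrite (ydg_orth gP).
  apply/DE; rewrite mklinE E0.
  apply/eqP; rewrite subr_eq0; apply/eqP.
  rewrite comulM (hopf_map_comul vH_hopf) comulN.
  set Y := tmap vH vH _.
  have TL : lin (fun X => tmap idfun E (tens_mul X Y)).
    by apply: (@lin_app _ _ _ _ (tmap idfun E)); apply: tens_mul_linear_l.
  have TE u w : tmap idfun E (tens_mul (u *t w) Y) =
      tlift (fun h1 h2 => (u * vH h1) *t E (w * vH h2)) (comul h).
    rewrite /tens_mul tliftE; last exact: tens_mul_bilinear_l.
    rewrite tlift_tmap; last by lin.
    by rewrite (linear_tlift (tmap idfun E)); apply: eq_tlift => h1 h2; rewrite /= tmapE.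
  rewrite -[LHS](mklinE TL) linear_tlift.
  (* Applying E to the second leg of Delta(n h) leaves n^1 (n^2)_{-1} h_1 lam((n^2)_0) (x) h_2.
     Colinearity of [lam] removes the coaction term, then the integral property replaces n^1
     lam(n^2) by lam(n) 1. *)
  transitivity (tlift (fun a b => (lam b : k) *: tlift (fun h1 h2 => (vN a * vH h1) *t h2) (comul h)) (yd_comul B n)).
    apply: eq_tlift => a b; rewrite linear_tlift.
    have GL : lin (fun g => tlift (fun h1 h2 => (vN a * vH g * vH h1) *t h2) (comul h)) by lin.
    transitivity (mklin GL (tlift (fun g y => (lam y : k) *: g) (yd_coact B b))).
      rewrite linear_tlift; apply: eq_tlift => g b0; rewrite mklinE TE linearZ /= mklinE tliftZ.
      by apply: eq_tlift => h1 h2; rewrite E0 ptensZr.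
    by rewrite lam_coact linearZ /= mklinE (hopf_map1 vH_hopf) mulr1.
  have GL : lin (fun a => tlift (fun h1 h2 => (vN a * vH h1) *t h2) (comul h)) by lin.
  transitivity (mklin GL (tlift (fun a b => (lam b : k) *: a) (yd_comul B n))).
    by rewrite linear_tlift; apply: eq_tlift => a b; rewrite linearZ /= mklinE.
  rewrite lam_integral // !linearZ /= mklinE; congr (_ *: _).
  by rewrite /tmap; apply: eq_tlift => h1 h2; rewrite vN1 mul1r.
Qed.

End Expectation.

(** * Adjoining one factor *)

Section PullbackCoalgebra.
Variables (k : fieldType) (C : coalgType k) (X : lmodType k) (m : {linear X -> C}).
Variable D : {linear X -> tens X X}.
Hypothesis m_inj : injective m.
Hypothesis m_comul : forall x, tmap m m (D x) = comul (m x).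

Definition pullback_counit : {linear X -> k^o} := counit \o m.

(** [X] is not equipped with a coalgebra structure; the axioms of [C] are read off through the
    injection [m]. *)
Lemma pullback_comulA x : tassoc (tmap D idfun (D x)) = tmap idfun D (D x).
Proof.
apply: (tmap_inj m_inj (tmap_inj m_inj m_inj)).
rewrite -tassoc_tmap.
rewrite (tmap_comp (h := comul \o m) (h' := m)) //.
rewrite (tmap_comp (h := m) (h' := comul \o m)) //.
have e1 t : tmap (comul \o m) m t = tmap comul idfun (tmap m m t).
  by rewrite (tmap_comp (h := comul \o m) (h' := m)).
have e2 t : tmap m (comul \o m) t = tmap idfun comul (tmap m m t).
  by rewrite (tmap_comp (h := m) (h' := comul \o m)).
by rewrite e1 e2 m_comul; apply: comulA.
Qed.

Lemma pullback_counitl x : tlift (fun a b => (pullback_counit a : k) *: b) (D x) = x.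
Proof.
apply: m_inj; rewrite linear_tlift -[RHS]counitl -m_comul tlift_tmap; last by lin.
by apply: eq_tlift => a b; rewrite linearZ.
Qed.

Lemma pullback_counitr x : tlift (fun a b => (pullback_counit b : k) *: a) (D x) = x.
Proof.
apply: m_inj; rewrite linear_tlift -[RHS]counitr -m_comul tlift_tmap; last by lin.
by apply: eq_tlift => a b; rewrite linearZ.
Qed.

End PullbackCoalgebra.

(** All that the induction retains of a factor: N_l H as a Hopf algebra and its projection to H are
    gone from here on. *)
Record smash_factor (k : fieldType) (U H : hopfAlgType k) (N : algType k)
    (vH : {linear H -> U}) (vN : {linear N -> U}) (B : ydHopf H N)
    (p : nat -> {linear N -> N}) (E : {linear U -> H}) : Prop := SmashFactor {
  sf_comul : forall n, comul (vN n) =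
    tlift (fun a b => tlift (fun g b0 => (vN a * vH g) *t vN b0) (yd_coact B b))
      (yd_comul B n);
  sf_mul : forall h n,
    vH h * vN n = tlift (fun h1 h2 => vN (yd_act B h1 n) * vH h2) (comul h);
  sf_counit : forall n, yd_counit B n = counit (vN n);
  sf_grading : yd_grading B p;
  sf_E1 : E 1 = 1;
  sf_El : forall n s m h, E (vH h * (vN n * vH s * antipode (vN m))) =
    h * E (vN n * vH s * antipode (vN m));
  sf_Er : forall n s m h, E (vN n * vH s * antipode (vN m) * vH h) =
    E (vN n * vH s * antipode (vN m)) * h;
  sf_Ecomul : forall n s m, p 0 n = n -> p 0 m = m ->
    tmap idfun E (comul (vN n * vH s * antipode (vN m))) =
    tmap vH idfun (comul (E (vN n * vH s * antipode (vN m))))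
}.

(* The invariant of the induction on the number of factors: a graded coalgebra
   [X] over [H], embedded in [U] by [m]. The form [sigma] generalizes [g (x) h |-> g S(h)]. *)
Record smash_module (k : fieldType) (U H : hopfAlgType k) (vH : {linear H -> U})
    (X : lmodType k) (m : {linear X -> U}) (D : {linear X -> tens X X})
    (act : {linear tens H X -> X}) (P : nat -> {linear X -> X})
    (sigma : {linear tens X X -> H}) : Prop := SmashModule {
  sm_comul : forall x, tmap m m (D x) = comul (m x);
  sm_act : forall h x, m (act (h *t x)) = vH h * m x;
  sm_orth : forall i j x, P i (P j x) = if i == j then P j x else 0;
  sm_proj_comul : forall i j x,
    tmap (P i) (P j) (D x) = tmap (P i) (P j) (D (P (i + j)%N x));
  sm_proj_act : forall i h x, P i (act (h *t x)) = act (h *t P i x);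
  sm_counit : forall i x, counit (m (P i x)) = if i == 0%N then counit (m x) else 0;
  sm_inj : forall n x, tmap (P 1) (P n) (D x) = 0 ->
    tmap (P n) (P 1) (D x) = 0 -> P n.+1 x = 0;
  sm_form_counit : forall x, sigma (D x) = (counit (m x) : k)%:A;
  sm_form_comul : forall x y, P 0 x = x -> P 0 y = y ->
    tlift (fun x1 x2 => tlift (fun y1 y2 =>
      (m x1 * antipode (m y2)) *t sigma (x2 *t y1)) (D y)) (D x) =
    tmap vH idfun (comul (sigma (x *t y)));
  sm_forml : forall h x y, sigma (act (h *t x) *t y) = h * sigma (x *t y);
  sm_formr : forall h x y, sigma (x *t act (h *t y)) = sigma (x *t y) * antipode h
}.

Section Base.
Variables (k : fieldType) (U H : hopfAlgType k) (vH : {linear H -> U}).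
Hypothesis vH_hopf : hopf_map vH.

Lemma smash_module_base : exists D act P sigma,
  smash_module vH vH D act P sigma /\ forall i h, P i h = if i == 0%N then h else 0.
Proof.
have actL : lin (tlift (fun g h : H => g * h)) by lin.
have sL : lin (tlift (fun g h : H => g * antipode h)) by lin.
have actE g h : mklin actL (g *t h) = g * h by rewrite mklinE tliftE //; lin.
have sE g h : mklin sL (g *t h) = g * antipode h by rewrite mklinE tliftE //; lin.
have PL (i : nat) : lin (fun h : H => if i == 0%N then h else 0) by case: eqP => _; lin.
pose P i := mklin (PL i); have PE i h : P i h = if i == 0%N then h else 0 by exact: mklinE.
clearbody P.
have tP0 (V W : lmodType k) (f : {linear V -> W}) i (z : tens H V) : (0 < i)%N -> tmap (P i) f z = 0.
  move=> i0; move: z; apply: tens_ext; [by lin|by lin|] => a b.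
  by rewrite tmapE PE gtn_eqF // ptens0l.
have t0P (V W : lmodType k) (f : {linear V -> W}) i (z : tens V H) : (0 < i)%N -> tmap f (P i) z = 0.
  move=> i0; move: z; apply: tens_ext; [by lin|by lin|] => a b.
  by rewrite tmapE PE gtn_eqF // ptens0r.
exists comul, (mklin actL), P, (mklin sL); split; last by [].
split.
- by move=> x; rewrite (hopf_map_comul vH_hopf).
- by move=> h x; rewrite actE (hopf_mapM vH_hopf).
- by case=> [|i] [|j] x; rewrite !PE //=; case: ifP.
- move=> i j x; have [->|i0] := posnP i; last by rewrite !tP0.
  have [->|j0] := posnP j; last by rewrite !t0P.
  by rewrite !PE.
- by move=> i h x; rewrite !actE !PE; case: eqP; rewrite ?actE ?mulr0.
- by move=> i x; rewrite PE; case: eqP; rewrite ?linear0.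
- by move=> n x _ _; rewrite PE.
- move=> x; rewrite mklinE antipoder (hopf_map_counit vH_hopf) //.
- move=> x y _ _; rewrite sE comulM comul_antipode tens_mul_tliftr linear_tlift.
  rewrite tlift_exchange; apply: eq_tlift => y1 y2.
  rewrite -[comul x]tlift_ptens tens_mul_tliftl linear_tlift tlift_ptens.
  apply: eq_tlift => x1 x2; rewrite tens_mulE /= tmapE.
  by rewrite (hopf_mapM vH_hopf) (hopf_map_antipode vH_hopf) sE.
- by move=> h x y; rewrite actE !sE mulrA.
- by move=> h x y; rewrite actE !sE antipodeM mulrA.
Qed.

End Base.

Section Step.
Variables (k : fieldType) (U H : hopfAlgType k) (N : algType k) (X : lmodType k).
Variables (vH : {linear H -> U}) (vN : {linear N -> U}) (B : ydHopf H N).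
Variables (p : nat -> {linear N -> N}) (E : {linear U -> H}).
Hypotheses (vH_hopf : hopf_map vH) (fN : smash_factor vH vN B p E).
Variables (m : {linear X -> U}) (D : {linear X -> tens X X}).
Variables (act : {linear tens H X -> X}) (P : nat -> {linear X -> X}).
Variable sigma : {linear tens X X -> H}.
Hypothesis mX : smash_module vH m D act P sigma.
Hypothesis m_inj : injective m.

Local Notation Y := (tens N X).

Definition step_map : {linear Y -> U} := tlift_mul vN m.

Lemma step_mapE n x : step_map (n *t x) = vN n * m x.
Proof. by rewrite /step_map /= tlift_mulE. Qed.

Lemma step_braid_lin : lin (tlift (fun (s : tens N N) (t : tens X X) =>
  tlift (fun a b => tlift (fun c d => tlift (fun g b0 =>
    (a *t act (g *t c)) *t (b0 *t d)) (yd_coact B b)) t) s)).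
Proof. by lin. Qed.

(** The two comultiplications are applied first and the braiding after them. As the braiding
    respects degrees, a homogeneous component of [step_comul] factors through components of the two
    comultiplications. *)
Definition step_comul : {linear Y -> tens Y Y} :=
  mklin step_braid_lin \o tmap (yd_comul B) D.

Lemma step_comulE n x : step_comul (n *t x) =
  tlift (fun a b => tlift (fun c d => tlift (fun g b0 =>
    (a *t act (g *t c)) *t (b0 *t d)) (yd_coact B b)) (D x)) (yd_comul B n).
Proof. by rewrite /= tmapE mklinE tliftE //; lin. Qed.

Lemma step_act_lin : lin (tlift (fun h (t : Y) => tlift (fun n x =>
  tlift (fun h1 h2 => yd_act B h1 n *t act (h2 *t x)) (comul h)) t)).
Proof. by lin. Qed.

Definition step_act : {linear tens H Y -> Y} := mklin step_act_lin.

Lemma step_actE h n x : step_act (h *t (n *t x)) =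
  tlift (fun h1 h2 => yd_act B h1 n *t act (h2 *t x)) (comul h).
Proof. by rewrite mklinE tliftE ?tliftE //; lin. Qed.

Lemma step_proj_lin i : lin (fun t : Y => \sum_(a < i.+1) tmap (p a) (P (i - a)%N) t).
Proof. by lin. Qed.

Definition step_proj i : {linear Y -> Y} := mklin (step_proj_lin i).

Lemma step_projE i n x : step_proj i (n *t x) = \sum_(a < i.+1) p a n *t P (i - a)%N x.
Proof. by rewrite mklinE; apply: eq_bigr => a _; rewrite tmapE. Qed.

Lemma step_form_lin : lin (tlift (fun t t' : Y => tlift (fun n x => tlift (fun n' x' =>
  E (vN n * vH (sigma (x *t x')) * antipode (vN n'))) t') t)).
Proof. by lin. Qed.

Definition step_form : {linear tens Y Y -> H} := mklin step_form_lin.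

Lemma step_formE n x n' x' : step_form ((n *t x) *t (n' *t x')) =
  E (vN n * vH (sigma (x *t x')) * antipode (vN n')).
Proof. by rewrite mklinE !tliftE //; lin. Qed.

Let gN := sf_grading fN.

Lemma step_map_comul t : tmap step_map step_map (step_comul t) = comul (step_map t).
Proof.
move: t; apply: tens_ext; [by lin|by lin|] => n x.
rewrite step_comulE step_mapE comulM (sf_comul fN) -(sm_comul mX).
rewrite [LHS](linear_tlift (tmap step_map step_map)) tens_mul_tliftl.
apply: eq_tlift => a b; rewrite tens_mul_tliftl.
rewrite [LHS](linear_tlift (tmap step_map step_map)).
transitivity (tlift (fun g b0 => tlift (fun c d =>
    (vN a * vH g * m c) *t (vN b0 * m d)) (D x)) (yd_coact B b)); last first.
  by apply: eq_tlift => g b0; rewrite tens_mul_tmap.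
rewrite tlift_exchange; apply: eq_tlift => c d.
rewrite (linear_tlift (tmap step_map step_map)); apply: eq_tlift => g b0.
by rewrite /= tmapE !step_mapE (sm_act mX) mulrA.
Qed.

Lemma step_map_act h t : step_map (step_act (h *t t)) = vH h * step_map t.
Proof.
move: t; apply: tens_ext; [by lin|by lin|] => n x.
rewrite step_actE step_mapE mulrA (sf_mul fN) tliftMl linear_tlift.
by apply: eq_tlift => h1 h2; rewrite step_mapE (sm_act mX) mulrA.
Qed.

Lemma step_proj_mixed i a b n x :
  step_proj i (p a n *t P b x) = if (a + b)%N == i then p a n *t P b x else 0.
Proof.
rewrite step_projE; case: eqP => [abi|abi].
  have ai : (a < i.+1)%N by rewrite -abi ltnS leq_addr.
  rewrite (bigD1 (Ordinal ai)) //= big1 ?addr0 => [|c ca].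
    by rewrite (ydg_orth gN) (sm_orth mX) -abi addKn !eqxx.
  by rewrite (ydg_orth gN) ifN ?ptens0l.
rewrite big1 // => c _; rewrite (ydg_orth gN) (sm_orth mX).
case: eqP => [ca|]; last by rewrite ptens0l.
case: eqP => [cb|]; last by rewrite ptens0r.
by case: abi; rewrite -cb -ca subnKC // -ltnS.
Qed.

Lemma step_orth i j t : step_proj i (step_proj j t) = if i == j then step_proj j t else 0.
Proof.
move: t; apply: tens_ext; [by lin|by case: (i == j); lin|] => n x.
rewrite step_projE linear_sum.
transitivity (\sum_(a < j.+1) if i == j then p a n *t P (j - a)%N x else 0).
  apply: eq_bigr => a _; rewrite step_proj_mixed subnKC; last by rewrite -ltnS.
  by rewrite eq_sym.
by case: (i == j); last by rewrite big1.
Qed.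

(** The maps on [X] are left general because they are instantiated both by the projections to a
    total degree and by those to a multidegree. *)
Lemma step_comul_mixed a b (f g h : {linear X -> X}) t :
  (forall l x, f (act (l *t x)) = act (l *t f x)) ->
  (forall x, tmap f g (D x) = tmap f g (D (h x))) ->
  tmap (tmap (p a) f) (tmap (p b) g) (step_comul t) =
  tmap (tmap (p a) f) (tmap (p b) g) (step_comul (tmap (p (a + b)%N) h t)).
Proof.
move=> f_act fgh.
have KE n x : tmap (tmap (p a) f) (tmap (p b) g) (step_comul (n *t x)) =
    mklin step_braid_lin (tmap (p a) (p b) (yd_comul B n) *t tmap f g (D x)).
  rewrite step_comulE mklinE tliftE; last by lin.
  rewrite tlift_tmap; last by lin.
  rewrite (linear_tlift (tmap (tmap (p a) f) (tmap (p b) g))).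
  apply: eq_tlift => u v; rewrite tlift_tmap; last by lin.
  rewrite (linear_tlift (tmap (tmap (p a) f) (tmap (p b) g))).
  apply: eq_tlift => y z; rewrite (ydg_coact gN) tlift_tmap; last by lin.
  rewrite (linear_tlift (tmap (tmap (p a) f) (tmap (p b) g))).
  by apply: eq_tlift => l v0; rewrite /= tmapE /= !tmapE f_act.
move: t; apply: tens_ext; [by lin|by lin|] => n x.
by rewrite tmapE !KE (ydg_comul gN) fgh.
Qed.

Lemma step_act_mixed a (f : {linear X -> X}) l t :
  (forall l x, f (act (l *t x)) = act (l *t f x)) ->
  tmap (p a) f (step_act (l *t t)) = step_act (l *t tmap (p a) f t).
Proof.
move=> f_act; move: t; apply: tens_ext; [by lin|by lin|] => n x.
rewrite step_actE (linear_tlift (tmap (p a) f)) tmapE step_actE.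
by apply: eq_tlift => l1 l2; rewrite /= tmapE (ydg_act gN) f_act.
Qed.

Lemma step_proj_comul i j t : tmap (step_proj i) (step_proj j) (step_comul t) =
  tmap (step_proj i) (step_proj j) (step_comul (step_proj (i + j)%N t)).
Proof.
have PE z : tmap (step_proj i) (step_proj j) z =
    \sum_(a < i.+1) \sum_(b < j.+1)
      tmap (tmap (p a) (P (i - a)%N)) (tmap (p b) (P (j - b)%N)) z.
  move: z; apply: tens_ext; [by lin|by lin|] => u v.
  rewrite tmapE ![step_proj _ _]mklinE.
  have uL (w : Y) : lin (fun u : Y => u *t w) by lin.
  have vL (w : Y) : lin (fun v : Y => w *t v) by lin.
  rewrite -[LHS](mklinE (uL _)) linear_sum; apply: eq_bigr => a _.
  rewrite mklinE -[LHS](mklinE (vL _)) linear_sum; apply: eq_bigr => b _.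
  by rewrite mklinE tmapE.
rewrite !PE; apply: eq_bigr => a _; apply: eq_bigr => b _.
have [ai bj] : (a <= i)%N /\ (b <= j)%N by split; rewrite -ltnS.
have mixed z := step_comul_mixed a b z (sm_proj_act mX (i - a)%N)
  (sm_proj_comul mX (i - a)%N (j - b)%N).
rewrite [LHS]mixed [RHS]mixed; congr (tmap _ _ (step_comul _)).
have ->  : (i - a + (j - b) = i + j - (a + b))%N by lia.
move: t; apply: tens_ext; [by lin|by lin|] => n x.
rewrite tmapE step_projE linear_sum.
have abij : (a + b < (i + j).+1)%N by lia.
rewrite (bigD1 (Ordinal abij)) //= big1 ?addr0 => [|c cab]; rewrite tmapE (ydg_orth gN) (sm_orth mX).
  by rewrite !eqxx.
by rewrite ifN ?ptens0l // eq_sym.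
Qed.

Lemma step_proj_act i h t : step_proj i (step_act (h *t t)) = step_act (h *t step_proj i t).
Proof.
move: t; apply: tens_ext; [by lin|by lin|] => n x.
rewrite step_actE linear_tlift step_projE.
have hL : lin (fun t : Y => step_act (h *t t)) by lin.
rewrite -[RHS](mklinE hL) linear_sum /=.
transitivity (\sum_(a < i.+1) tlift (fun h1 h2 =>
    p a (yd_act B h1 n) *t P (i - a)%N (act (h2 *t x))) (comul h)).
  by rewrite /tlift exchange_big /=; apply: eq_bigr => q _; rewrite step_projE.
apply: eq_bigr => a _; rewrite mklinE step_actE; apply: eq_tlift => h1 h2.
by rewrite (ydg_act gN) (sm_proj_act mX).
Qed.

Lemma step_counit i t :
  counit (step_map (step_proj i t)) = if i == 0%N then counit (step_map t) else 0.
Proof.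
move: t; apply: tens_ext; [by lin|by case: (i == 0%N); lin|] => n x.
rewrite step_projE (linear_sum step_map) (linear_sum counit) step_mapE counitM -(sf_counit fN).
transitivity (\sum_(a < i.+1) (yd_counit B (p a n) : k) * (counit (m (P (i - a)%N x)) : k)).
  by apply: eq_bigr => a _; rewrite step_mapE counitM (sf_counit fN).
rewrite big_ord_recl /= big1 => [|a _].
  rewrite (ydg_counit gN) eqxx (sm_counit mX) subn0 addr0.
  by case: (i == 0%N); rewrite // mulr0.
by rewrite (ydg_counit gN) /= mul0r.
Qed.

Lemma step_projK a b t :
  tmap (p a) (P b) (step_proj (a + b)%N t) = tmap (p a) (P b) t.
Proof.
move: t; apply: tens_ext; [by lin|by lin|] => n x.
rewrite step_projE linear_sum.
have aab : (a < (a + b).+1)%N by rewrite ltnS leq_addr.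
rewrite (bigD1 (Ordinal aab)) //= big1 ?addr0 => [|c ca]; rewrite tmapE (ydg_orth gN) (sm_orth mX).
  by rewrite addKn !eqxx tmapE.
by rewrite ifN ?ptens0l // eq_sym.
Qed.

Lemma act1 x : act (1 *t x) = x.
Proof. by apply: m_inj; rewrite (sm_act mX) (hopf_map1 vH_hopf) mul1r. Qed.

Let DA := pullback_comulA m_inj (sm_comul mX).
Let De := pullback_counitl m_inj (sm_comul mX).
Let eD := pullback_counitr m_inj (sm_comul mX).

(** Consider the part of degree (a, b) in N (x) X with a + b = n + 1. If a > 0, a degree one piece
    is split off the N part to the left, the counit discarding the X part of the first leg. If a =
    0, a degree one piece is split off the X part to the right, the counit discarding the N part of
    the second leg. Splitting it off to the left would leave the coaction of the N part acting on
    it, so both extreme components are used. *)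
Lemma step_inj n t :
  tmap (step_proj 1) (step_proj n) (step_comul t) = 0 ->
  tmap (step_proj n) (step_proj 1) (step_comul t) = 0 -> step_proj n.+1 t = 0.
Proof.
move=> tL tR; rewrite mklinE big1 // => -[[|a] /= an] _.
  rewrite subn0.
  have X_inj := graded_injective DA De eD (sm_proj_comul mX) _ (sm_inj mX) n.
  have [|g gE] := linear_factor (f := tmap (P n) (P 1) \o D) (g := P n.+1).
    move=> x; apply: (X_inj _ x).2 => y.
    by rewrite /= (sm_counit mX).
  have rL : lin (tlift (fun n x => (yd_counit B n : k) *: x : X)) by lin.
  have GL : lin (tlift (fun (u : Y) v => tlift (fun u1 u2 => u1 *t g (u2 *t v)) u)) by lin.
  pose r := mklin rL; have rE n' x : r (n' *t x) = (yd_counit B n' : k) *: x.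
    by rewrite mklinE tliftE //; lin.
  (* After the counit of N, a total degree of 1 can only come from X. The map [q] below plays the
     same part with N and X exchanged. *)
  have rQ u : P 1 (r (step_proj 1 u)) = P 1 (r u).
    move: u; apply: tens_ext; [by lin|by lin|] => n' x.
    rewrite step_projE !big_ord_recl big_ord0 addr0 !linearD /= !rE !(ydg_counit gN) /=.
    by rewrite scale0r linear0 addr0 !linearZ /= (sm_orth mX) eqxx.
  transitivity (mklin GL (tmap (tmap (p 0) (P n)) (P 1 \o r) (step_comul t))).
    move: (t); apply: tens_ext; [by lin|by lin|] => n' x.
    rewrite tmapE -gE step_comulE.
    rewrite [in RHS](linear_tlift (tmap (tmap (p 0) (P n)) (P 1 \o r))) [RHS]linear_tlift.
    rewrite -[LHS](@yd_sw_counitr _ _ _ B _ (fun n' => p 0 n' *t g (tmap (P n) (P 1) (D x)))); last by lin.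
    apply: eq_tlift => a b.
    rewrite [in RHS](linear_tlift (tmap (tmap (p 0) (P n)) (P 1 \o r))) [RHS]linear_tlift.
    rewrite [tmap (P n) _ _]/tmap linear_tlift tlift_ptr tliftZ.
    apply: eq_tlift => c d.
    rewrite [in RHS](linear_tlift (tmap (tmap (p 0) (P n)) (P 1 \o r))) [RHS]linear_tlift.
    have HL : lin (fun h => p 0 a *t g (P n (act (h *t c)) *t P 1 d)) by lin.
    transitivity (mklin HL (tlift (fun g y => (yd_counit B y : k) *: g) (yd_coact B b))).
      by rewrite yd_coact_eps linearZ /= mklinE act1.
    rewrite linear_tlift; apply: eq_tlift => h b0.
    rewrite linearZ /= !mklinE /= tmapE /= tmapE rE tliftE; last by lin.
    by rewrite tliftE ?linearZ ?ptensZr //= ?linearZ ?ptensZr //; lin.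
  suff -> : tmap (tmap (p 0) (P n)) (P 1 \o r) (step_comul t) = 0 by rewrite linear0.
  transitivity (tmap (tmap (p 0) (P n)) (P 1 \o r) (tmap (step_proj n) (step_proj 1) (step_comul t))).
    move: (step_comul t); apply: tens_ext; [by lin|by lin|] => u v.
    by rewrite !tmapE /= rQ (step_projK 0 n).
  by rewrite tR linear0.
have {}an : (a <= n)%N by move: an; rewrite !ltnS.
rewrite subSS; set b := (n - a)%N.
have [g gE] := ydg_inj gN a.
have qL : lin (tlift (fun n' x => (counit (m x) : k) *: n' : N)) by lin.
have GL : lin (tlift (fun u (v : Y) => tlift (fun v1 v2 => g (u *t v1) *t v2) v)) by lin.
pose q := mklin qL; have qE n' x : q (n' *t x) = (counit (m x) : k) *: n'.
  by rewrite mklinE tliftE //; lin.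
have qQ u : p 1 (q (step_proj 1 u)) = p 1 (q u).
  move: u; apply: tens_ext; [by lin|by lin|] => n' x.
  rewrite step_projE !big_ord_recl big_ord0 addr0 !linearD /= !qE !(sm_counit mX) /=.
  by rewrite scale0r linear0 add0r !linearZ /= (ydg_orth gN) eqxx.
transitivity (mklin GL (tmap (p 1 \o q) (tmap (p a) (P b)) (step_comul t))).
  move: (t); apply: tens_ext; [by lin|by lin|] => n' x.
  rewrite tmapE -gE step_comulE.
  rewrite [in RHS](linear_tlift (tmap (p 1 \o q) (tmap (p a) (P b)))) [RHS]linear_tlift.
  rewrite [tmap (p 1) _ _]/tmap linear_tlift tlift_ptl.
  apply: eq_tlift => u v.
  rewrite [in RHS](linear_tlift (tmap (p 1 \o q) (tmap (p a) (P b)))) [RHS]linear_tlift.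
  have xL : lin (fun x => g (p 1 u *t p a v) *t P b x) by lin.
  rewrite -[LHS](mklinE xL) -[x in LHS]De linear_tlift.
  apply: eq_tlift => c d.
  rewrite [in RHS](linear_tlift (tmap (p 1 \o q) (tmap (p a) (P b)))) [RHS]linear_tlift.
  rewrite linearZ /= mklinE.
  rewrite -[g _ *t _](@yd_coact_counitE _ _ _ B _ (fun v => g (p 1 u *t p a v) *t P b d)); last by lin.
  rewrite tliftZ; apply: eq_tlift => h v0.
  rewrite mklinE /= tmapE /= tmapE qE (sm_act mX) counitM (hopf_map_counit vH_hopf) tliftE; last by lin.
  rewrite tliftE; last by lin.
  have uL : lin (fun u => g (p 1 u *t p a v0) *t P b d) by lin.
  by rewrite -[RHS](mklinE uL) [RHS]linearZ /= mklinE scalerA mulrC.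
suff -> : tmap (p 1 \o q) (tmap (p a) (P b)) (step_comul t) = 0 by rewrite linear0.
transitivity (tmap (p 1 \o q) (tmap (p a) (P b)) (tmap (step_proj 1) (step_proj n) (step_comul t))).
  move: (step_comul t); apply: tens_ext; [by lin|by lin|] => u v.
  by rewrite !tmapE /= qQ -(subnKC an) step_projK.
by rewrite tL linear0.
Qed.

(** The inner form contracts to eps(x), which leaves E(n_1 S(n_2)) = eps(n) 1. *)
Lemma step_form_counit t : step_form (step_comul t) = (counit (step_map t) : k)%:A.
Proof.
move: t; apply: tens_ext; [by lin|by lin|] => n x.
rewrite step_comulE step_mapE linear_tlift.
have EL : lin (tlift (fun u v : U => E (u * antipode v))) by lin.
transitivity ((counit (m x) : k) *: mklin EL (comul (vN n))).
  rewrite (sf_comul fN) linear_tlift tliftZ; apply: eq_tlift => a b.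
  rewrite linear_tlift linear_tlift tliftZ.
  transitivity (tlift (fun c d => tlift (fun g b0 =>
      E (vN a * vH (g * sigma (c *t d)) * antipode (vN b0))) (yd_coact B b)) (D x)).
    apply: eq_tlift => c d; rewrite linear_tlift; apply: eq_tlift => g b0.
    by rewrite step_formE (sm_forml mX).
  rewrite tlift_exchange; apply: eq_tlift => g b0.
  have FL : lin (fun h => E (vN a * vH (g * h) * antipode (vN b0))) by lin.
  transitivity (mklin FL (sigma (D x))).
    rewrite -[D x in RHS]tlift_ptens !linear_tlift.
    by apply: eq_tlift => c d; rewrite mklinE.
  rewrite (sm_form_counit mX) linearZ /= mklinE mulr1; congr (_ *: _).
  by rewrite mklinE tliftE //; lin.
have -> : mklin EL (comul (vN n)) = E (tlift (fun u v => u * antipode v) (comul (vN n))).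
  by rewrite mklinE linear_tlift.
by rewrite antipoder linearZ /= (sf_E1 fN) scalerA counitM mulrC.
Qed.

Lemma step_forml h t t' : step_form (step_act (h *t t) *t t') = h * step_form (t *t t').
Proof.
move: t; apply: tens_ext; [by lin|by lin|] => n x.
move: t'; apply: tens_ext; [by lin|by lin|] => n' x'.
rewrite step_formE -(sf_El fN) step_actE tlift_ptl linear_tlift.
rewrite !mulrA (sf_mul fN) !tliftMl linear_tlift.
apply: eq_tlift => h1 h2.
by rewrite step_formE (sm_forml mX) (hopf_mapM vH_hopf) !mulrA.
Qed.

Lemma step_formr h t t' :
  step_form (t *t step_act (h *t t')) = step_form (t *t t') * antipode h.
Proof.
move: t; apply: tens_ext; [by lin|by lin|] => n x.
move: t'; apply: tens_ext; [by lin|by lin|] => n' x'.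
rewrite step_formE -(sf_Er fN) step_actE tlift_ptr linear_tlift.
rewrite -(hopf_map_antipode vH_hopf) -mulrA -antipodeM (sf_mul fN).
rewrite (linear_tlift antipode) tliftMr linear_tlift.
apply: eq_tlift => h1 h2.
by rewrite step_formE (sm_formr mX) (hopf_mapM vH_hopf) antipodeM (hopf_map_antipode vH_hopf) !mulrA.
Qed.

(** Both sides expand (id (x) E) Delta(n s S(n')) with s = sigma(c, c'). The smash coproduct gives
    Delta(n) and Delta(n'), and the same identity for [X] gives Delta(s). *)
Lemma step_form_comul t t' : step_proj 0 t = t -> step_proj 0 t' = t' ->
  tlift (fun x1 x2 => tlift (fun y1 y2 =>
    (step_map x1 * antipode (step_map y2)) *t step_form (x2 *t y1)) (step_comul t'))
    (step_comul t) =
  tmap vH idfun (comul (step_form (t *t t'))).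
Proof.
move=> <- <-; move: t; apply: tens_ext; [by lin|by lin|] => n c.
move: t'; apply: tens_ext; [by lin|by lin|] => n' c'.
have P0E u v : step_proj 0 (u *t v) = p 0 u *t P 0 v.
  by rewrite step_projE big_ord_recl big_ord0 addr0.
rewrite !P0E.
have [n0 n'0] : p 0 (p 0 n) = p 0 n /\ p 0 (p 0 n') = p 0 n'.
  by rewrite !(ydg_orth gN).
have [c0 c'0] : P 0 (P 0 c) = P 0 c /\ P 0 (P 0 c') = P 0 c'.
  by rewrite !(sm_orth mX).
move: (p 0 n) (p 0 n') (P 0 c) (P 0 c') n0 n'0 c0 c'0 => {}n {}n' {}c {}c' n0 n'0 c0 c'0.
rewrite step_formE -(sf_Ecomul fN) //.
set s := sigma (c *t c').
(* Here u (x) w stands for Delta(n) and u' (x) w' for Delta(n'); the antipode exchanges the legs of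
   the latter. *)
pose G u w u' w' := tlift (fun s1 s2 =>
  (u * vH s1 * antipode w') *t E (w * vH s2 * antipode u')) (comul s).
have GL1 w u' w' : lin (fun u => G u w u' w') by rewrite /G; lin.
have GL2 u u' w' : lin (fun w => G u w u' w') by rewrite /G; lin.
have GL3 u w w' : lin (fun u' => G u w u' w') by rewrite /G; lin.
have GL4 u w u' : lin (fun w' => G u w u' w') by rewrite /G; lin.
transitivity (tlift (fun u w => tlift (fun u' w' => G u w u' w') (comul (vN n'))) (comul (vN n))).
  pose T a g b0 a' g' b0' c1 c2 c1' c2' :=
    (vN a * vH g * (m c1 * antipode (m c2')) * antipode (vN b0')) *t
    E (vN b0 * vH (sigma (c2 *t c1') * antipode g') * antipode (vN a')).
  transitivity (tlift (fun a b => tlift (fun c1 c2 => tlift (fun g b0 =>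
      tlift (fun a' b' => tlift (fun c1' c2' => tlift (fun g' b0' =>
        T a g b0 a' g' b0' c1 c2 c1' c2') (yd_coact B b')) (D c')) (yd_comul B n'))
      (yd_coact B b)) (D c)) (yd_comul B n)).
    set f := (fun x1 x2 : Y => _).
    have fL : lin (tlift f) by rewrite /f; lin.
    rewrite -[LHS](mklinE fL) step_comulE linear_tlift; apply: eq_tlift => a b.
    rewrite linear_tlift; apply: eq_tlift => c1 c2.
    rewrite linear_tlift; apply: eq_tlift => g b0.
    rewrite mklinE tliftE; last by rewrite /f; lin.
    rewrite /f; set f' := (fun y1 y2 : Y => _).
    have f'L : lin (tlift f') by rewrite /f'; lin.
    rewrite -[LHS](mklinE f'L) step_comulE linear_tlift; apply: eq_tlift => a' b'.
    rewrite linear_tlift; apply: eq_tlift => c1' c2'.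
    rewrite linear_tlift; apply: eq_tlift => g' b0'.
    rewrite mklinE tliftE; last by rewrite /f'; lin.
    rewrite /f' !step_mapE step_formE (sm_act mX) (sm_formr mX) antipodeM.
    by rewrite /T !mulrA.
  have GL : lin (tlift (fun u w => tlift (fun u' w' => G u w u' w') (comul (vN n')))).
    by lin.
  rewrite (sf_comul fN n) -[RHS](mklinE GL) linear_tlift; apply: eq_tlift => a b.
  rewrite tlift_exchange linear_tlift; apply: eq_tlift => g b0.
  rewrite mklinE tliftE; last by lin.
  have GL' : lin (tlift (fun u' w' => G (vN a * vH g) (vN b0) u' w')).
    by lin.
  rewrite (sf_comul fN n') -[RHS](mklinE GL') linear_tlift tlift_exchange.
  apply: eq_tlift => a' b'; rewrite linear_tlift.
  transitivity (tlift (fun g' b0' => tlift (fun c1 c2 => tlift (fun c1' c2' =>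
      T a g b0 a' g' b0' c1 c2 c1' c2') (D c')) (D c)) (yd_coact B b')).
    rewrite [RHS]tlift_exchange; apply: eq_tlift => c1 c2.
    exact: tlift_exchange.
  apply: eq_tlift => g' b0'; rewrite mklinE tliftE; last by lin.
  have PhiL : lin (tlift (fun u h => (vN a * vH g * u * antipode (vN b0')) *t
    E (vN b0 * vH (h * antipode g') * antipode (vN a')))) by lin.
  (* The identity for [X], with the outer elements wrapped around it, turns the sums over c and c'
     into Delta(s). *)
  have := congr1 (mklin PhiL) (sm_form_comul mX c0 c'0).
  rewrite [X in _ = X -> _]mklinE tlift_tmap; last by lin.
  rewrite -/s => e; transitivity (mklin PhiL (tlift (fun x1 x2 => tlift (fun y1 y2 =>
    (m x1 * antipode (m y2)) *t sigma (x2 *t y1)) (D c')) (D c))).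
    rewrite linear_tlift; apply: eq_tlift => c1 c2.
    rewrite linear_tlift; apply: eq_tlift => c1' c2'.
    by rewrite mklinE tliftE //; lin.
  rewrite e /G; apply: eq_tlift => s1 s2.
  by rewrite antipodeM (hopf_map_antipode vH_hopf) (hopf_mapM vH_hopf) !mulrA.
rewrite !comulM (hopf_map_comul vH_hopf) comul_antipode.
move: (comul (vN n)) (comul (vN n')) => Z Z'.
move: Z; apply: tens_ext; [by lin|by lin|] => u w.
move: Z'; apply: tens_ext; [by lin|by lin|] => u' w'.
rewrite tliftE; last by lin.
rewrite tliftE; last by lin.
rewrite tliftE; last by lin.
rewrite tens_mul_tmap tens_mul_tliftl (linear_tlift (tmap idfun E)).
by apply: eq_tlift => s1 s2; rewrite tens_mulE /= tmapE.
Qed.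

Lemma smash_module_step :
  smash_module vH step_map step_comul step_act step_proj step_form.
Proof.
split.
- exact: step_map_comul.
- exact: step_map_act.
- exact: step_orth.
- exact: step_proj_comul.
- exact: step_proj_act.
- exact: step_counit.
- exact: step_inj.
- exact: step_form_counit.
- exact: step_form_comul.
- exact: step_forml.
- exact: step_formr.
Qed.

End Step.

(** * Adjoining all the factors *)

Section IteratedProduct.
Variables (k : fieldType) (U H : hopfAlgType k) (vH : {linear H -> U}).
Hypotheses (vH_hopf : hopf_map vH) (vH_inj : injective vH).
Variables (I : finType) (N : I -> algType k) (vN : forall l, {linear N l -> U}).
Variable B : forall l, ydHopf H (N l).
Variable p : forall l, nat -> {linear N l -> N l}.
Hypothesis vN_inj : forall l, injective (vN l).
Hypothesis vN1 : forall l, vN l 1 = 1.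

(** A counterpart of [tens_seq] with the whole algebras as factors: all multidegrees then live in
    one space, where they are cut out by [prod_proj]. Lists of indices allow the factors to be
    adjoined by induction. *)
Fixpoint prod_tens (s : seq I) : lmodType k :=
  if s is l :: s' then tens (N l) (prod_tens s') else H.

Fixpoint prod_map (s : seq I) : {linear prod_tens s -> U} :=
  if s is l :: s' then tlift_mul (vN l) (prod_map s') else vH.

Fixpoint prod_proj (s : seq I) (i : I -> nat) : {linear prod_tens s -> prod_tens s} :=
  if s is l :: s' then tmap (p l (i l)) (prod_proj s' i) else idfun.

Lemma prod_map_tail l s : injective (prod_map (l :: s)) -> injective (prod_map s).
Proof.
move=> inj x y xy.
have : (1 : N l) *t x = 1 *t y.
  by apply: inj; rewrite /= !tlift_mulE xy.
have L : lin (tlift (fun n x => (yd_counit (B l) n : k) *: x : prod_tens s)) by lin.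
by move/(congr1 (mklin L)); rewrite !mklinE !tliftE ?yd_counit_one ?scale1r //; lin.
Qed.

Lemma prod_map_base s : exists j : {linear H -> prod_tens s},
  forall h, prod_map s (j h) = vH h.
Proof.
elim: s => [|l s [j jE]]; first by exists idfun.
have L : lin (fun h => (1 : N l) *t j h) by lin.
by exists (mklin L) => h; rewrite mklinE /= tlift_mulE jE vN1 mul1r.
Qed.

(** The factors before l are stripped off by [prod_map_tail]; units in those after l embed N_l (x) H
    in what remains. *)
Lemma prod_map_factor l s : l \in s -> injective (prod_map s) ->
  injective (tlift_mul (vN l) vH).
Proof.
elim: s => // l' s IHs; rewrite inE => /orP[/eqP ->|/IHs ls] inj; last first.
  exact: ls (prod_map_tail inj).
have [j jE] := prod_map_base s.
have j_inj : injective j.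
  by move=> x y xy; apply: vH_inj; rewrite -!jE xy.
have E t : tlift_mul (vN l') vH t = prod_map (l' :: s) (tmap idfun j t).
  move: t; apply: tens_ext; [by lin|by lin|] => n h.
  by rewrite tmapE /= !tlift_mulE jE.
by move=> x y; rewrite !E => /inj; apply: tmap_inj.
Qed.

Lemma eq_prod_proj s i j : {in s, i =1 j} -> prod_proj s i =1 prod_proj s j.
Proof.
elim: s => //= l s IHs ij; apply: eq_tmap => [x|]; first by rewrite ij ?mem_head.
by apply: IHs => l' ls; apply: ij; rewrite inE ls orbT.
Qed.

Hypothesis gp : forall l, yd_grading (B l) (p l).

Lemma prod_proj_orth s i j x :
  prod_proj s i (prod_proj s j x) = if all [pred l | i l == j l] s then prod_proj s j x else 0.
Proof.
elim: s x => //= l s IHs; apply: tens_ext; [by lin|by case: (_ && _); lin|] => n x.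
rewrite !tmapE (ydg_orth (gp l)) IHs.
by case: eqP => _ /=; [case: ifP => _ //; rewrite ptens0r|rewrite ptens0l].
Qed.

Lemma prod_proj_span s x : uniq s ->
  x \in sumsp [set S | exists i : {ffun I -> nat}, S = lrange (prod_proj s i)]%classic.
Proof.
elim: s x => [|l s IHs] x /=.
  move=> _; apply: (sumsp_mem (S := lrange idfun)); first by exists [ffun=> 0%N].
  by apply/asboolP; exists x.
case/andP=> ls us; move: x; apply: tens_mem => n x.
have [M ->] := ydg_sum (gp l) n.
have L (y : prod_tens s) : lin (fun n : N l => n *t y) by lin.
rewrite -[_ *t x](mklinE (L x)) linear_sum; apply: rpred_sum => a _; rewrite mklinE.
have R : lin (fun x => p l a n *t x : prod_tens (l :: s)) by lin.
rewrite -[_ *t x](mklinE R).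
pose S := sumsp [set S | exists i : {ffun I -> nat}, S = lrange (prod_proj (l :: s) i)]%classic.
suff /(_ x (IHs x us)) : {subset sumsp [set S | exists i : {ffun I -> nat},
    S = lrange (prod_proj s i)]%classic <= lpreim (mklin R) S} by [].
apply: sumsp_sub => _ [i ->] _ /asboolP[y ->].
change (mklin R (prod_proj s i y) \in sumsp
  [set S | exists i : {ffun I -> nat}, S = lrange (prod_proj (l :: s) i)]%classic).
(* Changing the multidegree at [l] does not affect the tail, because [l] does not occur in [s]. *)
pose i' := [ffun l' => if l' == l then nat_of_ord a else i l'].
rewrite mklinE; apply: (sumsp_mem (S := lrange (prod_proj (l :: s) i'))); first by exists i'.
apply/asboolP; exists (n *t y); rewrite /= tmapE ffunE eqxx; congr (_ *t _).
by apply: eq_prod_proj => l' l's; rewrite ffunE; case: eqP => // e; rewrite -e l's in ls.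
Qed.

(** The invariant [smash_module] remembers the total degree only; the added clauses carry the
    multidegree through the induction. *)
Lemma prod_smash_module (E : I -> {linear U -> H}) s :
  (forall l, smash_factor vH (vN l) (B l) (p l) (E l)) ->
  injective (prod_map s) -> exists D act P sigma,
  [/\ smash_module vH (prod_map s) D act P sigma,
      forall i h x, prod_proj s i (act (h *t x)) = act (h *t prod_proj s i x),
      forall i j x, tmap (prod_proj s i) (prod_proj s j) (D x) =
        tmap (prod_proj s i) (prod_proj s j) (D (prod_proj s (fun l => i l + j l)%N x)) &
      forall n i x, P n (prod_proj s i x) =
        if (\sum_(l <- s) i l == n)%N then prod_proj s i x else 0].
Proof.
move=> fN; elim: s => [|l s IHs] inj.
  have [D [act [P [sigma [sm PE]]]]] := smash_module_base vH_hopf.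
  exists D, act, P, sigma; split=> // n i x.
  by rewrite PE big_nil eq_sym.
have inj' := prod_map_tail inj.
have [D [act [P [sigma [sm M1 M2 M3]]]]] := IHs inj'.
exists (step_comul (B l) D act), (step_act (B l) act), (step_proj (p l) P), (step_form vH (vN l) (E l) sigma).
split.
- exact: (smash_module_step vH_hopf (fN l) sm inj').
- by move=> i h x; apply: (step_act_mixed (fN l)) => *; apply: M1.
- move=> i j x; apply: (step_comul_mixed (fN l)) => *; [exact: M1|exact: M2].
move=> n i x; move: x; apply: tens_ext; [by lin|by case: (_ == n); lin|] => y x.
rewrite /= tmapE big_cons step_projE.
transitivity (\sum_(a < n.+1) if (a == i l :> nat) && (\sum_(l <- s) i l == n - a)%N
    then p l (i l) y *t prod_proj s i x else 0).
  apply: eq_bigr => a _; rewrite (ydg_orth (gp l)) M3.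
  by case: eqP => _ /=; [case: ifP => _; rewrite ?ptens0r|rewrite ptens0l].
case: eqP => [iln|iln].
  have il : (i l < n.+1)%N by rewrite -iln ltnS leq_addr.
  have sE : (\sum_(l <- s) i l == n - i l)%N by rewrite -iln addKn.
  rewrite (bigD1 (Ordinal il)) //= [X in _ + X]big1 ?addr0 => [|a ai]; first by rewrite eqxx sE.
  by rewrite ifN // negb_and [(a : nat) == _](negPf ai).
rewrite big1 // => a _; case: eqP => //= ai; case: eqP => // sn.
by case: iln; rewrite sn -ai subnKC // -ltnS.
Qed.

End IteratedProduct.

Section ProjectionFamily.
Variables (k : fieldType) (V : lmodType k) (I : eqType) (P : I -> {linear V -> V}).
Hypothesis P_sum : forall x, exists2 s : seq I, uniq s &
  (forall i, i \notin s -> P i x = 0) /\ x = \sum_(i <- s) P i x.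

Lemma tens_family_mem (S : submodClosed (tens V V)) z :
  (forall i j, tmap (P i) (P j) z \in S) -> z \in S.
Proof.
suff [s zE] : exists s : seq I, forall t, uniq t -> {subset s <= t} ->
    z = \sum_(i <- t) \sum_(j <- t) tmap (P i) (P j) z.
  move=> zS; rewrite (zE (undup s)) ?undup_uniq // => [|i]; last by rewrite mem_undup.
  by apply: rpred_sum => i _; apply: rpred_sum.
move: z; apply: tens_ind => [a b||x y [s xE] [t yE]]; last 1 first.
- exists (s ++ t) => u uu st.
  rewrite {1}(xE u) // => [|i is_]; last by apply: st; rewrite mem_cat is_.
  rewrite {1}(yE u) // => [|i it]; last by apply: st; rewrite mem_cat it orbT.
  rewrite -big_split; apply: eq_bigr => i _; rewrite -big_split.
  by apply: eq_bigr => j _; rewrite linearD.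
- have [s us [s0 aE]] := P_sum a; have [t ut [t0 bE]] := P_sum b.
  exists (s ++ t) => u uu stu.
  have aE' : a = \sum_(i <- u) P i a.
    rewrite {1}aE; apply/esym/big_support => // i is_.
    by apply: stu; rewrite mem_cat is_.
  have bE' : b = \sum_(i <- u) P i b.
    rewrite {1}bE; apply/esym/big_support => // i it.
    by apply: stu; rewrite mem_cat it orbT.
  have lL (w : V) : lin (fun v : V => v *t w) by lin.
  have rL (w : V) : lin (fun v : V => w *t v) by lin.
  rewrite {1}aE' -[LHS](mklinE (lL b)) linear_sum; apply: eq_bigr => i _.
  rewrite mklinE {1}bE' -[LHS](mklinE (rL (P i a))) linear_sum.
  by apply: eq_bigr => j _; rewrite mklinE tmapE.
- by exists [::] => t _ _; rewrite big1 // => i _; rewrite big1 // => j _; rewrite linear0.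
Qed.

End ProjectionFamily.

(** * The product is coradically graded *)

Section ProductTheorem.
Variables (k : fieldType) (U H : hopfAlgType k) (vH : {linear H -> U}).
Hypotheses (vH_hopf : hopf_map vH).
Hypothesis H_cosemisimple : cosemisimple H.
Variables (I : finType) (N : I -> algType k) (vN : forall l, {linear N l -> U}).
Variable B : forall l, ydHopf H (N l).
Variable p : forall l, nat -> {linear N l -> N l}.
Variable E : I -> {linear U -> H}.
Hypothesis fN : forall l, smash_factor vH (vN l) (B l) (p l) (E l).
Variable s : seq I.
Hypothesis s_uniq : uniq s.
Hypothesis s_all : forall l, l \in s.

Local Notation X := (prod_tens H N s).
Local Notation mu := (prod_map vH vN s).
Local Notation pr i := (prod_proj H p s i).

Hypothesis mu_inj : injective mu.
Hypothesis mu_surj : forall u, exists x, u = mu x.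
Variable G : {ffun I -> nat} -> submodClosed U.
Hypothesis GE : forall i u, u \in G i <-> exists x, u = mu (pr i x).

Let gp (l : I) := sf_grading (fN l).

Lemma pr_orth (i j : {ffun I -> nat}) x : pr i (pr j x) = if i == j then pr j x else 0.
Proof.
rewrite (prod_proj_orth gp); congr (if _ then _ else _).
apply/allP/eqP => [ij|-> //]; last by move=> l _ /=.
by apply/ffunP => l; apply/eqP/ij.
Qed.

Lemma component_sum : direct_sum G.
Proof.
split=> [u|t v ut vG v0 i it].
  suff -> : u \in sumsp (range G) by [].
  have [x ->] := mu_surj u.
  suff /(_ x (prod_proj_span gp x s_uniq)) :
    {subset sumsp [set S | exists i : {ffun I -> nat}, S = lrange (pr i)]%classic <=
      lpreim mu (sumsp (range G))} by [].
  apply: sumsp_sub => _ [i ->] _ /asboolP[y ->].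
  change (mu (pr i y) \in sumsp (range G)).
  by apply: (sumsp_mem (S := G i)); [exists i|apply/GE; exists y].
have /choice[x xE] : forall j, exists x, v j = mu (pr j x) by move=> j; apply/GE.
have x0 : \sum_(j <- t) pr j (x j) = 0.
  apply: mu_inj; rewrite linear_sum linear0 -[RHS]v0.
  by apply: eq_bigr => j _; rewrite xE.
rewrite xE; have := congr1 (pr i) x0; rewrite linear0 linear_sum (bigD1_seq i) //=.
rewrite pr_orth eqxx big1 ?addr0 => [->|j ji]; first by rewrite linear0.
by rewrite pr_orth eq_sym (negPf ji).
Qed.

Lemma component_projections : exists Q : {ffun I -> nat} -> {linear U -> U},
  (forall i x, Q i (mu x) = mu (pr i x)) /\
  (forall x, exists2 t, uniq t & (forall i, i \notin t -> Q i x = 0) /\ x = \sum_(i <- t) Q i x).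
Proof.
have [Q [QG QE Qsum]] := direct_sum_projection component_sum.
exists Q; split=> // i x.
have L : lin (fun x => Q i (mu x) - mu (pr i x)) by lin.
apply/eqP; rewrite -subr_eq0 -[_ - _](mklinE L).
have [|a z t z0 t0|D DE] := @submod_pack _ _ (fun x => mklin L x = 0).
- by rewrite linear0.
- by rewrite linearP /= z0 t0 scaler0 addr0.
apply/eqP/DE; move: x (prod_proj_span gp x s_uniq); apply: sumsp_sub => _ [j ->] _ /asboolP[x ->].
apply/DE; rewrite mklinE (QE i j); last by apply/GE; exists x.
by rewrite pr_orth; case: eqP => _; rewrite ?subrr // linear0 subr0.
Qed.

Variable D : {linear X -> tens X X}.
Variable act : {linear tens H X -> X}.
Variable P : nat -> {linear X -> X}.
Variable sigma : {linear tens X X -> H}.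
Hypothesis sm : smash_module vH mu D act P sigma.
Hypothesis M2 : forall i j x, tmap (pr i) (pr j) (D x) =
  tmap (pr i) (pr j) (D (pr (fun l => i l + j l)%N x)).
Hypothesis M3 : forall n i x, P n (pr i x) =
  if (\sum_(l <- s) i l == n)%N then pr i x else 0.

Lemma component_comul i u : u \in G i ->
  comul u \in sumsp [set S | exists j j', (j + j')%R = i /\ S = tens_sub (G j) (G j')]%classic.
Proof.
move=> /GE[x ->]; have [Q [QE Qsum]] := component_projections.
apply: (tens_family_mem Qsum) => j j'.
have QP z : tmap (Q j) (Q j') (tmap mu mu z) = tmap mu mu (tmap (pr j) (pr j') z).
  by move: z; apply: tens_ext; [by lin|by lin|] => a b; rewrite !tmapE !QE.
rewrite -(sm_comul sm) QP M2.
rewrite (_ : pr (fun l => j l + j' l)%N _ = pr (j + j')%R (pr i x)); last first.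
  by apply: eq_prod_proj => l _; rewrite ffunE.
rewrite pr_orth; case: eqP => [ji|_]; last by rewrite !linear0 rpred0.
apply: (sumsp_mem (S := tens_sub (G j) (G j'))); first by exists j, j'.
rewrite (tmap_comp (h := mu \o pr j) (h' := mu \o pr j')) //.
by apply: tmap_in => y; apply/GE; exists y.
Qed.

Lemma degree_projections : exists Q : nat -> {linear U -> U},
  [/\ nat_graded Q, forall n x, Q n (mu x) = mu (P n x) &
      forall n i u, u \in G i -> Q n u = if (\sum_(l <- s) i l == n)%N then u else 0].
Proof.
have [r rK] := linear_retract mu_inj.
pose Q n : {linear U -> U} := mu \o (P n \o r).
have QE n x : Q n (mu x) = mu (P n x) by rewrite /= rK.
have QG n i u : u \in G i -> Q n u = if (\sum_(l <- s) i l == n)%N then u else 0.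
  by move=> /GE[x ->]; rewrite QE M3; case: eqP => _; rewrite ?linear0.
clearbody Q; exists Q; split=> //; split.
- move=> i j u; have [x ->] := mu_surj u; rewrite !QE (sm_orth sm).
  by case: eqP => _; rewrite ?linear0.
- move=> u; suff [M uE] : exists M, forall m, (M <= m)%N -> u = \sum_(n < m) Q n u.
    by exists M; apply: uE.
  have [|a x y [M xE] [M' yE]|S SE] := @submod_pack _ U (fun u =>
      exists M, forall m, (M <= m)%N -> u = \sum_(n < m) Q n u).
  + by exists 0%N => m _; rewrite big1 // => n _; rewrite linear0.
  + exists (maxn M M') => m; rewrite geq_max => /andP[/xE xm /yE ym].
    rewrite {1}xm {1}ym scaler_sumr -big_split; apply: eq_bigr => n _.
    by rewrite linearP.
  apply/SE; have: u \in sumsp (range G) by rewrite component_sum.1.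
  apply: sumsp_sub => _ [i _ <-] {}u ui; apply/SE.
  set d := \sum_(l <- s) i l; exists d.+1 => m dm.
  rewrite (bigD1 (Ordinal dm)) //= big1 => [|n nd].
    by rewrite (QG d i) // eqxx addr0.
  by rewrite (QG n i) // ifN // eq_sym.
- move=> i j u; have [x ->] := mu_surj u.
  have QP z : tmap (Q i) (Q j) (tmap mu mu z) = tmap mu mu (tmap (P i) (P j) z).
    by move: z; apply: tens_ext; [by lin|by lin|] => a b; rewrite !tmapE !QE.
  by rewrite QE -!(sm_comul sm) !QP -(sm_proj_comul sm).
Qed.

Lemma product_coradically_graded (deg : {ffun I -> nat} -> nat) :
  (forall i, deg i = \sum_(l <- s) i l)%N -> coradically_graded deg G.
Proof.
move=> degE; split; first by split; [exact: component_sum|exact: component_comul].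
have [Q [gQ QE QG]] := degree_projections.
have [||lam [lam1 lamP]] := @coradical_integral k H 1; [exact: comul1|exact: counit1|].
have lam_int h : tlift (fun a b => (lam b : k) *: a) (comul h) = (lam h : k) *: 1.
  have hC : h \in coradical H by rewrite H_cosemisimple.
  by have [] := lamP h hC.
have [r rK] := linear_retract mu_inj.
(* The scalar form: the integral of H is applied after [sigma], transported to U by the inverse of
   [mu]. *)
have tauL : lin (tlift (fun u v => lam (sigma (r u *t r v)))) by lin.
pose tau := mklin tauL.
have tauE x y : tau (mu x *t mu y) = lam (sigma (x *t y)).
  by rewrite mklinE tliftE ?rK //; lin.
have tau_tmap z : tau (tmap mu mu z) = lam (sigma z).
  move: z; apply: tens_ext; [by lin|by lin|] => x y.
  by rewrite tmapE tauE.
pose Z : submodClosed U := lrange (Q 0).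
have ZE u : u \in Z <-> Q 0 u = u.
  split=> [/asboolP[v ->]|<-]; first by rewrite (proj_orth gQ).
  by apply/asboolP; exists u.
have Zcoalg : subcoalgebra Z.
  move=> u /ZE u0; rewrite -(nat_graded_comul0 gQ u0).
  by apply: tmap_in => v; apply/ZE; rewrite (proj_orth gQ).
have tau_counit : {in Z, forall c, tau (comul c) = counit c}.
  move=> c _; have [x ->] := mu_surj c.
  by rewrite -(sm_comul sm) tau_tmap (sm_form_counit sm) linearZ /= lam1 [LHS]mulr1.
(* Apply the integral of H to the second leg of [sm_form_comul]: this gives tau(c_2, d_1) c_1 S(d_2)
   = tau(c, d) 1. *)
have tauS : {in Z & Z, forall c d, tlift (fun c1 c2 => tlift (fun d1 d2 =>
    (tau (c2 *t d1) : k) *: (c1 * antipode d2)) (comul d)) (comul c) = (tau (c *t d) : k) *: 1}.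
  move=> c d /ZE c0 /ZE d0; have [x cE] := mu_surj c; have [y dE] := mu_surj d.
  have [x0 y0] : P 0 x = x /\ P 0 y = y.
    by split; apply: mu_inj; rewrite -QE -?cE -?dE.
  have LL : lin (tlift (fun (u : U) (h : H) => (lam h : k) *: u)) by lin.
  have := congr1 (mklin LL) (sm_form_comul sm x0 y0).
  rewrite [X in _ = X -> _]mklinE tlift_tmap; last by lin.
  have -> : tlift (fun a b => (lam b : k) *: vH a) (comul (sigma (x *t y))) = (tau (c *t d) : k) *: 1.
    rewrite cE dE tauE -(hopf_map1 vH_hopf) -linearZ -lam_int (linear_tlift vH).
    by apply: eq_tlift => a b; rewrite linearZ.
  move=> <-; rewrite cE dE -!(sm_comul sm) tlift_tmap; last by lin.
  rewrite linear_tlift; apply: eq_tlift => x1 x2.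
  rewrite tlift_tmap; last by lin.
  rewrite linear_tlift; apply: eq_tlift => y1 y2.
  by rewrite mklinE tliftE ?tauE //; lin.
(* Insert S(d_2) d_3 on the left: tau(c_2, d_1) c_1 S(d_2) d_3 is tau(c, d_1) d_2 by the preceding
   identity. *)
have balanced : {in Z & Z, forall c d,
    tlift (fun a b => (tau (b *t d) : k) *: a) (comul c) =
    tlift (fun a b => (tau (c *t a) : k) *: b) (comul d)}.
  move=> c d cZ dZ.
  transitivity (tlift (fun c1 c2 => tlift (fun d1 d' => tlift (fun d2 d3 =>
      (tau (c2 *t d1) : k) *: (c1 * antipode d2 * d3)) (comul d')) (comul d)) (comul c)).
    apply: eq_tlift => c1 c2.
    rewrite -[LHS](@sw_counitr _ _ _ (fun d => (tau (c2 *t d) : k) *: c1)); last by lin.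
    apply: eq_tlift => d1 d'; rewrite -tliftZ.
    have -> : tlift (fun a b => c1 * antipode a * b) (comul d') = (counit d' : k) *: c1.
      rewrite -[RHS]mulr1 -scalerAl scalerAr -antipodel tliftMr.
      by apply: eq_tlift => a b; rewrite mulrA.
    by rewrite !scalerA mulrC.
  transitivity (tlift (fun d' d3 => tlift (fun c1 c2 => tlift (fun d1 d2 =>
      (tau (c2 *t d1) : k) *: (c1 * antipode d2)) (comul d')) (comul c) * d3) (comul d)).
    transitivity (tlift (fun c1 c2 => tlift (fun d' d3 => tlift (fun d1 d2 =>
        (tau (c2 *t d1) : k) *: (c1 * antipode d2 * d3)) (comul d')) (comul d)) (comul c)).
      apply: eq_tlift => c1 c2.
      by rewrite (@sw_assoc _ _ _ (fun d1 d2 d3 => (tau (c2 *t d1) : k) *: (c1 * antipode d2 * d3)));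
        [|by lin|by lin|by lin].
    rewrite tlift_exchange; apply: eq_tlift => d' d3.
    rewrite tliftMl; apply: eq_tlift => c1 c2; rewrite tliftMl; apply: eq_tlift => d1 d2.
    by rewrite scalerAl.
  apply: tlift_eq_in (Zcoalg d dZ) _; [by lin|by lin|] => d' d3 d'Z _ /=.
  by rewrite tauS // -scalerAl mul1r.
have Q0C u : Q 0 u \in coradical U.
  apply: (coseparable_coradical Zcoalg balanced tau_counit).
  by apply/ZE; rewrite (proj_orth gQ).
have DA := pullback_comulA mu_inj (sm_comul sm).
have De := pullback_counitl mu_inj (sm_comul sm).
have eD := pullback_counitr mu_inj (sm_comul sm).
have Qinj m : exists g : {linear tens U U -> U}, forall u,
    g (tmap (Q 1) (Q m) (comul u)) = Q m.+1 u.
  apply: (linear_factor (f := tmap (Q 1) (Q m) \o comul)) => u.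
  have [x ->] := mu_surj u; rewrite /= -(sm_comul sm) QE.
  have -> : tmap (Q 1) (Q m) (tmap mu mu (D x)) = tmap mu mu (tmap (P 1) (P m) (D x)).
    move: (D x); apply: tens_ext; [by lin|by lin|] => a b.
    by rewrite !tmapE !QE.
  rewrite -[0](linear0 (tmap mu mu)) => /(tmap_inj mu_inj mu_inj) x0.
  have [+ _] := graded_injective DA De eD (sm_proj_comul sm) (fun y => sm_counit sm 0 y) (sm_inj sm) m x.
  by move=> /(_ x0) ->; rewrite linear0.
move=> n u; have cfE := coradical_filtrationP gQ Q0C Qinj n u.
apply/idP/idP => [/cfE u0|uS]; last first.
  apply/cfE => m nm; have [|a x y x0 y0|S SE] := @submod_pack _ _ (fun u => Q m u = 0).
  - by rewrite linear0.
  - by rewrite linearP /= x0 y0 scaler0 addr0.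
  apply/SE; move: u uS {cfE}; apply: sumsp_sub => _ [i + ->] u ui; rewrite degE => di.
  by apply/SE; rewrite (QG m i) // ltn_eqF // (leq_ltn_trans di nm).
have [M uE] := proj_sum gQ u; rewrite uE; apply: rpred_sum => -[m mM] _ /=.
have [nm|mn] := ltnP n m; first by rewrite u0 // rpred0.
set T := sumsp _.
suff /(_ u) : {subset sumsp (range G) <= lpreim (Q m) T}.
  by rewrite component_sum.1; apply.
apply: sumsp_sub => _ [i _ <-] v vi; change (Q m v \in T).
rewrite (QG m i) //; case: eqP => im; last exact: rpred0.
by apply: (sumsp_mem (S := G i)) => //; exists i => //; rewrite degE im.
Qed.

End ProductTheorem.

(** * Reduction to the product of the factors *)

Lemma exists_smash_factor (k : fieldType) (U H A : hopfAlgType k) (N : algType k)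
    (vH : {linear H -> U}) (vA : {linear A -> U}) (vN : {linear N -> U})
    (pi : {linear A -> H}) (B : ydHopf H N) (F : nat -> submodClosed N) :
  hopf_map vH -> hopf_map vA -> hopf_map pi -> injective vA -> injective vN ->
  vN 1 = 1 -> (forall x y, vN (x * y) = vN x * vN y) ->
  (forall n, exists a, vN n = vA a) ->
  (forall h n, vN (yd_act B h n) = adjoint (vH h) (vN n)) ->
  (forall n a, vA a = vN n ->
    tmap idfun vN (yd_coact B n) = tmap pi vA (comul a)) ->
  (forall n a, vA a = vN n ->
    tmap vN vN (yd_comul B n) = tlift (fun a12 a3 => tlift (fun a1 a2 =>
      (vA a1 * vH (antipode (pi a2))) *t vA a3) a12) (comul3 a)) ->
  injective (tlift_mul vN vH) -> coradically_graded_ydHopf B F ->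
  exists p E, smash_factor vH vN B p E /\
    forall i x, x \in F i <-> exists y, x = p i y.
Proof.
move=> vH_hopf vA_hopf pi_hopf vA_inj vN_inj vN1 vNM NA act_def coact_def comul_def NH_inj F_graded.
have comulN := factor_comul vH_hopf vA_hopf pi_hopf vA_inj NA coact_def comul_def.
have mulHN := factor_mul vH_hopf act_def.
have [p [gp pF pFE corad]] := coradically_graded_yd_grading F_graded.
have p0C x : p 0 x \in coradical (yd_coalg B) by rewrite corad.
have [lam [lam1 lam_int lam_act lam_coact]] := yd_integral gp p0C.
have antipodeN := factor_antipode vH_hopf vA_hopf pi_hopf vA_inj vN_inj vN1 vNM NA coact_def comul_def.
have [E [E1 El Er Ecomul]] := smash_expectation vH_hopf vN1 vNM comulN mulHN antipodeN gp
  lam1 lam_int lam_act lam_coact NH_inj.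
exists p, E; split.
  split=> //.
  exact: factor_counit vH_hopf vA_hopf pi_hopf vA_inj vN_inj NA coact_def comul_def.
move=> i x; split=> [xF|[y ->]] //; exists x; by rewrite (pFE i i) // eqxx.
Qed.

Lemma sub_valP (k : pzRingType) (V : lmodType k) (S : submodClosed V) x :
  x \in S <-> exists y, x = sub_val S y.
Proof. by split=> [xS|[y ->]]; [exists (exist _ x xS)|apply: valP]. Qed.

Section MulSeq.
Variables (k : fieldType) (U H : hopfAlgType k) (vH : {linear H -> U}).
Variables (I : finType) (N : I -> algType k) (vN : forall l, {linear N l -> U}).
Variables (K : submodClosed U) (S : I -> submodClosed U).
Hypothesis KE : forall u, u \in K <-> exists h, u = vH h.

Lemma prod_map_inj s : injective vH -> (forall l, injective (vN l)) ->
  (forall l n, vN l n \in S l) -> injective (mul_seq [seq S l | l <- s] K) ->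
  injective (prod_map vH vN s).
Proof.
move=> vH_inj vN_inj vNS mu_inj.
suff [j j_inj jE] : exists2 j : {linear prod_tens H N s -> tens_seq [seq S l | l <- s] K},
    injective j & forall x, mul_seq _ _ (j x) = prod_map vH vN s x.
  by move=> x y; rewrite -!jE => /mu_inj/j_inj.
elim: s {mu_inj} => [|l s [j j_inj jE]] /=.
  have vHK h : exists y, vH h = sub_val K y.
    by apply/sub_valP/KE; exists h.
  have [j jE] := linear_lift vHK; exists j => // x y xy.
  by apply: vH_inj; rewrite -!jE xy.
have vNS' n : exists y, vN l n = sub_val (S l) y by apply/sub_valP.
have [i iE] := linear_lift vNS'.
have i_inj : injective i by move=> x y xy; apply: (vN_inj l); rewrite -!iE xy.
exists (tmap i j); first exact: tmap_inj.
by apply: tens_ext; [by lin|by lin|] => n x; rewrite /= tmapE !tlift_mulE iE jE.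
Qed.

(** Connects the two descriptions of a component: the image of a tensor product of subspaces, as in
    [product_component], and the image of a projection. *)
Lemma lrange_mul_seq (p : forall l, nat -> {linear N l -> N l}) (i : I -> nat) s u :
  (forall l v, v \in S l <-> exists n, v = vN l (p l (i l) n)) ->
  u \in lrange (mul_seq [seq S l | l <- s] K) <->
    exists x, u = prod_map vH vN s (prod_proj H p s i x).
Proof.
move=> SE.
suff [to_prod to_seq] :
  (forall y, exists x, mul_seq [seq S l | l <- s] K y = prod_map vH vN s (prod_proj H p s i x)) /\
  (forall x, exists y, mul_seq [seq S l | l <- s] K y = prod_map vH vN s (prod_proj H p s i x)).
  split=> [/asboolP[y ->]|[x ->]]; first by apply: to_prod.
  by apply/asboolP; have [y <-] := to_seq x; exists y.
elim: s => [|l s [to_prod to_seq]] /=.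
  split=> [y|x]; first by apply/KE; apply: valP.
  have /sub_valP[y ->] : vH x \in K by apply/KE; exists x.
  by exists y.
split; apply: tens_ind => [a b||x y [x' xE] [y' yE]].
- have [n nE] : exists n, sub_val (S l) a = vN l (p l (i l) n) by apply/SE; apply: valP.
  by have [x xE] := to_prod b; exists (n *t x); rewrite tmapE !tlift_mulE nE xE.
- by exists 0; rewrite !linear0.
- by exists (x' + y'); rewrite [LHS]linearD /= xE yE !linearD.
- have /sub_valP[c cE] : vN l (p l (i l) a) \in S l by apply/SE; exists a.
  by have [y yE] := to_seq b; exists (c *t y); rewrite tmapE !tlift_mulE -cE yE.
- by exists 0; rewrite !linear0.
- by exists (x' + y'); rewrite [LHS]linearD /= xE yE !linearD.
Qed.

End MulSeq.

Lemma sub_hopf_map (k : fieldType) (U : hopfAlgType k) (S : hopfSub U) :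
  hopf_map (sub_val S).
Proof. by split=> // x; rewrite -sub_comulE. Qed.

Lemma hopf_morphism_map (k : fieldType) (A B : hopfAlgType k) (f : {lrmorphism A -> B}) :
  hopf_morphism f -> hopf_map f.
Proof. by case=> comul_f counit_f antipode_f; split=> //; [exact: rmorph1|exact: rmorphM]. Qed.

Theorem theorem3p4 (k : closedFieldType) (char_k : [pchar k] =i pred0)
    (U : hopfAlgType k) (H : hopfSub U)
    (T : nat) (T_gt0 : (0 < T)%N) (N : 'I_T -> subalgClosed U)
    (mu_bij : bijective
      (mul_seq [seq (N l : submodClosed U) | l <- enum 'I_T] H))
    (A : 'I_T -> hopfSub U)
    (A_def : forall l, A l =i lrange (mul_seq [:: N l : submodClosed U] H))
    (pi : forall l, {lrmorphism sub_of (A l) -> sub_of H})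
    (pi_def : forall l (a : sub_of (A l)) n h, n \in N l -> h \in H ->
      val a = n * h -> val (pi l a) = (counit n : k) *: h)
    (pi_hopf : forall l, hopf_morphism (pi l))
    (N_coinv : forall l x, x \in N l <->
      exists2 a : sub_of (A l), val a = x & coinvariant (pi l) a)
    (H_cosemisimple : cosemisimple (sub_of H))
    (B : forall l, ydHopf (sub_of H) (sub_of (N l)))
    (B_def : forall l, induced_ydHopf (pi l) (B l))
    (F : forall l, nat -> submodClosed (sub_of (N l)))
    (F_graded : forall l, coradically_graded_ydHopf (B l) (F l)) :
  coradically_graded (@total_degree T) (product_component H F).
Proof.
have vH_inj : injective (sub_val H) by exact: val_inj.
have vN_inj l : injective (sub_val (N l)) by exact: val_inj.
have vH_hopf := sub_hopf_map H.
have HE u : u \in (H : submodClosed U) <-> exists h, u = sub_val H h.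
  exact: sub_valP.
have mu_inj : injective (prod_map (sub_val H) (fun l => sub_val (N l)) (enum 'I_T)).
  apply: (prod_map_inj (S := fun l => N l) HE) => //; last exact: bij_inj.
  by move=> l n; apply: (valP n).
have NA l (n : sub_of (N l)) : exists a : sub_of (A l), sub_val (N l) n = sub_val (A l) a.
  apply/sub_valP; rewrite A_def; apply/asboolP; exists (n *t (1 : sub_of H)).
  by rewrite /= tlift_mulE mulr1.
have ex_factor l : exists pE, smash_factor (sub_val H) (sub_val (N l)) (B l) pE.1 pE.2 /\
    forall i x, x \in F l i <-> exists y, x = pE.1 i y.
  suff [p [E pE]] : exists p E, smash_factor (sub_val H) (sub_val (N l)) (B l) p E /\
    forall i x, x \in F l i <-> exists y, x = p i y by exists (p, E).
  apply: (exists_smash_factor vH_hopf (sub_hopf_map (A l)) (hopf_morphism_map (pi_hopf l)))=> //.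
  - exact: val_inj.
  - exact: vN_inj.
  - exact: NA.
  - by move=> h n; exact: (induced_act (B_def l) h n).
  - by move=> n a aE; exact: (induced_coact (B_def l) aE).
  - by move=> n a aE; exact: (induced_comul (B_def l) aE).
  - apply: (prod_map_factor vH_inj B _ _ mu_inj) => //; by rewrite mem_enum.
  exact: F_graded.
pose p l := (projT1 (cid (ex_factor l))).1.
pose E l := (projT1 (cid (ex_factor l))).2.
have fN l : smash_factor (sub_val H) (sub_val (N l)) (B l) (p l) (E l).
  by rewrite /p /E; case: cid => /= ? [].
have FE l i x : x \in F l i <-> exists y, x = p l i y.
  by rewrite /p; case: cid => /= ? [].
clearbody p E.
have [D [act [P [sigma [sm _ M2 M3]]]]] := prod_smash_module vH_hopf (fun l => sf_grading (fN l)) fN mu_inj.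
have mu_surj u : exists x, u = prod_map (sub_val H) (fun l => sub_val (N l)) (enum 'I_T) x.
  have [g _ gK] := mu_bij.
  (* With identity maps in place of the graded projections, [lrange_mul_seq] compares the full
     images, and surjectivity carries over from [mul_seq]. *)
  have NE l v : v \in (N l : submodClosed U) <-> exists n, v = sub_val (N l) ((fun _ _ => idfun) l 0%N n).
    exact: sub_valP.
  have : u \in lrange (mul_seq [seq (N l : submodClosed U) | l <- enum 'I_T] H).
    by apply/asboolP; exists (g u); rewrite gK.
  move/(lrange_mul_seq HE (p := fun _ _ => idfun) (i := fun=> 0%N) _ _ NE) => [x ->].
  by eexists.
have GE (i : {ffun 'I_T -> nat}) u : u \in product_component H F i <->
    exists x, u = prod_map (sub_val H) (fun l => sub_val (N l)) (enum 'I_T)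
      (prod_proj (sub_of H) p (enum 'I_T) i x).
  apply: (lrange_mul_seq HE) => l v.
  split=> [/asboolP[x ->]|[n ->]].
    by have /FE[y yE] := valP x; exists y; rewrite -yE.
  have /sub_valP[x xE] : p l (i l) n \in F l (i l) by apply/FE; exists n.
  by apply/asboolP; exists x; rewrite xE.
apply: (product_coradically_graded vH_hopf H_cosemisimple fN _ _ mu_inj mu_surj GE sm M2 M3).
- exact: enum_uniq.
- by move=> l; rewrite mem_enum.
- by move=> i; rewrite /total_degree big_enum.
Qed.
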